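(* Let $p$ be an odd prime number, let $n$ be a positive integer divisible by $p$, and let $\zeta_n\in\mathbb{C}$ be a primitive $n$-th root of unity and $\zeta_p\in\mathbb{Q}(\zeta_n)$ a primitive $p$-th root of unity. Consider Nikshych's Hopf algebra $H_p$ as defined over $\mathbb{Q}(\zeta_n)$. Let $w\in\mathbb{Z}[\zeta_n]$ and $t\in\mathbb{C}$ be such that $w$ is invertible in $\mathbb{Z}[\zeta_n]$ and $t^2=w(\zeta_p-1)$. Assume that there is $d\in\mathbb{Z}[\zeta_n]$ such that $\frac12(d+t)\in\mathcal{O}_{\mathbb{Q}(\zeta_n,t)}$, the ring of integers of $\mathbb{Q}(\zeta_n,t)$. Then $H_p$ admits a $\mathbb{Q}(\zeta_n,t)/\mathbb{Q}(\zeta_n)$-form $H_p'$ which in turn admits a Hopf order over $\mathbb{Z}[\zeta_n]$.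
   Context: Forms: for a Galois extension $L/K$ and a Hopf algebra $H$ over $K$, an $L/K$-form of $H$ is a Hopf algebra $H'$ over $K$ such that $H'\otimes_KL\simeq H\otimes_KL$ as Hopf algebras over $L$. Nikshych's Hopf algebra $H_p$ over a field $K$ of characteristic $0$ containing $\zeta=\zeta_p$: as a $K$-algebra it is generated by $e_0,e_1,u_a,u_b,v_a,v_b,g$ with defining relations $e_0+e_1=1$, $e_0e_1=e_1e_0=0$; $u_a^p=u_b^p=e_0$, $e_0u_a=u_a$, $e_0u_b=u_b$, $u_au_b=u_bu_a$; $v_a^p=v_b^p=e_1$, $e_1v_a=v_a$, $e_1v_b=v_b$, $v_av_b=\zeta v_bv_a$; $g^2=1$, $gu_a=u_bg$, $gu_b=u_ag$, $gv_a=v_ag$, $gv_b=v_bg$. Its Hopf structure is: $\Delta(u_a)=u_a\otimes u_a+v_a\otimes v_a$, $\Delta(u_b)=u_b\otimes u_b+v_b\otimes v_b^{p-1}$, $\Delta(v_a)=u_a\otimes v_a+v_a\otimes u_a$, $\Delta(v_b)=u_b\otimes v_b+v_b\otimes u_b^{p-1}$; $\varepsilon(u_a)=\varepsilon(u_b)=1$, $\varepsilon(v_a)=\varepsilon(v_b)=0$; $S(u_a)=u_a^{p-1}$, $S(u_b)=u_b^{p-1}$, $S(v_a)=v_a^{p-1}$, $S(v_b)=v_b$; $\varepsilon(g)=1$, $S(g)=g$, and $$\Delta(g)=\tfrac{1}{p^2}\sum_{i,j,k,l}\zeta^{kj-il}gu_a^iu_b^j\otimes gu_a^ku_b^l+\tfrac1p\sum_{k,l}\zeta^{-(k+l)k}gu_a^ku_b^l\otimes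 gv_a^{k+l}v_b^{k+l}+\tfrac1p\sum_{k,l}\zeta^{k(k+l)}gv_a^{k+l}v_b^{(p-1)(k+l)}\otimes gu_a^ku_b^l+\tfrac1p\sum_{k,l}gv_a^kv_b^l\otimes gv_a^{(p-1)l}v_b^k,$$ indices running from $0$ to $p-1$, with $u_a^0=u_b^0=e_0$, $v_a^0=v_b^0=e_1$. It has dimension $4p^2$. Hopf order: for a finite-dimensional Hopf algebra $H$ over $K$ and a subring $R\subset K$, a Hopf order of $H$ over $R$ is a finitely generated projective $R$-submodule $X\subset H$ such that the natural map $X\otimes_RK\to H$ is an isomorphism, $1_H\in X$, $XX\subseteq X$, $\Delta(X)\subseteq X\otimes_RX$ (viewed inside $H\otimes_KH$), $\varepsilon(X)\subseteq R$ and $S(X)\subseteq X$. *)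

(* Defs.v *)
From HB Require Import structures.
From mathcomp Require Import all_boot all_algebra all_field.
From mathcomp Require Import ring_quotient freeg.
From mathcomp Require Import boolp.

Set Implicit Arguments.
Unset Strict Implicit.
Unset Printing Implicit Defensive.

Import GRing.Theory.
Local Open Scope ring_scope.
Local Open Scope quotient_scope.

Reserved Notation "x ⊗ y" (at level 40, left associativity).

Definition bilin (R : pzRingType) (M N P : lmodType R) (f : M -> N -> P) :=
  (forall y, linear (f^~ y)) /\ (forall x, linear (f x)).

Section LinearFacts.
Variables (R : pzRingType) (M N : lmodType R) (f : M -> N).
Hypothesis fL : linear f.

Lemma linear_fD x y : f (x + y) = f x + f y.
Proof. by have := fL 1 x y; rewrite !scale1r. Qed.

Lemma linear_f0 : f 0 = 0.
Proof. by apply: (addrI (f 0)); rewrite -linear_fD !addr0. Qed.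

Lemma linear_fZ a x : f (a *: x) = a *: f x.
Proof. by have := fL a x 0; rewrite linear_f0 !addr0. Qed.

End LinearFacts.

Section Tensor.
Variables (R : comNzRingType) (M N : lmodType R).

Local Notation free := {freeg (M * N)%type / R}.
Local Notation "<| x , y |>" := (<< 1 *g (x, y) >> : free)
  (at level 0, format "<| x ,  y |>").

Inductive tensor_null : free -> Prop :=
| tensor_null0 : tensor_null 0
| tensor_nullP a u v :
    tensor_null u -> tensor_null v -> tensor_null (a *: u + v)
| tensor_nullDl x x' y : tensor_null (<|x + x', y|> - (<|x, y|> + <|x', y|>))
| tensor_nullDr x y y' : tensor_null (<|x, y + y'|> - (<|x, y|> + <|x, y'|>))
| tensor_nullZl a x y : tensor_null (<|a *: x, y|> - a *: <|x, y|>)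
| tensor_nullZr a x y : tensor_null (<|x, a *: y|> - a *: <|x, y|>).

Definition tensor_null_pred : {pred free} := fun z => `[< tensor_null z >].

Fact tensor_null_submod : GRing.submod_closed tensor_null_pred.
Proof.
split=> [|a u v /asboolP nu /asboolP nv]; apply/asboolP.
  exact: tensor_null0.
exact: tensor_nullP.
Qed.

HB.instance Definition _ :=
  GRing.isSubmodClosed.Build R free tensor_null_pred tensor_null_submod.

Definition tensor : Type := Quotient.quot tensor_null_pred.

HB.instance Definition _ := GRing.Zmodule.on tensor.

Definition tensor_pi (z : free) : tensor := \pi_(Quotient.quot tensor_null_pred) z.

Fact tensor_pi_eq z z' : (tensor_pi z = tensor_pi z') <-> tensor_null (z - z').
Proof.
rewrite /tensor_pi; split=> [/eqP|nz].
  by rewrite piE Quotient.equivE => /asboolP.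
by apply/eqP; rewrite piE Quotient.equivE; apply/asboolP.
Qed.

Fact tensor_pi_zmod_morphism : zmod_morphism tensor_pi.
Proof. by move=> u v; rewrite /tensor_pi -raddfB. Qed.

HB.instance Definition _ :=
  GRing.isZmodMorphism.Build free tensor tensor_pi tensor_pi_zmod_morphism.

Fact tensor_piK (t : tensor) : tensor_pi (repr t) = t.
Proof. exact: reprK. Qed.

Definition tensor_scale (a : R) (t : tensor) : tensor :=
  tensor_pi (a *: repr t).

Fact tensor_piZ a z : tensor_pi (a *: z) = tensor_scale a (tensor_pi z).
Proof.
apply/tensor_pi_eq; rewrite -scalerBr -[_ *: _]addr0.
apply: tensor_nullP; last exact: tensor_null0.
by apply/tensor_pi_eq; rewrite tensor_piK.
Qed.

Fact tensor_scaleA a b t :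
  tensor_scale a (tensor_scale b t) = tensor_scale (a * b) t.
Proof. by rewrite -[t]tensor_piK -!tensor_piZ scalerA. Qed.

Fact tensor_scale1 : left_id 1 tensor_scale.
Proof. by move=> t; rewrite -[t]tensor_piK -!tensor_piZ scale1r. Qed.

Fact tensor_scaleDr : right_distributive tensor_scale +%R.
Proof.
move=> a t u; rewrite -[t]tensor_piK -[u]tensor_piK -raddfD -!tensor_piZ.
by rewrite scalerDr raddfD.
Qed.

Fact tensor_scaleDl t : {morph tensor_scale^~ t : a b / a + b}.
Proof.
by move=> a b; rewrite -[t]tensor_piK -!tensor_piZ scalerDl raddfD.
Qed.

HB.instance Definition _ := GRing.Zmodule_isLmodule.Build R tensor
  tensor_scaleA tensor_scale1 tensor_scaleDr tensor_scaleDl.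

Definition tens (x : M) (y : N) : tensor := tensor_pi <|x, y|>.

Local Notation "x ⊗ y" := (tens x y).

Lemma tensDl x x' y : (x + x') ⊗ y = x ⊗ y + x' ⊗ y.
Proof. by rewrite -raddfD; apply/tensor_pi_eq; apply: tensor_nullDl. Qed.

Lemma tensDr x y y' : x ⊗ (y + y') = x ⊗ y + x ⊗ y'.
Proof. by rewrite -raddfD; apply/tensor_pi_eq; apply: tensor_nullDr. Qed.

Lemma tensZl a x y : (a *: x) ⊗ y = a *: (x ⊗ y).
Proof.
by rewrite /tens [RHS]/GRing.scale /= -tensor_piZ;
   apply/tensor_pi_eq; apply: tensor_nullZl.
Qed.

Lemma tensZr a x y : x ⊗ (a *: y) = a *: (x ⊗ y).
Proof.
by rewrite /tens [RHS]/GRing.scale /= -tensor_piZ;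
   apply/tensor_pi_eq; apply: tensor_nullZr.
Qed.

Lemma tensor_ind (P : tensor -> Prop) :
    (forall x y, P (x ⊗ y)) -> (forall t u, P t -> P u -> P (t + u)) ->
  forall t, P t.
Proof.
move=> Ptens PD t; rewrite -[t]tensor_piK -[repr t]freeg_sumE raddf_sum /=.
have P0 : P 0.
  by have := Ptens (0 *: 0) 0; rewrite tensZl scale0r.
elim/big_ind: _ => // k _; case: k (coeff k _) => x y c.
have -> : << c *g (x, y) >> = c *: <|x, y|>.
  apply/eqP/freeg_eqP => k.
  by rewrite coeffZ !coeffU mul1r.
rewrite tensor_piZ.
by have := Ptens (c *: x) y; rewrite tensZl.
Qed.

Section Lift.
Variable P : lmodType R.

(* Meaningful only when f is bilinear. *)
Definition tlift (f : M -> N -> P) (t : tensor) : P :=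
  fglift (fun xy => f xy.1 xy.2) (repr t).

Variable f : M -> N -> P.
Hypothesis f_bilin : bilin f.
Let fl := f_bilin.1.
Let fr := f_bilin.2.

Let F := fglift (fun xy : M * N => f xy.1 xy.2).

Let FU c x y : F << c *g (x, y) >> = c *: f x y.
Proof. by rewrite /F liftU. Qed.

Let FB z z' : F (z - z') = F z - F z'.
Proof. by rewrite /F; apply: lift_is_additive. Qed.

Let F0 : F 0 = 0. Proof. by rewrite -(subrr 0) FB subrr. Qed.

Let FD z z' : F (z + z') = F z + F z'.
Proof. by rewrite -{1}[z']opprK FB -[- z']sub0r FB F0 sub0r opprK. Qed.

Let FZ c z : F (c *: z) = c *: F z.
Proof.
rewrite -[z]freeg_sumE.
elim: (dom z) => [|k s IH]; first by rewrite !big_nil scaler0 F0 scaler0.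
rewrite !big_cons scalerDr !FD scalerDr IH; congr (_ + _).
have -> : c *: << coeff k z *g k >> = << c * coeff k z *g k >>.
  by apply/eqP/freeg_eqP => j; rewrite coeffZ !coeffU mulrA.
by case: k => x y; rewrite !FU scalerA.
Qed.

Let fDl x x' y : f (x + x') y = f x y + f x' y.
Proof. by have := fl y 1 x x'; rewrite /= !scale1r. Qed.
Let fDr x y y' : f x (y + y') = f x y + f x y'.
Proof. by have := fr x 1 y y'; rewrite !scale1r. Qed.
Let fZl a x y : f (a *: x) y = a *: f x y.
Proof.
have f0 : f 0 y = 0 by apply: (addrI (f 0 y)); rewrite -fDl !addr0.
by have := fl y a x 0; rewrite /= f0 !addr0.
Qed.
Let fZr a x y : f x (a *: y) = a *: f x y.
Proof.
have f0 : f x 0 = 0 by apply: (addrI (f x 0)); rewrite -fDr !addr0.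
by have := fr x a y 0; rewrite /= f0 !addr0.
Qed.

Let F_null z : tensor_null z -> F z = 0.
Proof.
elim=> [|a u v _ Hu _ Hv|x x' y|x y y'|a x y|a x y].
- exact: F0.
- by rewrite FD FZ Hu Hv scaler0 addr0.
- by rewrite FB FD !FU /= !scale1r fDl subrr.
- by rewrite FB FD !FU /= !scale1r fDr subrr.
- by rewrite FB FZ !FU /= !scale1r fZl subrr.
by rewrite FB FZ !FU /= !scale1r fZr subrr.
Qed.

Let tlift_pi z : tlift f (tensor_pi z) = F z.
Proof.
apply/eqP; rewrite -subr_eq0 -[X in X - _]/(F _) -FB; apply/eqP/F_null.
by apply/tensor_pi_eq; rewrite tensor_piK.
Qed.

Lemma tlift_linear : linear (tlift f).
Proof.
move=> a t u; rewrite -[t in LHS]tensor_piK -[u in LHS]tensor_piK.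
rewrite [_ *: _]/GRing.scale /= -tensor_piZ -raddfD tlift_pi FD FZ.
by rewrite -!tlift_pi !tensor_piK.
Qed.

Lemma tliftE x y : tlift f (x ⊗ y) = f x y.
Proof. by rewrite /tens tlift_pi FU /= scale1r. Qed.

End Lift.
End Tensor.

Notation "x ⊗ y" := (tens x y) : ring_scope.

Section TensorLinear.
Variable R : comNzRingType.
Implicit Types M N P Q : lmodType R.

Lemma tens_bilin M N : bilin (@tens R M N).
Proof.
by split=> [y|x] a u v; rewrite ?tensDl ?tensDr ?tensZl ?tensZr.
Qed.

Lemma tensor_linear_eq M N P (f g : tensor M N -> P) :
  linear f -> linear g -> (forall x y, f (x ⊗ y) = g (x ⊗ y)) -> f =1 g.
Proof.
move=> fL gL fg; apply: tensor_ind => // t u eqt equ.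
by rewrite (linear_fD fL) (linear_fD gL) eqt equ.
Qed.

Lemma tlift_param M N P Q (f : Q -> M -> N -> P) t :
    (forall z, bilin (f z)) -> (forall x y, linear (fun z => f z x y)) ->
  linear (fun z => tlift (f z) t).
Proof.
move=> fb fL a u v; elim/tensor_ind: t => [x y|t t' IH IH'].
  by rewrite !tliftE // fL.
by rewrite !(linear_fD (tlift_linear (fb _))) IH IH' scalerDr addrACA.
Qed.

Lemma tlift_bilin M N M' N' P (f : M -> N -> M' -> N' -> P) :
    (forall x y, bilin (f x y)) -> (forall x' y', bilin (fun x y => f x y x' y')) ->
  bilin (fun t u => tlift (fun x y => tlift (f x y) u) t).
Proof.
move=> fb fb'.
have fbi u : bilin (fun x y => tlift (f x y) u).
  by split=> [y|x]; apply: tlift_param => // *; [exact: (fb' _ _).1|exact: (fb' _ _).2].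
split=> [u|t]; first exact: tlift_linear.
by apply: tlift_param => // x y; apply: tlift_linear.
Qed.

Definition tmap M N M' N' (f : M -> M') (g : N -> N') : tensor M N -> tensor M' N' :=
  tlift (fun x y => f x ⊗ g y).

Lemma tmap_bilin M N M' N' (f : M -> M') (g : N -> N') :
  linear f -> linear g -> bilin (fun x y => f x ⊗ g y).
Proof.
by move=> fL gL; split=> [y|x] a u v; rewrite (fL, gL) ((tens_bilin _ _).1, (tens_bilin _ _).2).
Qed.

Definition tassoc M N P : tensor (tensor M N) P -> tensor M (tensor N P) :=
  tlift (fun t z => tlift (fun x y => x ⊗ (y ⊗ z)) t).

Let tassoc_bilin_in M N P (z : P) : bilin (fun (x : M) (y : N) => x ⊗ (y ⊗ z)).
Proof. by split=> [y|x] a u v; rewrite ?(tensDl, tensDr, tensZl, tensZr). Qed.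

Let tassoc_bilin M N P :
  bilin (fun (t : tensor M N) (z : P) => tlift (fun x y => x ⊗ (y ⊗ z)) t).
Proof.
split=> [z|t]; first exact: (tlift_linear (@tassoc_bilin_in _ _ _ _)).
apply: tlift_param => [z|x y a u v]; first exact: tassoc_bilin_in.
by rewrite !(tensDr, tensZr).
Qed.

Lemma tmapE M N M' N' (f : M -> M') (g : N -> N') x y :
  linear f -> linear g -> tmap f g (x ⊗ y) = f x ⊗ g y.
Proof. by move=> fL gL; rewrite /tmap (tliftE (tmap_bilin fL gL)). Qed.

Lemma tmap_linear M N M' N' (f : M -> M') (g : N -> N') :
  linear f -> linear g -> linear (tmap f g).
Proof. by move=> fL gL; apply: (tlift_linear (tmap_bilin fL gL)). Qed.

Lemma tassocE M N P (x : M) (y : N) (z : P) : tassoc (x ⊗ y ⊗ z) = x ⊗ (y ⊗ z).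
Proof. by rewrite /tassoc (tliftE (@tassoc_bilin _ _ _)) (tliftE (@tassoc_bilin_in _ _ _ _)). Qed.

Lemma tassoc_linear M N P : linear (@tassoc M N P).
Proof. exact: (tlift_linear (@tassoc_bilin _ _ _)). Qed.

End TensorLinear.

Section TensorAlgebra.
Variables (R : comNzRingType) (A B : algType R).

Definition tensor_mul (t u : tensor A B) : tensor A B :=
  tlift (fun x y => tlift (fun x' y' => (x * x') ⊗ (y * y')) u) t.

Let mul_bilin : bilin tensor_mul.
Proof.
apply: tlift_bilin => [x y|x' y']; split=> [z|z] a u v /=.
- by rewrite mulrDr -scalerAr tensDl tensZl.
- by rewrite mulrDr -scalerAr tensDr tensZr.
- by rewrite mulrDl -scalerAl tensDl tensZl.
by rewrite mulrDl -scalerAl tensDr tensZr.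
Qed.

Lemma tensor_mulE x y x' y' :
  tensor_mul (x ⊗ y) (x' ⊗ y') = (x * x') ⊗ (y * y').
Proof.
have b1 z w : bilin (fun x' y' => (z * x') ⊗ (w * y') : tensor A B).
  split=> [?|?] a u v /=.
    by rewrite mulrDr -scalerAr tensDl tensZl.
  by rewrite mulrDr -scalerAr tensDr tensZr.
rewrite /tensor_mul tliftE ?tliftE //.
split=> [w|z]; apply: tlift_param => [z'|x1 y1 a u v]; rewrite ?mulrDl -?scalerAl //.
  by rewrite tensDl tensZl.
by rewrite tensDr tensZr.
Qed.

Fact tensor_mulDl : left_distributive tensor_mul +%R.
Proof. by move=> t u v; apply: (linear_fD (mul_bilin.1 _)). Qed.

Fact tensor_mulDr : right_distributive tensor_mul +%R.
Proof. by move=> t u v; apply: (linear_fD (mul_bilin.2 _)). Qed.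

Fact tensor_mulA : associative tensor_mul.
Proof.
move=> t u v; elim/tensor_ind: t => [x y|t t' IH IH']; last by rewrite !tensor_mulDl IH IH'.
elim/tensor_ind: u => [x' y'|u u' IH IH']; last by rewrite !(tensor_mulDl, tensor_mulDr) IH IH'.
elim/tensor_ind: v => [x2 y2|v v' IH IH']; last by rewrite !tensor_mulDr IH IH'.
by rewrite !tensor_mulE !mulrA.
Qed.

Fact tensor_mul1 : left_id (1 ⊗ 1) tensor_mul.
Proof.
move=> t; elim/tensor_ind: t => [x y|t t' IH IH']; last by rewrite tensor_mulDr IH IH'.
by rewrite tensor_mulE !mul1r.
Qed.

Fact tensor_mulr1 : right_id (1 ⊗ 1) tensor_mul.
Proof.
move=> t; elim/tensor_ind: t => [x y|t t' IH IH']; last by rewrite tensor_mulDl IH IH'.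
by rewrite tensor_mulE !mulr1.
Qed.

(* Only a pzRing: over a general R, A ⊗ B may be the zero ring. *)
HB.instance Definition _ := GRing.Zmodule_isPzRing.Build (tensor A B)
  tensor_mulA tensor_mul1 tensor_mulr1 tensor_mulDl tensor_mulDr.

Lemma tensM x y x' y' : (x ⊗ y) * (x' ⊗ y') = (x * x') ⊗ (y * y') :> tensor A B.
Proof. exact: tensor_mulE. Qed.

Lemma tens1 : 1 ⊗ 1 = 1 :> tensor A B.
Proof. by []. Qed.

Lemma tensor_scalerAl a (t u : tensor A B) : a *: (t * u) = a *: t * u.
Proof. by rewrite -(linear_fZ (mul_bilin.1 _)). Qed.

Lemma tensor_scalerAr a (t u : tensor A B) : a *: (t * u) = t * (a *: u).
Proof. by rewrite -(linear_fZ (mul_bilin.2 _)). Qed.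

End TensorAlgebra.

Record hopfAlgebra (K : comNzRingType) := HopfAlgebra {
  hopf_alg :> algType K;
  comult : {lrmorphism hopf_alg -> tensor hopf_alg hopf_alg};
  counit : {lrmorphism hopf_alg -> K^o};
  antipode : {linear hopf_alg -> hopf_alg};
  comultA : forall h, tassoc (tmap comult id (comult h)) = tmap id comult (comult h);
  counitl : forall h, tlift (fun x y => counit x *: y) (comult h) = h;
  counitr : forall h, tlift (fun x y => counit y *: x) (comult h) = h;
  antipodel : forall h, tlift (fun x y => antipode x * y) (comult h) = counit h *: 1;
  antipoder : forall h, tlift (fun x y => x * antipode y) (comult h) = counit h *: 1
}.

(* V regarded as an R-module along f : R -> S. *)
Definition restr (R S : comNzRingType) (f : {rmorphism R -> S}) (V : lmodType S) : Type := V.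

Section Restr.
Variables (R S : comNzRingType) (f : {rmorphism R -> S}) (V : lmodType S).

HB.instance Definition _ := GRing.Zmodule.on (restr f V).

Definition restr_scale (a : R) (v : restr f V) : restr f V := f a *: (v : V).

Fact restr_scaleA a b v : restr_scale a (restr_scale b v) = restr_scale (a * b) v.
Proof. by rewrite /restr_scale scalerA rmorphM. Qed.

Fact restr_scale1 : left_id 1 restr_scale.
Proof. by move=> v; rewrite /restr_scale rmorph1 scale1r. Qed.

Fact restr_scaleDr : right_distributive restr_scale +%R.
Proof. by move=> a u v; apply: scalerDr. Qed.

Fact restr_scaleDl v : {morph restr_scale^~ v : a b / a + b}.
Proof. by move=> a b; rewrite /restr_scale rmorphD; apply: scalerDl. Qed.

HB.instance Definition _ := GRing.Zmodule_isLmodule.Build R (restr f V)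
  restr_scaleA restr_scale1 restr_scaleDr restr_scaleDl.

Lemma restr_scaleE a (v : restr f V) : a *: v = (f a *: (v : V) : V).
Proof. by []. Qed.

End Restr.

(* H ⊗_K L, with L acting on the right-hand factor. *)
Definition base_change (K : comNzRingType) (L : comAlgType K) (H : hopfAlgebra K) : Type :=
  tensor H L.

Section BaseChange.
Variables (K : comNzRingType) (L : comAlgType K) (H : hopfAlgebra K).
Local Notation HL := (base_change L H).

HB.instance Definition _ := GRing.PzRing.on HL.

Definition base_change_scale (l : L) (t : HL) : HL :=
  tlift (fun (x : H) m => x ⊗ (l * m)) t.

Let scale_bilin (l : L) : bilin (fun (x : H) m => x ⊗ (l * m)).
Proof.
split=> [y|x] a u v; first by rewrite tensDl tensZl.
by rewrite mulrDr -scalerAr tensDr tensZr.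
Qed.

Let scale_linear l : linear (base_change_scale l : tensor H L -> tensor H L).
Proof. exact: tlift_linear. Qed.

Let scaleE l (x : H) m : base_change_scale l (x ⊗ m) = x ⊗ (l * m).
Proof. exact: tliftE. Qed.

Let scaleDr : right_distributive base_change_scale +%R.
Proof. by move=> l t u; apply: (linear_fD (scale_linear l)). Qed.

Let scaleA a b t :
  base_change_scale a (base_change_scale b t) = base_change_scale (a * b) t.
Proof.
elim/tensor_ind: t => [x m|t u IH IH']; last by rewrite !scaleDr IH IH'.
by rewrite !scaleE mulrA.
Qed.

Let scale1 : left_id 1 base_change_scale.
Proof.
elim/tensor_ind=> [x m|t u IH IH']; last by rewrite scaleDr IH IH'.
by rewrite scaleE mul1r.
Qed.

Let scaleDl t : {morph base_change_scale^~ t : a b / a + b}.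
Proof.
move=> a b; elim/tensor_ind: t => [x m|t u IH IH'].
  by rewrite !scaleE mulrDl tensDr.
by rewrite !scaleDr IH IH' addrACA.
Qed.

HB.instance Definition _ := GRing.Zmodule_isLmodule.Build L HL
  scaleA scale1 scaleDr scaleDl.

Lemma base_changeZ l x m : l *: (x ⊗ m : HL) = x ⊗ (l * m).
Proof. exact: scaleE. Qed.

Definition base_change_counit (t : HL) : L :=
  tlift (fun (x : H) m => counit H x *: m) t.

Let counit_bilin : bilin (fun (x : H) (m : L) => counit H x *: m).
Proof.
split=> [y|x] a u v; first by rewrite linearP scalerDl scalerA.
by rewrite scalerDr !scalerA mulrC.
Qed.

Let counitE x m : base_change_counit (x ⊗ m) = counit H x *: m.
Proof. exact: tliftE. Qed.

Let counitD t u : base_change_counit (t + u) = base_change_counit t + base_change_counit u.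
Proof. exact: (linear_fD (tlift_linear counit_bilin)). Qed.

Fact base_change_oner_neq0 : 1 != 0 :> HL.
Proof.
apply/eqP=> /(congr1 base_change_counit); rewrite -tens1 counitE rmorph1 scale1r.
have -> : base_change_counit 0 = 0 := linear_f0 (tlift_linear counit_bilin).
by apply/eqP; apply: oner_neq0.
Qed.

HB.instance Definition _ := GRing.PzSemiRing_isNonZero.Build HL base_change_oner_neq0.

Fact base_change_scalerAl l (t u : HL) : l *: (t * u) = l *: t * u.
Proof.
elim/tensor_ind: t => [x m|t t' IH IH']; last by rewrite mulrDl !scalerDr mulrDl IH IH'.
elim/tensor_ind: u => [x' m'|u u' IH IH']; last by rewrite !mulrDr scalerDr IH IH'.
by rewrite base_changeZ /= !tensM base_changeZ mulrA.
Qed.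

HB.instance Definition _ :=
  GRing.Lmodule_isLalgebra.Build L HL base_change_scalerAl.

Fact base_change_scalerAr l (t u : HL) : l *: (t * u) = t * (l *: u).
Proof.
elim/tensor_ind: t => [x m|t t' IH IH']; last by rewrite !mulrDl scalerDr IH IH'.
elim/tensor_ind: u => [x' m'|u u' IH IH']; last by rewrite !(mulrDr, scalerDr) IH IH'.
by rewrite base_changeZ /= !tensM base_changeZ mulrCA.
Qed.

HB.instance Definition _ :=
  GRing.Lalgebra_isAlgebra.Build L HL base_change_scalerAr.

Local Notation iota := (in_alg L).

Definition base_change_incl (x : H) : HL := x ⊗ 1.
Local Notation "x %:L" := (base_change_incl x) (at level 2, format "x %:L").

Let inclD x y : (x + y)%:L = x%:L + y%:L. Proof. exact: tensDl. Qed.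
Let inclZ a x : (a *: x)%:L = iota a *: x%:L.
Proof. by rewrite base_changeZ mulr1 /= /base_change_incl tensZl -tensZr. Qed.
Let inclM x y : (x * y)%:L = x%:L * y%:L.
Proof. by rewrite tensM mulr1. Qed.
Let incl1 : 1%:L = 1. Proof. by []. Qed.
Let inclE x l : x ⊗ l = l *: x%:L. Proof. by rewrite base_changeZ mulr1. Qed.

(* The canonical map H ⊗_K H -> (H ⊗_K L) ⊗_L (H ⊗_K L). *)
Definition base_change_tens (t : tensor H H) : tensor HL HL :=
  tlift (fun x y => x%:L ⊗ y%:L : restr iota (tensor HL HL)) t.
Local Notation kappa := base_change_tens.

Let kappa_bilin :
  bilin (fun x y : H => x%:L ⊗ y%:L : restr iota (tensor HL HL)).
Proof.
split=> [y|x] a u v; rewrite inclD inclZ.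
  by rewrite tensDl tensZl.
by rewrite tensDr tensZr.
Qed.

Let kappaE x y : kappa (x ⊗ y) = x%:L ⊗ y%:L.
Proof. exact: (tliftE kappa_bilin). Qed.
Let kappaD t u : kappa (t + u) = kappa t + kappa u.
Proof. exact: (linear_fD (tlift_linear kappa_bilin)). Qed.
Let kappaZ a t : kappa (a *: t) = iota a *: kappa t.
Proof. exact: (linear_fZ (tlift_linear kappa_bilin)). Qed.
Let kappa1 : kappa 1 = 1. Proof. by rewrite -tens1 kappaE. Qed.
Let kappaM t u : kappa (t * u) = kappa t * kappa u.
Proof.
elim/tensor_ind: t => [x m|t t' IH IH']; last by rewrite !(mulrDl, kappaD) IH IH'.
elim/tensor_ind: u => [x' m'|u u' IH IH']; last by rewrite !(mulrDr, kappaD) IH IH'.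
by rewrite tensM !kappaE tensM !inclM.
Qed.

Definition base_change_comult (t : HL) : tensor HL HL :=
  tlift (fun (x : H) (l : L) => l *: kappa (comult H x) : restr iota (tensor HL HL)) t.
Local Notation DeltaL := base_change_comult.

Let DeltaL_bilin :
  bilin (fun (x : H) (l : L) => l *: kappa (comult H x) : restr iota (tensor HL HL)).
Proof.
split=> [l|x] a u v.
  by rewrite linearP kappaD kappaZ scalerDr restr_scaleE !scalerA mulrC.
by rewrite scalerDl restr_scaleE scalerA /= -scalerAl mul1r.
Qed.

Let DeltaLE x l : DeltaL (x ⊗ l) = l *: kappa (comult H x).
Proof. exact: (tliftE DeltaL_bilin). Qed.
Let DeltaLD t u : DeltaL (t + u) = DeltaL t + DeltaL u.
Proof. exact: (linear_fD (tlift_linear DeltaL_bilin)). Qed.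
Let DeltaLZ l t : DeltaL (l *: t) = l *: DeltaL t.
Proof.
elim/tensor_ind: t => [x m|t u IH IH']; last by rewrite !(scalerDr, DeltaLD) IH IH'.
by rewrite base_changeZ !DeltaLE scalerA.
Qed.

Fact base_change_comult_linear : linear DeltaL.
Proof. by move=> a u v; rewrite DeltaLD DeltaLZ. Qed.

HB.instance Definition _ :=
  GRing.isLinear.Build L HL (tensor HL HL) _ DeltaL base_change_comult_linear.

Fact base_change_comult_monoid : monoid_morphism DeltaL.
Proof.
split=> [|t u]; first by rewrite -tens1 DeltaLE rmorph1 scale1r kappa1.
elim/tensor_ind: t => [x m|t t' IH IH']; last by rewrite !(mulrDl, DeltaLD) IH IH'.
elim/tensor_ind: u => [x' m'|u u' IH IH']; last by rewrite !(mulrDr, DeltaLD) IH IH'.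
rewrite tensM !DeltaLE rmorphM kappaM.
by rewrite -tensor_scalerAl -tensor_scalerAr scalerA.
Qed.

HB.instance Definition _ :=
  GRing.isMonoidMorphism.Build HL (tensor HL HL) DeltaL base_change_comult_monoid.

Fact base_change_counit_linear : scalar base_change_counit.
Proof.
move=> a u v; rewrite counitD; congr (_ + _).
elim/tensor_ind: u => [x m|t u IH IH']; last by rewrite !(scalerDr, counitD) IH IH' mulrDr.
by rewrite base_changeZ !counitE scalerAr.
Qed.

HB.instance Definition _ :=
  GRing.isLinear.Build L HL L^o _ base_change_counit base_change_counit_linear.

Fact base_change_counit_monoid : monoid_morphism (base_change_counit : HL -> L^o).
Proof.
split=> [|t u]; first by rewrite -tens1 counitE rmorph1 scale1r.
elim/tensor_ind: t => [x m|t t' IH IH']; last by rewrite !(mulrDl, counitD) IH IH'.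
elim/tensor_ind: u => [x' m'|u u' IH IH']; last by rewrite !(mulrDr, counitD) IH IH'.
have scaleM (a b : K) (y z : L) : (a * b) *: (y * z) = (a *: y) * (b *: z).
  by rewrite -scalerAl -scalerAr scalerA.
by rewrite tensM !counitE rmorphM; apply: scaleM.
Qed.

HB.instance Definition _ :=
  GRing.isMonoidMorphism.Build HL L^o base_change_counit base_change_counit_monoid.

Definition base_change_antipode (t : HL) : HL := tmap (antipode H) (@id L) t.
Local Notation SL := base_change_antipode.

Let idL (V : lmodType K) : linear (@id V). Proof. by []. Qed.
Let idLL (V : lmodType L) : linear (@id V). Proof. by []. Qed.
Let linP (R : pzRingType) (V W : lmodType R) (f : {linear V -> W}) : linear f.
Proof. exact: linearP. Qed.

Let SLE x l : SL (x ⊗ l) = antipode H x ⊗ l.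
Proof. exact: (tmapE _ _ (@linP _ _ _ (antipode H)) (@idL _)). Qed.
Let SLD t u : SL (t + u) = SL t + SL u.
Proof. exact: (linear_fD (tmap_linear (@linP _ _ _ (antipode H)) (@idL _))). Qed.

Fact base_change_antipode_linear : linear SL.
Proof.
move=> a u v; rewrite SLD; congr (_ + _).
elim/tensor_ind: u => [x m|t u IH IH']; last by rewrite !(scalerDr, SLD) IH IH'.
by rewrite base_changeZ !SLE base_changeZ.
Qed.

HB.instance Definition _ :=
  GRing.isLinear.Build L HL HL _ SL base_change_antipode_linear.

Let kappa3 (t : tensor H (tensor H H)) : tensor HL (tensor HL HL) :=
  tlift (fun x s => x%:L ⊗ kappa s : restr iota (tensor HL (tensor HL HL))) t.

Let kappa3_bilin :
  bilin (fun (x : H) s => x%:L ⊗ kappa s : restr iota (tensor HL (tensor HL HL))).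
Proof.
split=> [y|x] a u v; first by rewrite inclD inclZ tensDl tensZl.
by rewrite kappaD kappaZ tensDr tensZr.
Qed.

Let kappa3E x s : kappa3 (x ⊗ s) = x%:L ⊗ kappa s.
Proof. exact: (tliftE kappa3_bilin). Qed.
Let kappa3D t u : kappa3 (t + u) = kappa3 t + kappa3 u.
Proof. exact: (linear_fD (tlift_linear kappa3_bilin)). Qed.

Fact base_change_comultA t :
  tassoc (tmap DeltaL id (DeltaL t)) = tmap id DeltaL (DeltaL t).
Proof.
have lL := tmap_linear (@linP _ _ _ DeltaL) (@idLL HL).
have lR := tmap_linear (@idLL HL) (@linP _ _ _ DeltaL).
have lA := @tassoc_linear L HL HL HL.
elim/tensor_ind: t => [x l|t u IH IH']; last first.
  by rewrite !DeltaLD (linear_fD lL) (linear_fD lA) (linear_fD lR) IH IH'.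
rewrite !DeltaLE (linear_fZ lL) (linear_fZ lA) (linear_fZ lR); congr (_ *: _).
have kL := tmap_linear (@linP _ _ _ (comult H)) (@idL H).
have kR := tmap_linear (@idL H) (@linP _ _ _ (comult H)).
have kA := @tassoc_linear K H H H.
have DI y : DeltaL y%:L = kappa (comult H y) by rewrite DeltaLE scale1r.
have -> s : tassoc (tmap DeltaL id (kappa s)) = kappa3 (tassoc (tmap (comult H) id s)).
  elim/tensor_ind: s => [y z|s s' IH IH']; last first.
    rewrite kappaD (linear_fD lL) (linear_fD lA) IH IH' -kappa3D.
    by rewrite (linear_fD kL) (linear_fD kA).
  rewrite kappaE (tmapE _ _ (@linP _ _ _ DeltaL) (@idLL HL)) /= DI.
  rewrite (tmapE _ _ (@linP _ _ _ (comult H)) (@idL H)) /=.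
  elim/tensor_ind: (comult H y) => [a b|r r' IH IH'].
    by rewrite tassocE kappa3E !kappaE tassocE.
  by rewrite kappaD !tensDl (linear_fD lA) (linear_fD kA) kappa3D IH IH'.
have -> s : tmap id DeltaL (kappa s) = kappa3 (tmap id (comult H) s).
  elim/tensor_ind: s => [y z|s s' IH IH']; last first.
    by rewrite kappaD (linear_fD lR) IH IH' -kappa3D (linear_fD kR).
  rewrite kappaE (tmapE _ _ (@idLL HL) (@linP _ _ _ DeltaL)) /= DI.
  by rewrite (tmapE _ _ (@idL H) (@linP _ _ _ (comult H))) kappa3E.
by rewrite comultA.
Qed.

Let contract (f : H -> H -> H) (g : HL -> HL -> HL) :
    bilin f -> bilin g -> (forall x y, g x%:L y%:L = (f x y)%:L) ->
  forall (x : H) l, tlift g (DeltaL (x ⊗ l)) = l *: (tlift f (comult H x))%:L.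
Proof.
move=> fb gb gf x l; rewrite DeltaLE (linear_fZ (tlift_linear gb)).
congr (_ *: _); elim/tensor_ind: (comult H x) => [y z|r r' IH IH'].
  by rewrite kappaE !tliftE.
by rewrite kappaD (linear_fD (tlift_linear gb)) IH IH' (linear_fD (tlift_linear fb)) inclD.
Qed.

Let counit_incl x : base_change_counit x%:L = iota (counit H x).
Proof. by rewrite counitE. Qed.
Let antipode_incl x : SL x%:L = (antipode H x)%:L.
Proof. exact: SLE. Qed.

Fact base_change_counitl t : tlift (fun x y : HL => base_change_counit x *: y) (DeltaL t) = t.
Proof.
have gb : bilin (fun x y : HL => base_change_counit x *: y).
  split=> [y|x] a u v; first by rewrite linearP scalerDl scalerA.
  by rewrite scalerDr !scalerA mulrC.
elim/tensor_ind: t => [x l|t u IH IH'].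
  rewrite (@contract (fun x y => counit H x *: y)) // ?counitl -?inclE //.
    split=> [y|y] a u v; first by rewrite linearP scalerDl scalerA.
    by rewrite scalerDr !scalerA mulrC.
  by move=> y z; rewrite counit_incl inclZ.
by rewrite DeltaLD (linear_fD (tlift_linear gb)) IH IH'.
Qed.

Fact base_change_counitr t : tlift (fun x y : HL => base_change_counit y *: x) (DeltaL t) = t.
Proof.
have gb : bilin (fun x y : HL => base_change_counit y *: x).
  split=> [y|x] a u v; last by rewrite linearP scalerDl scalerA.
  by rewrite scalerDr !scalerA mulrC.
elim/tensor_ind: t => [x l|t u IH IH'].
  rewrite (@contract (fun x y => counit H y *: x)) // ?counitr -?inclE //.
    split=> [y|y] a u v; last by rewrite linearP scalerDl scalerA.
    by rewrite scalerDr !scalerA mulrC.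
  by move=> y z; rewrite counit_incl inclZ.
by rewrite DeltaLD (linear_fD (tlift_linear gb)) IH IH'.
Qed.

Let antipode_bilinl (R : comNzRingType) (A : algType R) (f : {linear A -> A}) :
  bilin (fun x y : A => f x * y).
Proof.
split=> [y|x] a u v; first by rewrite linearP mulrDl scalerAl.
by rewrite mulrDr scalerAr.
Qed.

Let antipode_bilinr (R : comNzRingType) (A : algType R) (f : {linear A -> A}) :
  bilin (fun x y : A => x * f y).
Proof.
split=> [y|x] a u v; first by rewrite mulrDl scalerAl.
by rewrite linearP mulrDr scalerAr.
Qed.

Let counit_scale1 (x : H) l : l *: (counit H x *: 1)%:L = base_change_counit (x ⊗ l) *: 1.
Proof. by rewrite inclZ incl1 scalerA counitE /= -scalerAr mulr1. Qed.

Fact base_change_antipodel t :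
  tlift (fun x y : HL => SL x * y) (DeltaL t) = base_change_counit t *: 1.
Proof.
have gb := @antipode_bilinl L HL SL.
elim/tensor_ind: t => [x l|t u IH IH'].
  rewrite (@contract (fun x y => antipode H x * y) _ (@antipode_bilinl K H (antipode H)) gb).
    by rewrite antipodel counit_scale1.
  by move=> y z; rewrite /= antipode_incl inclM.
by rewrite DeltaLD (linear_fD (tlift_linear gb)) IH IH' counitD scalerDl.
Qed.

Fact base_change_antipoder t :
  tlift (fun x y : HL => x * SL y) (DeltaL t) = base_change_counit t *: 1.
Proof.
have gb := @antipode_bilinr L HL SL.
elim/tensor_ind: t => [x l|t u IH IH'].
  rewrite (@contract (fun x y => x * antipode H y) _ (@antipode_bilinr K H (antipode H)) gb).
    by rewrite antipoder counit_scale1.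
  by move=> y z; rewrite /= antipode_incl inclM.
by rewrite DeltaLD (linear_fD (tlift_linear gb)) IH IH' counitD scalerDl.
Qed.

Definition base_change_hopf : hopfAlgebra L :=
  @HopfAlgebra L HL DeltaL base_change_counit SL
    base_change_comultA base_change_counitl base_change_counitr
    base_change_antipodel base_change_antipoder.

End BaseChange.

Definition hopf_iso (K : comNzRingType) (A B : hopfAlgebra K) : Prop :=
  exists f : {lrmorphism A -> B},
    [/\ bijective f,
        forall x, comult B (f x) = tmap f f (comult A x),
        forall x, counit B (f x) = counit A x
      & forall x, antipode B (f x) = f (antipode A x)].

(* An L/K-form of H; the extension L/K is meant to be Galois, which the
   isomorphism condition itself does not involve. *)
Definition is_form (K : fieldType) (L : fieldExtType K) (H H' : hopfAlgebra K) : Prop :=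
  hopf_iso (base_change_hopf L H') (base_change_hopf L H).

Section FinitelyGeneratedProjective.
Variables (R : comNzRingType) (M : lmodType R).

Definition finitely_generated : Prop :=
  exists (m : nat) (b : 'I_m -> M), forall x, exists c : 'I_m -> R, x = \sum_i c i *: b i.

Definition projective : Prop :=
  forall (N N' : lmodType R) (g : {linear N -> N'}) (f : {linear M -> N'}),
    (forall y, exists x, g x = y) -> exists h : {linear M -> N}, forall x, g (h x) = f x.

End FinitelyGeneratedProjective.

Definition subring (K : fieldType) (R : subringClosed K) : Type := {x : K | x \in R}.

Section Subring.
Variables (K : fieldType) (R : subringClosed K).
HB.instance Definition _ := SubChoice.on (subring R).
HB.instance Definition _ := [SubChoice_isSubComNzRing of subring R by <:].

Definition over_subring (V : lmodType K) : lmodType (subring R) :=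
  restr (\val : subring R -> K) V.

End Subring.

Definition submodule (R : comNzRingType) (V : lmodType R) (X : submodClosed V) : Type :=
  {x : V | x \in X}.

Section Submodule.
Variables (R : comNzRingType) (V : lmodType R) (X : submodClosed V).
HB.instance Definition _ := SubChoice.on (submodule X).
HB.instance Definition _ := [SubChoice_isSubLmodule of submodule X by <:].
End Submodule.

Section HopfOrder.
Variables (K : fieldType) (H : hopfAlgebra K) (R : subringClosed K).
Variable X : submodClosed (over_subring R H).

(* The natural map X ⊗_R K -> H. *)
Definition order_to_hopf : tensor (submodule X) (over_subring R K^o) -> H :=
  tlift (fun (x : submodule X) (k : over_subring R K^o) =>
           (k : K) *: (\val x : H) : over_subring R H).

(* X ⊗_R X is viewed inside H ⊗_K H through this map. *)
Definition order_tens_to_hopf :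
    tensor (submodule X) (submodule X) -> tensor H H :=
  tlift (fun x y : submodule X => (\val x : H) ⊗ (\val y : H) : over_subring R (tensor H H)).

Definition hopf_order : Prop :=
  (finitely_generated (submodule X) /\ projective (submodule X)) /\
  [/\ bijective order_to_hopf,
      (1 : H) \in X,
      (forall x y : H, x \in X -> y \in X -> x * y \in X)
    & [/\ (forall x : H, x \in X -> exists t, comult H x = order_tens_to_hopf t),
          (forall x : H, x \in X -> counit H x \in R)
        & (forall x : H, x \in X -> antipode H x \in X)]].

End HopfOrder.

Section IntAdjoin.
Variables (K : fieldType) (z : K).

Definition int_adjoin : {pred K} :=
  fun x => `[< exists q : {poly int}, x = (map_poly intr q).[z] >].

Fact int_adjoin_subring : subring_closed int_adjoin.
Proof.
split=> [|x y|x y].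
- by apply/asboolP; exists 1; rewrite rmorph1 hornerC.
- move=> /asboolP[q ->] /asboolP[r ->]; apply/asboolP.
  by exists (q - r); rewrite rmorphB /= hornerD hornerN.
move=> /asboolP[q ->] /asboolP[r ->]; apply/asboolP.
by exists (q * r); rewrite rmorphM /= hornerM.
Qed.

HB.instance Definition _ := GRing.isSubringClosed.Build K int_adjoin int_adjoin_subring.

End IntAdjoin.

Record nikshych_gens (A : Type) := NikshychGens {
  gen_e0 : A; gen_e1 : A; gen_ua : A; gen_ub : A; gen_va : A; gen_vb : A; gen_g : A
}.

Definition map_gens (A B : Type) (f : A -> B) (x : nikshych_gens A) : nikshych_gens B :=
  NikshychGens (f (gen_e0 x)) (f (gen_e1 x)) (f (gen_ua x)) (f (gen_ub x))
    (f (gen_va x)) (f (gen_vb x)) (f (gen_g x)).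

Section Nikshych.
Variables (K : fieldType) (p : nat) (zeta : K).

Definition nikshych_relations (A : algType K) (x : nikshych_gens A) : Prop :=
  let: NikshychGens e0 e1 ua ub va vb g := x in
  [/\ [/\ e0 + e1 = 1, e0 * e1 = 0 & e1 * e0 = 0],
      [/\ ua ^+ p = e0, ub ^+ p = e0, e0 * ua = ua, e0 * ub = ub & ua * ub = ub * ua],
      [/\ va ^+ p = e1, vb ^+ p = e1, e1 * va = va, e1 * vb = vb
        & va * vb = zeta *: (vb * va)]
    & [/\ g ^+ 2 = 1, g * ua = ub * g, g * ub = ua * g, g * va = va * g
        & g * vb = vb * g]].

(* A is generated by x with defining relations nikshych_relations. *)
Definition nikshych_presentation (A : algType K) (x : nikshych_gens A) : Prop :=
  [/\ nikshych_relations x,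
      (forall S : subalgClosed A,
         all [in S] [:: gen_e0 x; gen_e1 x; gen_ua x; gen_ub x; gen_va x; gen_vb x; gen_g x] ->
         forall a, a \in S)
    & (forall (B : algType K) (y : nikshych_gens B), nikshych_relations y ->
         exists f : {lrmorphism A -> B}, map_gens f x = y)].

(* In the blocks e0 A and e1 A the zeroth power is the block unit, not 1. *)
Definition block_exp (A : algType K) (e x : A) (i : nat) : A :=
  if i == 0%N then e else x ^+ i.

Definition nikshych_comult_g (A : algType K) (x : nikshych_gens A) : tensor A A :=
  let: NikshychGens e0 e1 ua ub va vb g := x in
  let gu i j := g * block_exp e0 ua i * block_exp e0 ub j in
  let gv i j := g * block_exp e1 va i * block_exp e1 vb j in
  (p%:R ^+ 2)^-1 *: (\sum_(i < p) \sum_(j < p) \sum_(k < p) \sum_(l < p)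
     zeta ^ ((k * j)%N%:Z - (i * l)%N%:Z) *: (gu i j ⊗ gu k l))
  + p%:R^-1 *: (\sum_(k < p) \sum_(l < p)
     zeta ^ (- ((k + l) * k)%N%:Z) *: (gu k l ⊗ gv (k + l)%N (k + l)%N))
  + p%:R^-1 *: (\sum_(k < p) \sum_(l < p)
     zeta ^ (k * (k + l))%N%:Z *: (gv (k + l)%N ((p - 1) * (k + l))%N ⊗ gu k l))
  + p%:R^-1 *: (\sum_(k < p) \sum_(l < p) gv k l ⊗ gv ((p - 1) * l)%N k).

Definition nikshych_costructure (H : hopfAlgebra K) (x : nikshych_gens H) : Prop :=
  let: NikshychGens e0 e1 ua ub va vb g := x in
  [/\ [/\ comult H ua = ua ⊗ ua + va ⊗ va,
          comult H ub = ub ⊗ ub + vb ⊗ vb ^+ (p - 1),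
          comult H va = ua ⊗ va + va ⊗ ua,
          comult H vb = ub ⊗ vb + vb ⊗ ub ^+ (p - 1)
        & comult H g = nikshych_comult_g x],
      [/\ counit H ua = 1, counit H ub = 1, counit H va = 0, counit H vb = 0
        & counit H g = 1]
    & [/\ antipode H ua = ua ^+ (p - 1), antipode H ub = ub ^+ (p - 1),
          antipode H va = va ^+ (p - 1), antipode H vb = vb & antipode H g = g]].

Definition is_nikshych (H : hopfAlgebra K) : Prop :=
  exists x : nikshych_gens H, nikshych_presentation x /\ nikshych_costructure x.

End Nikshych.

(* Main.v *)
Require Import Defs.
From HB Require Import structures.
From mathcomp Require Import all_boot all_algebra all_field cyclic.
From mathcomp Require Import boolp ring zify.

Set Implicit Arguments.
Unset Strict Implicit.
Unset Printing Implicit Defensive.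

Import GRing.Theory.
Local Open Scope ring_scope.

(** Write c = w (zeta_p - 1) = t^2. The units a = u_a + v_a and b = u_b + v_b of Nikshych's
algebra H have order p, and H is spanned by the elements e_k a^i b^j g^eps. There is an
involution psi of the Hopf algebra H which fixes e_0, e_1, g and inverts a and b
([nik_hopf_of_presentation]). Let G = (1 - psi) / 2. It defines a Z/2-grading, and the
form H' is H with the product of two odd elements multiplied by c and the coproduct
rescaled accordingly ([twist_hopf]). Multiplication of odd elements by t identifies H' with
H over L ([twist_is_form]); thus an element x of H appears in H'[t] as
x_0 + (x_1 / c) t.

A root of unity of order p is congruent to 1 modulo zeta_p - 1 = t^2 / w. Of a and b only
half as much is required: the order X is the smallest subalgebra of H' over R = Z[zeta_n]
that contains e_0, e_1, g and for which a and b are congruent to 1 modulo t in X[theta],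
where theta = (t + c delta) / 2 ([nik_order]). The hypothesis on (d + t) / 2 provides a delta
for which theta is integral over R ([cyclotomic_order_scalars]); as it speaks of arbitrary
algebraic integers, one needs that Z[zeta_n] is integrally closed at 2
([int_adjoin_closed_at2]).

The coproduct of g is g ⊗ g times, on each of the four blocks e_i ⊗ e_j, canonical
elements (1/p) sum q^(-kl) x^k y^l built from elements x and y of order p
([nik_comult_gE]). The key fact is that such an element is integral as soon as x and y are
congruent to 1 modulo t ([rmat_in]): expanding x^k by the q-binomial theorem gives
the sum of the terms (x - 1)...(x - q^(m-1)) (y - 1)...(y - q^(m-1)) divided by
(q - 1)...(q^m - 1) up to units, and each pair of factors in the numerator contributes
t^2 = c, an associate of q^i - 1. It follows that X is closed under comultiplication
([nik_order_comult]).

It remains to see that X is a finitely generated projective lattice. There is a trace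
tau on H that reads off the coefficients of e_0 and e_1 ([nik_trace]). The form c^(p-1) tau
takes values in R on X ([nik_order_trace]): X lies in the span of products of the elements
(a - 1)...(a - q^(m-1)) / t^m and their analogues for b. The Casimir element of this form
lies in the image of X ⊗ X, again by the integrality of canonical elements
([nik_order_dual]). Hence X has a finite dual basis, which shows that it is finitely
generated, projective, and spans H' ([nik_hopf_order]). *)

(** * Tensors and antipodes *)

Section TensorFacts.
Variables (R : comNzRingType) (M N P : lmodType R).

Lemma tlift_add (f : M -> N -> P) (fb : bilin f) : {morph tlift f : s t / s + t}.
Proof. exact: (linear_fD (tlift_linear fb)). Qed.

Lemma tlift_scale (f : M -> N -> P) (fb : bilin f) a t :
  tlift f (a *: t) = a *: tlift f t.
Proof. exact: (linear_fZ (tlift_linear fb)). Qed.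

Lemma bilinP (f : M -> N -> P) :
    (forall a x x' y, f (a *: x + x') y = a *: f x y + f x' y) ->
    (forall a x y y', f x (a *: y + y') = a *: f x y + f x y') ->
  bilin f.
Proof. by move=> fl fr; split=> [y|x] a u v; rewrite ?fl ?fr. Qed.

Lemma eq_tlift (f g : M -> N -> P) (t : tensor M N) :
  (forall x y, f x y = g x y) -> tlift f t = tlift g t.
Proof. by move=> fg; congr (tlift _ t); apply/funext=> x; apply/funext=> y. Qed.

Lemma tens0l (y : N) : (0 : M) ⊗ y = 0.
Proof. by rewrite -(scale0r (0 : M)) tensZl scale0r. Qed.

Lemma tens0r (x : M) : x ⊗ (0 : N) = 0.
Proof. by rewrite -(scale0r (0 : N)) tensZr scale0r. Qed.

Lemma tensBl (x x' : M) (y : N) : (x - x') ⊗ y = x ⊗ y - x' ⊗ y.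
Proof. by rewrite tensDl -scaleN1r tensZl scaleN1r. Qed.

Lemma tensBr (x : M) (y y' : N) : x ⊗ (y - y') = x ⊗ y - x ⊗ y'.
Proof. by rewrite tensDr -scaleN1r tensZr scaleN1r. Qed.

Lemma tens_suml I (r : seq I) (Q : pred I) (F : I -> M) y :
  (\sum_(i <- r | Q i) F i) ⊗ y = \sum_(i <- r | Q i) F i ⊗ y :> tensor M N.
Proof.
by elim/big_rec2: _ => [|i s t _ <-]; rewrite ?tens0l ?tensDl.
Qed.

End TensorFacts.

Lemma linear_tlift (R : comNzRingType) (M N P Q : lmodType R) (g : P -> Q) (f : M -> N -> P) t :
  linear g -> bilin f -> g (tlift f t) = tlift (fun x y => g (f x y)) t.
Proof.
move=> gL fb.
have gfb : bilin (fun x y => g (f x y)).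
  by split=> [y|x] a u v; rewrite (fb.1, fb.2) gL.
elim/tensor_ind: t => [x y|t u IH IH']; first by rewrite !tliftE.
by rewrite (tlift_add fb) (tlift_add gfb) (linear_fD gL) IH IH'.
Qed.

Lemma lin_linear (R : pzRingType) (U V : lmodType R) (f : {linear U -> V}) : linear f.
Proof. exact: linearP. Qed.

Lemma id_linear (R : pzRingType) (U : lmodType R) : linear (@id U).
Proof. by []. Qed.

Section Antipode.
Variables (K : comNzRingType) (H : hopfAlgebra K).
Local Notation S := (antipode H).
Local Notation Delta := (comult H).
Local Notation eps := (counit H).

Lemma tensMX (A B : algType K) (x : A) (y : B) n :
  (x ⊗ y) ^+ n = (x ^+ n) ⊗ (y ^+ n) :> tensor A B.
Proof. by elim: n => [|n IH]; rewrite ?expr0 // !exprS IH tensM. Qed.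

(* Iterated comultiplication, evaluated against a trilinear form; the two
   bracketings agree by coassociativity. *)
Lemma comultA_trilinear (M : lmodType K) (f : H -> H -> H -> M) h :
    (forall y z, linear (fun x => f x y z)) ->
    (forall x z, linear (fun y => f x y z)) ->
    (forall x y, linear (f x y)) ->
  tlift (fun x z => tlift (fun x1 x2 => f x1 x2 z) (Delta x)) (Delta h)
  = tlift (fun x y => tlift (fun y1 y2 => f x y1 y2) (Delta y)) (Delta h).
Proof.
move=> f1 f2 f3.
have b12 z : bilin (fun x y => f x y z) by split=> [y|x]; [apply: f1|apply: f2].
have b23 x : bilin (f x) by split=> [z|y]; [apply: f2|apply: f3].
have bl : bilin (fun x z => tlift (fun x1 x2 => f x1 x2 z) (Delta x)).
  split=> [z|x] a u v; first by rewrite linearP (tlift_linear (b12 z)).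
  by apply: (@tlift_param _ _ _ _ _ (fun z x y => f x y z)) => // ? ?; apply: f3.
have br : bilin (fun x y => tlift (f x) (Delta y)).
  split=> [y|x] a u v; last by rewrite linearP (tlift_linear (b23 x)).
  by apply: tlift_param => // ? ?; apply: f1.
pose F3 := tlift (fun x s => tlift (f x) s).
have b3 : bilin (fun x s => tlift (f x) s).
  split=> [s|x]; last exact: tlift_linear.
  by apply: tlift_param => // ? ?; apply: f1.
have kD := @lin_linear _ _ _ (comult H).
have kL := tmap_linear kD (@id_linear K (hopf_alg H)).
have kR := tmap_linear (@id_linear K (hopf_alg H)) kD.
have -> : tlift (fun x z => tlift (fun x1 x2 => f x1 x2 z) (Delta x)) (Delta h)
        = F3 (tassoc (tmap Delta id (Delta h))).
  elim/tensor_ind: (Delta h) => [x z|s t IH IH'].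
    rewrite tliftE // tmapE //.
    elim/tensor_ind: (Delta x) => [x1 x2|s t IH IH'].
      by rewrite tassocE /F3 !tliftE.
    by rewrite tensDl (linear_fD (@tassoc_linear _ _ _ _)) /F3 !tlift_add // IH IH'.
  rewrite tlift_add // IH IH' (linear_fD kL) (linear_fD (@tassoc_linear _ _ _ _)).
  by rewrite /F3 tlift_add.
rewrite comultA.
elim/tensor_ind: (Delta h) => [x y|s t IH IH'].
  by rewrite tmapE // /F3 !tliftE.
by rewrite (linear_fD kR) /F3 !tlift_add // -/F3 IH IH'.
Qed.


Let mulE a (x y z : H) : (a *: x + y) * z = a *: (x * z) + y * z.
Proof. by rewrite mulrDl scalerAl. Qed.
Let mulEr a (x y z : H) : z * (a *: x + y) = a *: (z * x) + z * y.
Proof. by rewrite mulrDr scalerAr. Qed.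
Let bS : bilin (fun x y : H => S x * y).
Proof. by apply: bilinP => *; rewrite ?linearP ?mulE ?mulEr. Qed.

Lemma antipode1 : S 1 = 1.
Proof.
have := @antipodel _ H 1; rewrite !rmorph1 -tens1 (tliftE bS) mulr1.
by rewrite scale1r.
Qed.

(* Convolution identity over the pair (e, f): S is the inverse of the identity at e f. *)
Let antipode_conv e f :
  tlift (fun e1 e2 => tlift (fun f1 f2 => S (e1 * f1) * e2 * f2) (Delta f)) (Delta e)
  = (eps e * eps f) *: 1.
Proof.
have <- : tlift (fun x y => S x * y) (Delta (e * f)) = (eps e * eps f) *: 1.
  by rewrite antipodel rmorphM.
rewrite rmorphM /=.
have b1 (x y : H) : bilin (fun f1 f2 => S (x * f1) * y * f2).
  by apply: bilinP => *; rewrite ?mulEr ?linearP ?mulE.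
have b2 t : bilin (fun e1 e2 => tlift (fun f1 f2 => S (e1 * f1) * e2 * f2) t).
  by split=> [y|x]; apply: tlift_param => // x' y' a u v; rewrite !(mulE, mulEr) ?linearP ?mulE.
elim/tensor_ind: (Delta e) => [x y|s t IH IH'].
  rewrite (tliftE (b2 _)); elim/tensor_ind: (Delta f) => [z w|s t IH IH'].
    by rewrite (tliftE (b1 _ _)) tensM (tliftE bS) mulrA.
  by rewrite mulrDr (tlift_add (b1 _ _)) (tlift_add bS) IH IH'.
by rewrite mulrDl (tlift_add (b2 _)) (tlift_add bS) IH IH'.
Qed.


Let bS' : bilin (fun x y : H => x * S y).
Proof. by apply: bilinP => *; rewrite ?linearP ?mulE ?mulEr. Qed.
Let bel : bilin (fun x y : H => eps x *: y).
Proof.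
by apply: bilinP => *; rewrite ?linearP ?scalerDl ?scalerDr ?scalerA // mulrC.
Qed.
Let ber : bilin (fun x y : H => eps y *: x).
Proof.
by apply: bilinP => *; rewrite ?linearP ?scalerDl ?scalerDr ?scalerA // mulrC.
Qed.

Ltac lin_mul := repeat intro; cbn beta; rewrite !(mulEr, linearP, mulE).

(** Both [fun x y => S (x * y)] and [fun x y => S y * S x] are convolution inverses
of the multiplication map on H ⊗ H, hence equal; the two ways of bracketing
S (x1 y1) x2 y2 S (y3) S (x3) carry out that comparison. *)
Lemma antipodeM x y : S (x * y) = S y * S x.
Proof.
pose W a b d := tlift (fun y' y3 => tlift (fun y1 y2 => S (a * y1) * b * y2 * S y3 * S d)
                    (Delta y')) (Delta y).
have WE a b d : W a b d = S (a * y) * b * S d.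
  rewrite /W (@comultA_trilinear _ (fun y1 y2 y3 => S (a * y1) * b * y2 * S y3 * S d));
    try by lin_mul.
  have gL : linear (fun z => S (a * z) * b * S d).
    by lin_mul.
  rewrite -[in RHS](counitr y) (linear_tlift _ gL ber).
  apply: eq_tlift => y1 y'.
  have gL1 : linear (fun z => S (a * y1) * b * z * S d).
    by lin_mul.
  transitivity (S (a * y1) * b * (eps y' *: 1) * S d); last first.
    by rewrite -!scalerAr mulr1 -!scalerAl linearZZ -!scalerAl.
  rewrite -antipoder (linear_tlift _ gL1 bS'); apply: eq_tlift => u v.
  by rewrite !mulrA.
have bW1 : linear (fun z => S (z * y)) by lin_mul.
transitivity (tlift (fun x1 x' => tlift (fun x2 x3 => W x1 x2 x3) (Delta x')) (Delta x)).
  rewrite -[in LHS](counitr x) (linear_tlift _ bW1 ber).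
  apply: eq_tlift => x1 x'.
  have gL : linear (fun z => S (x1 * y) * z) by lin_mul.
  transitivity (S (x1 * y) * (eps x' *: 1)).
    by rewrite -scalerAr mulr1 -scalerAl linearZZ.
  rewrite -antipoder (linear_tlift _ gL bS').
  by apply: eq_tlift => u v; rewrite WE mulrA.
rewrite -(@comultA_trilinear _ W);
  try by repeat intro; cbn beta; rewrite !WE !(mulEr, linearP, mulE).
have bSS (k : H) : linear (fun z => S z * S k) by lin_mul.
rewrite -[in RHS](counitl x).
have gL : linear (fun z => S y * S z) by lin_mul.
rewrite (linear_tlift _ gL bel); apply: eq_tlift => x' x3.
have gL1 : linear (fun z => S z * S (eps x' *: x3)) by lin_mul.
rewrite -[in RHS](counitl y) (linear_tlift _ gL1 bel).
have bW a b d : bilin (fun y' y3 => tlift (fun y1 y2 => S (a * y1) * b * y2 * S y3 * S d)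
                    (Delta y')).
  have bi z : bilin (fun y1 y2 => S (a * y1) * b * y2 * S z * S d) by split; lin_mul.
  split=> [z|y'] k u v; first by rewrite linearP (tlift_linear (bi z)).
  by apply: (@tlift_param _ _ _ _ _ (fun z y1 y2 => S (a * y1) * b * y2 * S z * S d)) => // ? ?; lin_mul.
pose Wt t a b := tlift (fun y' y3 => tlift (fun y1 y2 => S (a * y1) * b * y2 * S y3 * S x3)
                    (Delta y')) t.
have WtL a b : linear (fun t => Wt t a b) by apply: (tlift_linear (bW a b x3)).
have Wt_pure a b u v :
  Wt (u ⊗ v) a b = tlift (fun f1 f2 => S (a * f1) * b * f2) (Delta u) * (S v * S x3).
  have bi : bilin (fun f1 f2 => S (a * f1) * b * f2) by split; lin_mul.
  have gL2 : linear (fun z : H => z * (S v * S x3)) by lin_mul.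
  rewrite /Wt (tliftE (bW a b x3)) (linear_tlift _ gL2 bi).
  by apply: eq_tlift => f1 f2; rewrite !mulrA.
have WtB t : bilin (Wt t).
  split=> [b|a] k u v; elim/tensor_ind: t => [p q|s t IH IH'].
  - have bi b' : bilin (fun f1 f2 => S (b' * f1) * b * f2) by split; lin_mul.
    rewrite !Wt_pure -mulE; congr (_ * _).
    by apply: (@tlift_param _ _ _ _ _ (fun z f1 f2 => S (z * f1) * b * f2)) => // ? ?; lin_mul.
  - by rewrite !(linear_fD (WtL _ _)) IH IH' scalerDr addrACA.
  - have bi b' : bilin (fun f1 f2 => S (a * f1) * b' * f2) by split; lin_mul.
    rewrite !Wt_pure -mulE; congr (_ * _).
    by apply: (@tlift_param _ _ _ _ _ (fun z f1 f2 => S (a * f1) * z * f2)) => // ? ?; lin_mul.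
  - by rewrite !(linear_fD (WtL _ _)) IH IH' scalerDr addrACA.
rewrite -[LHS]/(tlift (Wt (Delta y)) (Delta x')).
have hL : linear (fun t => tlift (Wt t) (Delta x')) by exact: tlift_param.
have bR : bilin (fun y' y3 : H => S (eps y' *: y3) * S (eps x' *: x3)).
  split=> [z|z] k u v; first by rewrite (bel.1 z) linearP mulE.
  by rewrite (bel.2 z) linearP mulE.
elim/tensor_ind: (Delta y) => [u v|s t IH IH']; last first.
  by rewrite (linear_fD hL) (tlift_add bR) IH IH'.
rewrite (tliftE bR).
transitivity (tlift (fun e1 e2 => tlift (fun f1 f2 => S (e1 * f1) * e2 * f2) (Delta u)
       * (S v * S x3)) (Delta x')); first by apply: eq_tlift => a b; rewrite Wt_pure.
have gL3 : linear (fun z : H => z * (S v * S x3)) by lin_mul.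
have bi : bilin (fun e1 e2 => tlift (fun f1 f2 => S (e1 * f1) * e2 * f2) (Delta u)).
  have bi e1 e2 : bilin (fun f1 f2 => S (e1 * f1) * e2 * f2) by split; lin_mul.
  by split=> [z|z]; apply: tlift_param => // ? ?; lin_mul.
rewrite -(linear_tlift _ gL3 bi) antipode_conv -scalerAl mul1r.
by rewrite !linearZZ -scalerAl -scalerAr scalerA mulrC.
Qed.
End Antipode.

(* Tensor products may vanish; for a Hopf algebra the counits show that 1 ⊗ 1 is nonzero,
   which the ring structure demands. *)
Section TensorSquare.
Variables (K : fieldType) (H : hopfAlgebra K).

Fact tensor_square_neq0 : 1 != 0 :> tensor H H.
Proof.
have b : bilin (fun x y : H => counit H x * counit H y : K^o).
  apply: bilinP => *; rewrite linearP /=; first by rewrite mulrDl scalerAl.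
  by rewrite mulrDr scalerAr.
apply/eqP => /(congr1 (tlift (fun x y : H => counit H x * counit H y : K^o))).
rewrite -tens1 (tliftE b) rmorph1 mulr1 (linear_f0 (tlift_linear b)).
by move/eqP; rewrite oner_eq0.
Qed.

HB.instance Definition _ :=
  GRing.PzSemiRing_isNonZero.Build (tensor H H) tensor_square_neq0.
HB.instance Definition _ :=
  GRing.Lmodule_isLalgebra.Build K (tensor H H) (@tensor_scalerAl K H H).
HB.instance Definition _ :=
  GRing.Lalgebra_isAlgebra.Build K (tensor H H) (@tensor_scalerAr K H H).

End TensorSquare.

(** * Z/2-graded algebras and their twists *)

Section Grading.
Variables (K : fieldType) (A : algType K).

(** Splitting an element into its components is a linear map here, so that compatibility
with comultiplication, counit and antipode becomes an equation between linear maps. *)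
Record grading := Grading {
  odd_part :> {linear A -> A};
  odd_partK : forall x, odd_part (odd_part x) = odd_part x;
  odd_partM : forall x y,
    odd_part (x * y) = odd_part x * (y - odd_part y) + (x - odd_part x) * odd_part y
}.

Variable G : grading.

Definition homog (i : bool) (x : A) : Prop := G x = if i then x else 0.

Lemma homog_odd x : homog true (G x).
Proof. exact: odd_partK. Qed.

Lemma homog_even x : homog false (x - G x).
Proof. by rewrite /homog linearB /= odd_partK subrr. Qed.

Lemma homog_ind (P : A -> Prop) :
    (forall x y, P x -> P y -> P (x + y)) -> (forall i x, homog i x -> P x) ->
  forall x, P x.
Proof.
move=> PD Ph x; rewrite -[x](subrK (G x)); apply: PD.
  exact: Ph (homog_even x).
exact: Ph (homog_odd x).
Qed.

Lemma homogM i j x y : homog i x -> homog j y -> homog (i (+) j) (x * y).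
Proof.
rewrite /homog odd_partM => -> ->.
by case: i; case: j; rewrite ?subrr ?subr0 ?mulr0 ?mul0r ?addr0 ?add0r.
Qed.

Lemma homog0 i : homog i 0.
Proof. by rewrite /homog linear0; case: i. Qed.

(** With o the odd part of 1, the product rule applied to o 1 gives o o = 0, and applied to
1 1 it gives o = 2 o. *)
Lemma homog1 : homog false 1.
Proof.
rewrite /homog; set o := G 1.
have oo : o * o = 0.
  have := odd_partM G o 1; rewrite mulr1 odd_partK subrr mul0r addr0 -/o mulrBr mulr1.
  by move/eqP; rewrite eq_sym subr_eq addrC -subr_eq subrr eq_sym => /eqP.
have := odd_partM G 1 1; rewrite mulr1 -/o mulrBr mulrBl mulr1 mul1r oo subr0.
by move/eqP; rewrite -subr_eq subrr eq_sym => /eqP.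
Qed.

End Grading.

Section Twist.
Variables (K : fieldType) (A : algType K).

(** The cocycle defining the twist: the product of two odd elements is multiplied by c.
When c = t^2, multiplying the odd elements of A by t maps the twist isomorphically onto A. *)
Definition twist_coef (c : K) (i j : bool) : K := if i && j then c else 1.

Definition twist (G : grading A) (c : K) : Type := A.

Variables (G : grading A) (c : K).
Local Notation A' := (twist G c).

HB.instance Definition _ := GRing.Lmodule.copy A' A.

Definition twist_mul (x y : A') : A' :=
  (x : A) * (y : A) + (c - 1) *: (G x * G y).

Lemma twist_mulE i j (x y : A) : homog G i x -> homog G j y ->
  twist_mul x y = twist_coef c i j *: (x * y).
Proof.
rewrite /twist_mul /twist_coef /homog => -> ->.
case: i; case: j => /=; rewrite ?mul0r ?mulr0 ?scaler0 ?addr0 ?scale1r //.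
by rewrite scalerBl scale1r addrCA subrr addr0.
Qed.

Fact twist_mulDl : left_distributive twist_mul +%R.
Proof.
by move=> x y z; rewrite /twist_mul linearD /= !mulrDl scalerDr addrACA.
Qed.
Fact twist_mulDr : right_distributive twist_mul +%R.
Proof.
by move=> x y z; rewrite /twist_mul linearD /= !mulrDr scalerDr addrACA.
Qed.
Fact twist_mulZl a (x y : A') : a *: twist_mul x y = twist_mul (a *: x) y.
Proof.
rewrite /twist_mul linearZZ /= -!scalerAl scalerDr.
by rewrite !scalerA [a * _]mulrC.
Qed.
Fact twist_mulZr a (x y : A') : a *: twist_mul x y = twist_mul x (a *: y).
Proof.
rewrite /twist_mul linearZZ /= -!scalerAr scalerDr.
by rewrite !scalerA [a * _]mulrC.
Qed.

Fact twist_mul1 : left_id (1 : A) twist_mul.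
Proof. by move=> x; rewrite /twist_mul (homog1 G) mul0r scaler0 addr0 mul1r. Qed.
Fact twist_mulr1 : right_id (1 : A) twist_mul.
Proof. by move=> x; rewrite /twist_mul (homog1 G) mulr0 scaler0 addr0 mulr1. Qed.

Fact twist_mulA : associative twist_mul.
Proof.
have Dl : forall x y z, twist_mul (x + y) z = twist_mul x z + twist_mul y z := twist_mulDl.
have Dr : forall x y z, twist_mul x (y + z) = twist_mul x y + twist_mul x z := twist_mulDr.
move=> x y z; elim/(homog_ind (G := G)): x => [x x' IH IH'|i x hx].
  by rewrite (Dl x x') (Dl x x' y) (Dl (twist_mul x y)) IH IH'.
elim/(homog_ind (G := G)): y => [y y' IH IH'|j y hy].
  by rewrite (Dl y y') (Dr x y) (Dr x _ (twist_mul y' z)) (Dl (twist_mul x y)) IH IH'.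
elim/(homog_ind (G := G)): z => [z z' IH IH'|k z hz].
  by rewrite (Dr y z) (Dr x) (Dr _ z z') IH IH'.
rewrite (twist_mulE hx hy) (twist_mulE hy hz) -twist_mulZl -twist_mulZr.
rewrite (twist_mulE (homogM hx hy) hz) (twist_mulE hx (homogM hy hz)) !scalerA mulrA.
by congr (_ *: _); case: i {hx}; case: j {hy}; case: k {hz}; rewrite /twist_coef /= ?mulr1 ?mul1r.
Qed.

HB.instance Definition _ := GRing.Zmodule_isNzRing.Build A'
  twist_mulA twist_mul1 twist_mulr1 twist_mulDl twist_mulDr (oner_neq0 A).
HB.instance Definition _ := GRing.Lmodule_isLalgebra.Build K A' twist_mulZl.
HB.instance Definition _ := GRing.Lalgebra_isAlgebra.Build K A' twist_mulZr.

Lemma twistM i j (x y : A) : homog G i x -> homog G j y ->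
  (x : A') * (y : A') = twist_coef c i j *: (x * y).
Proof. exact: twist_mulE. Qed.

End Twist.

Section TensorGrading.
Variables (K : fieldType) (H : hopfAlgebra K) (G : grading H).
Local Notation ev x := (x - G x).

Let odd_linear : linear G. Proof. exact: linearP. Qed.
Let ev_linear : linear (fun x => ev x).
Proof. by move=> a u v; rewrite linearP opprD addrACA scalerBr. Qed.

(** The total degree on a tensor square: odd means exactly one odd leg. *)
Definition tens_odd (s : tensor H H) : tensor H H :=
  tmap G (fun x => ev x) s + tmap (fun x => ev x) G s.

Fact tens_odd_linear : linear tens_odd.
Proof.
move=> a s t; rewrite /tens_odd (tmap_linear odd_linear ev_linear).
by rewrite (tmap_linear ev_linear odd_linear) scalerDr addrACA.
Qed.

HB.instance Definition _ :=
  GRing.isLinear.Build K (tensor H H) (tensor H H) _ tens_odd tens_odd_linear.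

Lemma tens_oddD s t : tens_odd (s + t) = tens_odd s + tens_odd t.
Proof. exact: (linear_fD tens_odd_linear). Qed.

Lemma tens_odd_homog i j x y : homog G i x -> homog G j y ->
  tens_odd (x ⊗ y) = if i (+) j then x ⊗ y else 0.
Proof.
move=> hx hy; rewrite /tens_odd !tmapE // hx hy.
by case: i {hx}; case: j {hy}; rewrite /= ?subrr ?subr0 ?tens0l ?tens0r ?addr0 ?add0r.
Qed.

Local Opaque tens_odd.

Lemma tensor_homog_ind (P : tensor H H -> Prop) :
    (forall s t, P s -> P t -> P (s + t)) ->
    (forall i j x y, homog G i x -> homog G j y -> P (x ⊗ y)) ->
  forall s, P s.
Proof.
move=> PD Ph; apply: tensor_ind => // x y.
elim/(homog_ind (G := G)): x => [x x' IH IH'|i x hx]; first by rewrite tensDl; apply: PD.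
elim/(homog_ind (G := G)): y => [y y' IH IH'|j y hy]; first by rewrite tensDr; apply: PD.
exact: Ph hx hy.
Qed.

Fact tens_oddK s : tens_odd (tens_odd s) = tens_odd s.
Proof.
elim/tensor_homog_ind: s => [s t IH IH'|i j x y hx hy].
  by rewrite (tens_oddD s t) (tens_oddD (tens_odd s)) IH IH'.
rewrite !(tens_odd_homog hx hy); case: ifP => ij; last by rewrite linear0.
by rewrite (tens_odd_homog hx hy) ij.
Qed.

Fact tens_oddM s t :
  tens_odd (s * t) = tens_odd s * (t - tens_odd t) + (s - tens_odd s) * tens_odd t.
Proof.
elim/tensor_homog_ind: s => [s s' IH IH'|i j x y hx hy].
  rewrite mulrDl (tens_oddD (s * t)) (tens_oddD s s') IH IH' [- (tens_odd s + _)]opprD [X in _ = _ + X * _]addrACA.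
  by rewrite [X in _ = X + _]mulrDl [X in _ = _ + X]mulrDl addrACA.
elim/tensor_homog_ind: t => [t t' IH IH'|i' j' x' y' hx' hy'].
  rewrite mulrDr (tens_oddD (_ * t)) (tens_oddD t t') IH IH' [- (tens_odd t + _)]opprD [X in _ = _ * X + _]addrACA.
  by rewrite [X in _ = X + _]mulrDr [X in _ = _ + X]mulrDr addrACA.
rewrite tensM (tens_odd_homog (homogM hx hx') (homogM hy hy')).
rewrite (tens_odd_homog hx hy) (tens_odd_homog hx' hy') addbACA.
by case: (i (+) j); case: (i' (+) j');
  rewrite /= ?subrr ?subr0 ?mulr0 ?mul0r ?addr0 ?add0r ?tensM.
Qed.

Definition tens_grading : grading (tensor H H) := Grading tens_oddK tens_oddM.

Lemma homog_tens i j x y : homog G i x -> homog G j y ->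
  homog tens_grading (i (+) j) (x ⊗ y).
Proof. exact: tens_odd_homog. Qed.

(* A homogeneous tensor is a sum of pure tensors with homogeneous legs whose
   degrees add up to its own. *)
Lemma tens_grading_ind l (P : tensor H H -> Prop) :
    (forall s t, P s -> P t -> P (s + t)) ->
    (forall i j x y, homog G i x -> homog G j y -> i (+) j = l -> P (x ⊗ y)) ->
  forall s, homog tens_grading l s -> P s.
Proof.
move=> PD Ph s hs.
pose pr r := if l then tens_odd r else r - tens_odd r.
suff Ppr r : P (pr r).
  by have := Ppr s; rewrite /pr; move: hs; rewrite /homog /= => ->; case: (l); rewrite ?subr0.
elim/tensor_homog_ind: r => [r r' IH IH'|i j x y hx hy].
  suff -> : pr (r + r') = pr r + pr r' by apply: PD.
  rewrite /pr; case: (l); rewrite (tens_oddD r r') //. by rewrite [- (tens_odd r + _)]opprD addrACA.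
rewrite /pr (tens_odd_homog hx hy); have [ij|ij] := eqVneq (i (+) j) l.
  have := Ph _ _ _ _ hx hy ij; rewrite ij.
  by case: (l); rewrite ?subr0.
suff -> : (if l then if i (+) j then x ⊗ y else 0
          else x ⊗ y - (if i (+) j then x ⊗ y else 0)) = 0.
  by rewrite -(tens0l _ (0 : H)); apply: (Ph l false); rewrite ?addbF //; apply: homog0.
by move: ij; case: (l); case: (i (+) j); rewrite ?subrr.
Qed.

End TensorGrading.

(** * Twisting a Z/2-graded Hopf algebra *)

Section TensorTwist.
Variables (K : fieldType) (H : hopfAlgebra K) (G : grading H) (c : K).
Local Notation H' := (twist G c).

(** The comparison H ⊗ H -> H' ⊗ H'. The twist of H ⊗ H for its total degree differs
from H' ⊗ H' by the factor c on odd ⊗ odd, which has to be divided out. *)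
Definition tens_twist (s : tensor H H) : tensor H' H' :=
  tlift (fun x y : H => (x : H') ⊗ (y : H') + (c^-1 - 1) *: ((G x : H') ⊗ (G y : H'))) s.

Let bilin_tw : bilin (fun x y : H =>
  (x : H') ⊗ (y : H') + (c^-1 - 1) *: ((G x : H') ⊗ (G y : H'))).
Proof.
split=> [y|x] a u v; rewrite linearP.
  rewrite !tensDl !tensZl !scalerDr !scalerA [a * _]mulrC addrACA.
  by rewrite -!scalerA.
rewrite !tensDr !tensZr !scalerDr !scalerA [a * _]mulrC addrACA.
by rewrite -!scalerA.
Qed.

Fact tens_twist_linear : linear tens_twist.
Proof. exact: (tlift_linear bilin_tw). Qed.

HB.instance Definition _ :=
  GRing.isLinear.Build K (tensor H H) (tensor H' H') _ tens_twist tens_twist_linear.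

Lemma tens_twistD s t : tens_twist (s + t) = tens_twist s + tens_twist t.
Proof. exact: (linear_fD tens_twist_linear). Qed.

Lemma tens_twistE i j (x y : H) : homog G i x -> homog G j y ->
  tens_twist (x ⊗ y) = twist_coef c^-1 i j *: ((x : H') ⊗ (y : H')).
Proof.
rewrite /tens_twist (tliftE bilin_tw) /twist_coef /homog => -> ->.
case: i; case: j => /=; rewrite ?tens0l ?tens0r ?scaler0 ?addr0 ?scale1r //.
by rewrite scalerBl scale1r addrCA subrr addr0.
Qed.

Hypothesis c_neq0 : c != 0.

(** Up to the factor forced by the total degree, the comparison is multiplicative: the
cocycle c^(i j) of the total degree is the product of those of the legs and of the
coboundary of the rescaling. *)
Lemma tens_twistM i j s t :
  homog (tens_grading G) i s -> homog (tens_grading G) j t ->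
  tens_twist s * tens_twist t = twist_coef c i j *: tens_twist (s * t).
Proof.
move=> hs ht; elim/tens_grading_ind: hs => [s1 s2 IH IH'|i1 i2 x1 x2 hx1 hx2 ii].
  by rewrite mulrDl !tens_twistD mulrDl IH IH' scalerDr.
elim/tens_grading_ind: ht => [t1 t2 IH IH'|j1 j2 y1 y2 hy1 hy2 jj].
  by rewrite mulrDr !tens_twistD mulrDr IH IH' scalerDr.
rewrite tensM (tens_twistE hx1 hx2) (tens_twistE hy1 hy2).
rewrite (tens_twistE (homogM hx1 hy1) (homogM hx2 hy2)).
rewrite -tensor_scalerAl -tensor_scalerAr tensM (twistM _ hx1 hy1) (twistM _ hx2 hy2).
rewrite tensZl tensZr !scalerA -ii -jj; congr (_ *: _).
by move: i1 i2 j1 j2 {hx1 hx2 hy1 hy2 ii jj} => [] [] [] [];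
  rewrite /twist_coef /=; field.
Qed.

Lemma tens_twist1 : tens_twist 1 = 1.
Proof. by rewrite -tens1 (tens_twistE (homog1 G) (homog1 G)) scale1r. Qed.

End TensorTwist.

Section TwistHopf.
Variables (K : fieldType) (H : hopfAlgebra K) (G : grading H) (c : K).
Hypothesis c_neq0 : c != 0.
Hypothesis comult_odd : forall h, comult H (G h) = tens_odd G (comult H h).
Hypothesis counit_odd : forall h, counit H (G h) = 0.
Hypothesis antipode_odd : forall h, antipode H (G h) = G (antipode H h).
Local Notation H' := (twist G c).
Local Notation Delta := (comult H).
Local Notation tw := (tens_twist G c).

Let homog_comult i h : homog G i h -> homog (tens_grading G) i (Delta h).
Proof. by rewrite /homog /= -comult_odd => ->; case: i => //; rewrite linear0. Qed.

Let homog_antipode i h : homog G i h -> homog G i (antipode H h).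
Proof. by rewrite /homog -antipode_odd => ->; case: i => //; rewrite linear0. Qed.

Let homog_counit h : homog G true h -> counit H h = 0.
Proof. by rewrite /homog => <-. Qed.

Definition twist_comult (h : H') : tensor H' H' := tw (Delta h).

Fact twist_comult_linear : linear twist_comult.
Proof.
by move=> a u v; rewrite /twist_comult -tens_twist_linear; congr (tw _); exact: linearP.
Qed.

HB.instance Definition _ :=
  GRing.isLinear.Build K H' (tensor H' H') _ twist_comult twist_comult_linear.

Fact twist_comult_monoid : monoid_morphism twist_comult.
Proof.
split=> [|x y]; first by rewrite /twist_comult -[RHS](tens_twist1 G c); congr (tw _); exact: rmorph1.
have DD : {morph twist_comult : u v / u + v} := linear_fD twist_comult_linear.
elim/(homog_ind (G := G)): x => [x x' IH IH'|i x hx].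
  by rewrite -[x + x']/((x : H') + (x' : H')) mulrDl (DD (x : H')) (DD ((x : H') * y)) IH IH' mulrDl.
elim/(homog_ind (G := G)): y => [y y' IH IH'|j y hy].
  by rewrite -[y + y']/((y : H') + (y' : H')) mulrDr (DD (y : H')) (DD ((x : H') * (y : H'))) IH IH' mulrDr.
rewrite (twistM _ hx hy) (linear_fZ twist_comult_linear) /twist_comult.
rewrite (tens_twistM c_neq0 (homog_comult hx) (homog_comult hy)).
by congr (_ *: tw _); exact: rmorphM.
Qed.

HB.instance Definition _ :=
  GRing.isMonoidMorphism.Build H' (tensor H' H') twist_comult twist_comult_monoid.

Definition twist_counit (h : H') : K^o := counit H h.

Fact twist_counit_linear : linear twist_counit.
Proof. by move=> a u v; rewrite /twist_counit; exact: (linearP (counit H)). Qed.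

HB.instance Definition _ :=
  GRing.isLinear.Build K H' K^o _ twist_counit twist_counit_linear.

Fact twist_counit_monoid : monoid_morphism twist_counit.
Proof.
split=> [|x y]; first exact: (rmorph1 (counit H)).
rewrite /twist_counit [x * y]/GRing.mul /= /twist_mul.
rewrite (linear_fD (lin_linear (counit H))) (linear_fZ (lin_linear (counit H))) /=.
by rewrite !rmorphM /= counit_odd mul0r scaler0 addr0.
Qed.

HB.instance Definition _ :=
  GRing.isMonoidMorphism.Build H' K^o twist_counit twist_counit_monoid.

Definition twist_antipode (h : H') : H' := antipode H h.

Fact twist_antipode_linear : linear twist_antipode.
Proof. by move=> a u v; exact: (linearP (antipode H)). Qed.

HB.instance Definition _ :=
  GRing.isLinear.Build K H' H' _ twist_antipode twist_antipode_linear.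

(* A bilinear form which vanishes, or is rescaled by c, on odd ⊗ odd sees the
   comparison map only through that factor. *)
Let tlift_tw (M : lmodType K) (f : H -> H -> M) (f' : H' -> H' -> M) s :
    bilin f -> bilin f' ->
    (forall i j x y, homog G i x -> homog G j y -> f' x y = twist_coef c i j *: f x y) ->
  tlift f' (tw s) = tlift f s.
Proof.
move=> fb fb' ff.
elim/(tensor_homog_ind (G := G)): s => [s t IH IH'|i j x y hx hy].
  by rewrite tens_twistD (tlift_add fb') (tlift_add fb) IH IH'.
rewrite (tens_twistE c hx hy) (tlift_scale fb') (tliftE fb') (tliftE fb) (ff _ _ _ _ hx hy).
rewrite scalerA /twist_coef; case: ifP => _; rewrite ?mulVf ?mul1r ?scale1r //.
Qed.

Fact twist_counitl h : tlift (fun x y => twist_counit x *: y) (twist_comult h) = h.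
Proof.
rewrite -[RHS](counitl (h : H)); apply: tlift_tw.
- by apply: bilinP => *; rewrite ?linearP ?scalerDl ?scalerDr ?scalerA // mulrC.
- by apply: bilinP => *; rewrite ?linearP ?scalerDl ?scalerDr ?scalerA // mulrC.
move=> i j x y hx hy; rewrite /twist_coef; case: i hx => hx; last by rewrite scale1r.
by rewrite /twist_counit (homog_counit hx) !scale0r scaler0.
Qed.

Fact twist_counitr h : tlift (fun x y => twist_counit y *: x) (twist_comult h) = h.
Proof.
rewrite -[RHS](counitr (h : H)); apply: tlift_tw.
- by apply: bilinP => *; rewrite ?linearP ?scalerDl ?scalerDr ?scalerA // mulrC.
- by apply: bilinP => *; rewrite ?linearP ?scalerDl ?scalerDr ?scalerA // mulrC.
move=> i j x y hx hy; rewrite /twist_coef andbC; case: j hy => hy; last by rewrite scale1r.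
by rewrite /twist_counit (homog_counit hy) !scale0r scaler0.
Qed.

Let bilin_antipodel (A : algType K) (f : {linear A -> A}) : bilin (fun x y : A => f x * y).
Proof. by split=> [y|x] a u v; [rewrite linearP mulrDl scalerAl | rewrite mulrDr scalerAr]. Qed.
Let bilin_antipoder (A : algType K) (f : {linear A -> A}) : bilin (fun x y : A => x * f y).
Proof. by split=> [y|x] a u v; [rewrite mulrDl scalerAl | rewrite linearP mulrDr scalerAr]. Qed.

Fact twist_antipodel h :
  tlift (fun x y => twist_antipode x * y) (twist_comult h) = twist_counit h *: 1.
Proof.
rewrite -[RHS](antipodel (h : H)); apply: tlift_tw.
- exact: (@bilin_antipodel H (antipode H)).
- exact: (@bilin_antipodel H' twist_antipode).
by move=> i j x y hx hy; rewrite -(twistM _ (homog_antipode hx) hy).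
Qed.

Fact twist_antipoder h :
  tlift (fun x y => x * twist_antipode y) (twist_comult h) = twist_counit h *: 1.
Proof.
rewrite -[RHS](antipoder (h : H)); apply: tlift_tw.
- exact: (@bilin_antipoder H (antipode H)).
- exact: (@bilin_antipoder H' twist_antipode).
by move=> i j x y hx hy; rewrite -(twistM _ hx (homog_antipode hy)).
Qed.

(* The rescaling of a triple tensor: c^-1 for each pair of odd legs, up to the
   identity (i + j) k + i j = i (j + k) + j k of bits. *)
Let coef3 i j k := twist_coef c^-1 (i (+) j) k * twist_coef c^-1 i j.

Let hk i (x : H) : H := if i then G x else x - G x.
Let hk_linear i : linear (hk i).
Proof.
by case: i => a u v; rewrite /hk linearP // opprD addrACA scalerBr.
Qed.
Let hkE i j x : homog G i x -> hk j x = if i == j then x else 0.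
Proof. by rewrite /hk => ->; case: i; case: j; rewrite /= ?subrr ?subr0. Qed.

Let tw3 (s : tensor H (tensor H H)) : tensor H' (tensor H' H') :=
  \sum_(i : bool) \sum_(j : bool) \sum_(k : bool)
    coef3 i j k *: tmap (hk i : H -> H') (tmap (hk j : H -> H') (hk k : H -> H')) s.

Let tw3_linear : linear tw3.
Proof.
move=> a s t; rewrite /tw3 scaler_sumr -big_split; apply: eq_bigr => i _ /=.
rewrite scaler_sumr -big_split; apply: eq_bigr => j _ /=.
rewrite scaler_sumr -big_split; apply: eq_bigr => k _ /=.
rewrite (tmap_linear (hk_linear i) (tmap_linear (hk_linear j) (hk_linear k))).
by rewrite scalerDr !scalerA mulrC.
Qed.

Let tw3E i j k x y z : homog G i x -> homog G j y -> homog G k z ->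
  tw3 (x ⊗ (y ⊗ z)) = coef3 i j k *: ((x : H') ⊗ ((y : H') ⊗ (z : H'))).
Proof.
move=> hx hy hz; rewrite /tw3.
have E i' j' k' : tmap (hk i' : H -> H') (tmap (hk j' : H -> H') (hk k' : H -> H'))
     (x ⊗ (y ⊗ z)) = (hk i' x : H') ⊗ ((hk j' y : H') ⊗ (hk k' z : H')).
  have lj := tmap_linear (hk_linear j') (hk_linear k').
  by rewrite (tmapE _ _ (hk_linear i') lj) (tmapE _ _ (hk_linear j') (hk_linear k')).
rewrite (bigD1 i) //= (bigD1 j) //= (bigD1 k) //= E !(hkE _ hx) !(hkE _ hy) !(hkE _ hz).
rewrite !eqxx !big1 ?addr0 //= => [i' ni|j' nj|k' nk].
- rewrite big1 // => j' _; rewrite big1 // => k' _.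
  by rewrite E (hkE _ hx) eq_sym (negbTE ni) tens0l scaler0.
- by rewrite big1 // => k' _; rewrite E (hkE _ hy) [j == _]eq_sym (negbTE nj) tens0l tens0r scaler0.
by rewrite E (hkE _ hz) [k == _]eq_sym (negbTE nk) !tens0r scaler0.
Qed.

(** Both iterated comultiplications are the one of H followed by a rescaling that depends on
the degrees of the three legs alone and is symmetric in the bracketing. *)
Fact twist_comultA h :
  tassoc (tmap twist_comult id (twist_comult h)) = tmap id twist_comult (twist_comult h).
Proof.
have D0 : linear (comult H) by exact: linearP.
have kL := tmap_linear D0 (@id_linear K (hopf_alg H)).
have kR := tmap_linear (@id_linear K (hopf_alg H)) D0.
have kA := @tassoc_linear K H H H.
have lL := tmap_linear twist_comult_linear (@id_linear K H').
have lR := tmap_linear (@id_linear K H') twist_comult_linear.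
have lA := @tassoc_linear K H' H' H'.
have -> : tassoc (tmap twist_comult id (twist_comult h)) = tw3 (tassoc (tmap Delta id (Delta h))).
  rewrite {2}/twist_comult.
  elim/(tensor_homog_ind (G := G)): (Delta h) => [s t IH IH'|l k x y hx hy].
    rewrite (tens_twistD _ _ s) (linear_fD lL) (linear_fD lA) IH IH'.
    by rewrite (linear_fD kL) (linear_fD kA) (linear_fD tw3_linear).
  rewrite (tens_twistE c hx hy) (linear_fZ lL) (linear_fZ lA).
  rewrite (tmapE _ _ twist_comult_linear (@id_linear K H')).
  rewrite (tmapE _ _ D0 (@id_linear K (hopf_alg H))) /twist_comult.
  elim/tens_grading_ind: (homog_comult hx) => [s t IH IH'|i j x1 x2 h1 h2 <-].
    rewrite tens_twistD !tensDl (linear_fD lA) scalerDr IH IH'.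
    by rewrite (linear_fD kA) (linear_fD tw3_linear).
  rewrite (tens_twistE c h1 h2) tassocE (tw3E h1 h2 hy) tensZl.
  by rewrite (linear_fZ lA) scalerA tassocE.
have -> : tmap id twist_comult (twist_comult h) = tw3 (tmap id Delta (Delta h)).
  rewrite {2}/twist_comult.
  elim/(tensor_homog_ind (G := G)): (Delta h) => [s t IH IH'|i l x y hx hy].
    by rewrite (tens_twistD _ _ s) (linear_fD lR) IH IH' (linear_fD kR) (linear_fD tw3_linear).
  rewrite (tens_twistE c hx hy) (linear_fZ lR).
  rewrite (tmapE _ _ (@id_linear K H') twist_comult_linear).
  rewrite (tmapE _ _ (@id_linear K (hopf_alg H)) D0) /twist_comult.
  elim/tens_grading_ind: (homog_comult hy) => [s t IH IH'|j k y1 y2 h1 h2 <-].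
    by rewrite tens_twistD !tensDr scalerDr IH IH' (linear_fD tw3_linear).
  rewrite (tens_twistE c h1 h2) (tw3E hx h1 h2) tensZr scalerA; congr (_ *: _).
  by move: (i) (j) (k) => [] [] []; rewrite /coef3 /twist_coef /= ?mul1r ?mulr1.
by rewrite comultA.
Qed.

(** The grading is the eigenspace decomposition of an involution of the Hopf algebra, and
the construction is Galois descent along K[t]/(t^2 - c) with respect to that involution. *)
Definition twist_hopf : hopfAlgebra K :=
  @HopfAlgebra K H' twist_comult twist_counit twist_antipode
    twist_comultA twist_counitl twist_counitr twist_antipodel twist_antipoder.

End TwistHopf.

(** * The twist is a form *)

Section BaseChangeFacts.
Variables (K : comNzRingType) (L : comAlgType K) (H : hopfAlgebra K).
Local Notation HL := (base_change L H).
Local Notation kappa := (@base_change_tens K L H).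
Local Notation incl := (@base_change_incl K L H).

Lemma base_change_inclD x y : incl (x + y) = incl x + incl y.
Proof. exact: tensDl. Qed.

Lemma base_change_inclZ a x : incl (a *: x) = in_alg L a *: incl x.
Proof. by rewrite base_changeZ mulr1 /= /base_change_incl tensZl -tensZr. Qed.

Lemma base_change_inclE (x : H) l : x ⊗ l = l *: incl x.
Proof. by rewrite base_changeZ mulr1. Qed.

Let kappa_bilin :
  bilin (fun x y : H => incl x ⊗ incl y : restr (in_alg L) (tensor HL HL)).
Proof.
split=> [y|x] a u v; rewrite base_change_inclD base_change_inclZ.
  by rewrite tensDl tensZl.
by rewrite tensDr tensZr.
Qed.

Lemma base_change_tensE x y : kappa (x ⊗ y) = incl x ⊗ incl y.
Proof. exact: (tliftE kappa_bilin). Qed.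
Lemma base_change_tensD t u : kappa (t + u) = kappa t + kappa u.
Proof. exact: (linear_fD (tlift_linear kappa_bilin)). Qed.
Lemma base_change_tensZ a t : kappa (a *: t) = in_alg L a *: kappa t.
Proof. exact: (linear_fZ (tlift_linear kappa_bilin)). Qed.

Lemma base_change_comultE (x : H) (l : L) :
  base_change_comult (x ⊗ l : HL) = l *: kappa (comult H x).
Proof.
have b : bilin (fun (x : H) (l : L) =>
    l *: kappa (comult H x) : restr (in_alg L) (tensor HL HL)).
  split=> [m|y] a u v.
    by rewrite linearP base_change_tensD base_change_tensZ scalerDr restr_scaleE !scalerA mulrC.
  by rewrite scalerDl restr_scaleE scalerA /= -scalerAl mul1r.
exact: (tliftE b).
Qed.

Lemma base_change_counitE (x : H) (l : L) :
  base_change_counit (x ⊗ l : HL) = counit H x *: l.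
Proof.
apply: tliftE; split=> [m|y] a u v; first by rewrite linearP scalerDl scalerA.
by rewrite scalerDr !scalerA mulrC.
Qed.

Lemma base_change_antipodeE (x : H) (l : L) :
  base_change_antipode (x ⊗ l : HL) = antipode H x ⊗ l.
Proof. exact: (tmapE _ _ (lin_linear (antipode H)) (@id_linear K L)). Qed.

Lemma base_change_comultD :
  {morph @base_change_comult K L H : s t / s + t}.
Proof. exact: (linear_fD (@base_change_comult_linear K L H)). Qed.

Lemma base_change_counitD :
  {morph @base_change_counit K L H : s t / s + t}.
Proof. by move=> s t; have := @base_change_counit_linear K L H 1 s t; rewrite scale1r mul1r. Qed.

Lemma base_change_antipodeD :
  {morph @base_change_antipode K L H : s t / s + t}.
Proof. exact: (linear_fD (@base_change_antipode_linear K L H)). Qed.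

End BaseChangeFacts.

Section TwistForm.
Variables (K : fieldType) (L : fieldExtType K) (H : hopfAlgebra K) (G : grading H).
Variables (c : K) (t : L).
Hypothesis c_neq0 : c != 0.
Hypothesis comult_odd : forall h, comult H (G h) = tens_odd G (comult H h).
Hypothesis counit_odd : forall h, counit H (G h) = 0.
Hypothesis antipode_odd : forall h, antipode H (G h) = G (antipode H h).
Hypothesis t_sqr : t ^+ 2 = c%:A.
Local Notation H' := (twist G c).
Local Notation hH' := (twist_hopf c_neq0 comult_odd counit_odd antipode_odd).
Local Notation HL := (base_change_hopf L H).
Local Notation HL' := (base_change_hopf L hH').

Let t_neq0 : t != 0.
Proof.
apply/eqP=> t0; move: t_sqr; rewrite t0 expr0n /= => /esym/eqP.
by rewrite scaler_eq0 oner_eq0 orbF (negbTE c_neq0).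
Qed.

(* The odd part gets multiplied by u; at u = t this is the isomorphism to be found. *)
Let scal (u : L) (s : tensor H L) : tensor H L :=
  tlift (fun x l => x ⊗ l + G x ⊗ ((u - 1) * l)) s.

Let scal_bilin u : bilin (fun (x : H) (l : L) => x ⊗ l + G x ⊗ ((u - 1) * l)).
Proof.
split=> [l|x] a v w; first by rewrite linearP !tensDl !tensZl scalerDr addrACA.
by rewrite mulrDr -scalerAr !tensDr !tensZr scalerDr addrACA.
Qed.
Let scal_linear u : linear (scal u).
Proof. exact: (tlift_linear (scal_bilin u)). Qed.
Let scalD u : {morph scal u : x y / x + y}.
Proof. exact: (linear_fD (scal_linear u)). Qed.

Let deg (u : L) (i : bool) : L := if i then u else 1.

Let scalE u i (x : H) l : homog G i x -> scal u (x ⊗ l) = x ⊗ (deg u i * l).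
Proof.
rewrite /scal (tliftE (scal_bilin u)) /homog /deg => ->; case: i => /=.
  by rewrite -tensDr -{1}[l]mul1r -mulrDl addrCA subrr addr0.
by rewrite tens0l addr0 mul1r.
Qed.

Let scalK u : u != 0 -> cancel (scal u) (scal u^-1).
Proof.
move=> u0 s; elim/tensor_ind: s => [x l|s s' IH IH']; last by rewrite !scalD IH IH'.
elim/(homog_ind (G := G)): x => [x x' IH IH'|i x hx].
  by rewrite tensDl !scalD IH IH'.
rewrite (scalE _ _ hx) (scalE _ _ hx) mulrA /deg.
by case: i {hx}; rewrite ?mulr1 ?mulVf // mul1r.
Qed.

Let f (s : HL') : HL := scal t s.

Let fE i (x : H) l : homog G i x -> f ((x : hH') ⊗ l) = x ⊗ (deg t i * l).
Proof. exact: scalE. Qed.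
Let fD : {morph f : x y / x + y}.
Proof. exact: scalD. Qed.

Let HL'_ind (P : HL' -> Prop) :
    (forall s s', P s -> P s' -> P (s + s')) ->
    (forall i (x : H) l, homog G i x -> P ((x : hH') ⊗ l)) -> forall s, P s.
Proof.
move=> PD Ph; apply: tensor_ind => // x l.
elim/(homog_ind (G := G)): x => [x x' IH IH'|i x hx]; last exact: Ph hx.
rewrite -[x + x']/((x : hH') + (x' : hH')) tensDl; exact: PD.
Qed.

Fact twist_form_linear : linear f.
Proof.
move=> a s s'; rewrite fD; congr (_ + _).
elim/HL'_ind: s => [u v IH IH'|i x l hx]; first by rewrite scalerDr !fD IH IH' scalerDr.
by rewrite base_changeZ (fE _ hx) (fE _ hx) base_changeZ mulrCA.
Qed.

Fact twist_form_monoid : monoid_morphism f.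
Proof.
split=> [|u v]; first by rewrite -tens1 (fE _ (homog1 G)) mul1r.
elim/HL'_ind: u => [u u' IH IH'|i x l hx]; first by rewrite mulrDl !fD IH IH' mulrDl.
elim/HL'_ind: v => [v v' IH IH'|j y m hy]; first by rewrite mulrDr !fD IH IH' mulrDr.
rewrite (fE _ hx) (fE _ hy) !tensM -[(x : hH') * (y : hH')]/((x : H') * (y : H')).
rewrite (twistM c hx hy) tensZl [LHS](linear_fZ (scal_linear t)).
rewrite [X in _ *: X](fE _ (homogM hx hy)) -tensZr; congr (_ ⊗ _).
move: (i) (j) => [] [] /=; rewrite /deg /twist_coef /= ?scale1r; try by ring.
by rewrite mul1r -mulr_algl -t_sqr; ring.
Qed.

HB.instance Definition _ := GRing.isLinear.Build L HL' HL _ f twist_form_linear.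
HB.instance Definition _ := GRing.isMonoidMorphism.Build HL' HL f twist_form_monoid.

Let fL : linear f := twist_form_linear.
Let ffL := tmap_linear fL fL.

Let f_tens i s : homog (tens_grading G) i s ->
  deg t i *: base_change_tens L s = tmap f f (@base_change_tens K L hH' (tens_twist G c s)).
Proof.
elim/tens_grading_ind=> {s} [s s' IH IH'|j k y z hy hz <-].
  rewrite tens_twistD base_change_tensD (@base_change_tensD K L hH') scalerDr IH IH'.
  by rewrite [RHS](linear_fD ffL).
rewrite (tens_twistE c hy hz) (@base_change_tensZ K L hH') [RHS](linear_fZ ffL).
rewrite base_change_tensE (@base_change_tensE K L hH').
rewrite [X in _ = _ *: X](tmapE _ _ fL fL) (fE _ hy) (fE _ hz) !mulr1 !base_change_inclE.
rewrite tensZl tensZr !scalerA.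
congr (_ *: _); move: (j) (k) => [] [];
  rewrite /deg /twist_coef /= ?rmorph1 ?scale1r ?mul1r ?mulr1 //.
by rewrite -expr2 t_sqr -scalerAl mul1r scalerA mulVf // scale1r.
Qed.

Let f_comult s : base_change_comult (f s) = tmap f f (@base_change_comult K L hH' s).
Proof.
elim/HL'_ind: s => [s s' IH IH'|i x l hx].
  by rewrite fD !base_change_comultD IH IH' [RHS](linear_fD ffL).
rewrite (fE _ hx) !base_change_comultE.
rewrite [RHS](linear_fZ ffL) mulrC -scalerA; congr (_ *: _); apply: f_tens.
by move: hx; rewrite /homog /= -comult_odd => ->; case: (i) => //; rewrite linear0.
Qed.

Let f_counit s : base_change_counit (f s) = @base_change_counit K L hH' s.
Proof.
elim/HL'_ind: s => [s s' IH IH'|i x l hx].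
  by rewrite fD !base_change_counitD IH IH'.
rewrite (fE _ hx) !base_change_counitE.
case: i hx => hx; last by rewrite mul1r.
by move: (counit_odd x); rewrite hx -[counit hH' x]/(counit H x) => ->; rewrite !scale0r.
Qed.

Let f_antipode s : base_change_antipode (f s) = f (@base_change_antipode K L hH' s).
Proof.
elim/HL'_ind: s => [s s' IH IH'|i x l hx].
  by rewrite fD !base_change_antipodeD IH IH' -fD.
have hS : homog G i (antipode H x).
  by move: hx; rewrite /homog -antipode_odd => ->; case: (i) => //; rewrite linear0.
rewrite (fE _ hx) !base_change_antipodeE.
by rewrite [RHS](fE _ hS).
Qed.

(** Over L the odd part may be multiplied by t, and t^2 = c turns the twisted product and
coproduct into the original ones. *)
Lemma twist_is_form : is_form L H hH'.
Proof.
exists f; split=> [|s|s|s].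
- exists (scal t^-1); first exact: scalK t_neq0.
  by move=> s; have := scalK (invr_neq0 t_neq0) s; rewrite invrK.
- exact: f_comult.
- exact: f_counit.
exact: f_antipode.
Qed.

End TwistForm.

(** * Integrality of q-exponentials *)

Section SubalgebraPredicate.
Variables (K : fieldType) (R : subringClosed K).

(** Subalgebras over R are predicates: orders are built as smallest such predicates, and
membership is proved by exhibiting another one. *)
Record Rsubalg (A : algType K) (Y : A -> Prop) : Prop := MkRsubalg {
  Rsubalg1 : Y 1;
  RsubalgD : forall x y, Y x -> Y y -> Y (x + y);
  RsubalgM : forall x y, Y x -> Y y -> Y (x * y);
  RsubalgZ : forall r x, r \in R -> Y x -> Y (r *: x)
}.

Variables (A : algType K) (Y : A -> Prop).
Hypothesis YR : Rsubalg Y.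

Lemma Rsubalg0 : Y 0.
Proof. by rewrite -(scale0r (1 : A)); apply: (RsubalgZ YR); [exact: rpred0|exact: Rsubalg1]. Qed.

Lemma RsubalgN x : Y x -> Y (- x).
Proof. by rewrite -scaleN1r; apply: (RsubalgZ YR); rewrite rpredN rpred1. Qed.

Lemma RsubalgB x y : Y x -> Y y -> Y (x - y).
Proof. by move=> hx hy; apply: (RsubalgD YR) hx _; apply: RsubalgN. Qed.

Lemma RsubalgX x n : Y x -> Y (x ^+ n).
Proof.
move=> hx; elim: n => [|n IH]; rewrite ?expr0 ?exprS; first exact: Rsubalg1 YR.
exact: (RsubalgM YR).
Qed.

Lemma Rsubalg_scalar r : r \in R -> Y r%:A.
Proof. by move=> hr; apply: (RsubalgZ YR) hr _; apply: (Rsubalg1 YR). Qed.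

Lemma Rsubalg_sum I (s : seq I) (P : pred I) (F : I -> A) :
  (forall i, P i -> Y (F i)) -> Y (\sum_(i <- s | P i) F i).
Proof. by move=> hF; elim/big_ind: _ => //; [exact: Rsubalg0|exact: (RsubalgD YR)]. Qed.

End SubalgebraPredicate.

Section RootsOfUnity.
Variables (K : fieldType) (p : nat) (q : K).
Hypothesis q_prim : p.-primitive_root q.

Lemma prim_expr_neq1 i : (0 < i < p)%N -> q ^+ i != 1.
Proof.
case/andP=> i0 ip; rewrite -(prim_order_dvd q_prim).
by apply/negP=> /dvdn_leq; rewrite i0 leqNgt ip => /(_ isT).
Qed.

Lemma prim_neq0 : q != 0.
Proof.
apply/eqP=> q0; have := prim_expr_order q_prim.
by rewrite q0 expr0n -[p == 0]negbK -lt0n (prim_order_gt0 q_prim) => /eqP; rewrite eq_sym oner_eq0.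
Qed.

Lemma sum_prim_expr i : \sum_(k < p) (q ^+ i) ^+ k = (if (p %| i)%N then p%:R else 0).
Proof.
case: ifP => [/dvdnP[j ->]|ni].
  rewrite mulnC exprM (prim_expr_order q_prim) expr1n.
  by rewrite (eq_bigr (fun=> 1)) ?sumr_const ?card_ord // => k _; rewrite expr1n.
have : q ^+ i != 1 by rewrite -(prim_order_dvd q_prim) ni.
rewrite -subr_eq0 => n1; apply: (mulfI n1); rewrite mulr0.
by rewrite -subrX1 -exprM mulnC exprM (prim_expr_order q_prim) expr1n subrr.
Qed.

End RootsOfUnity.

Lemma sum_shift1 (V : zmodType) n (f : nat -> V) :
  f n = f 0%N -> \sum_(k < n) f k.+1 = \sum_(k < n) f k.
Proof.
case: n => [|n] fn; first by rewrite !big_ord0.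
by rewrite big_ord_recr /= fn addrC [RHS]big_ord_recl.
Qed.

Lemma sum_shift (V : zmodType) n (f : nat -> V) j :
  (forall k, f (k + n)%N = f k) -> \sum_(k < n) f (k + j)%N = \sum_(k < n) f k.
Proof.
move=> fn; elim: j => [|j IH]; first by apply: eq_bigr => k _; rewrite addn0.
rewrite -IH -(@sum_shift1 _ n (fun k => f (k + j)%N)); last by rewrite addnC fn.
by apply: eq_bigr => k _; rewrite addnS addSn.
Qed.

Section QNewton.
Variables (K : fieldType) (p : nat) (q : K) (B : algType K).
Hypothesis q_prim : p.-primitive_root q.
Hypothesis p_neq0 : p%:R != 0 :> K.

Let qn0 : q != 0 := prim_neq0 q_prim.

(** The canonical element of the pairing (x^k, y^l) |-> q^(kl) of two cyclic groups of
order p; it raises x to the power k on the eigenspace of y for q^k. *)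
Definition rmat (x y : B) : B :=
  p%:R^-1 *: \sum_(k < p) \sum_(l < p) q^-1 ^+ (k * l) *: (x ^+ k * y ^+ l).

Let kap m : K := \prod_(i < m) ((q ^+ i.+1 - 1) * q ^+ i)^-1.
Let A m (x : B) := \prod_(i < m) (x - (q ^+ i)%:A).
Let N m (z : K) : K := kap m * \prod_(i < m) (z - q ^+ i).

Let N0 z : N 0 z = 1. Proof. by rewrite /N /kap !big_ord0 mulr1. Qed.
Let NS m z : N m.+1 z = N m z * ((z - q ^+ m) / ((q ^+ m.+1 - 1) * q ^+ m)).
Proof. by rewrite /N /kap !big_ord_recr /=; ring. Qed.

Let N_eq0 m k : (k < m)%N -> N m (q ^+ k) = 0.
Proof.
by move=> km; rewrite /N (bigD1 (Ordinal km)) //= subrr mul0r mulr0.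
Qed.

Let N_pascal m z : (m.+1 < p)%N ->
  N m.+1 (q * z) = N m z + q ^+ m.+1 * N m.+1 z.
Proof.
move=> mp.
have E n : \prod_(i < n.+1) (q * z - q ^+ i) = (q * z - 1) * q ^+ n * \prod_(i < n) (z - q ^+ i).
  rewrite big_ord_recl expr0 -mulrA; congr (_ * _).
  elim: n => [|n IH]; first by rewrite !big_ord0 mulr1.
  by rewrite !big_ord_recr /= IH /bump /= !add1n !exprS; ring.
have n1 : q ^+ m.+1 - 1 != 0 by rewrite subr_eq0 (prim_expr_neq1 q_prim).
have qm : q ^+ m != 0 by rewrite expf_neq0.
rewrite [N m.+1 z]NS [in LHS]/N E /kap big_ord_recr -/(kap m) /= /N exprS.
rewrite exprS in n1.
by field; rewrite n1 qm.
Qed.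

Let A_S m x : x * A m x = A m.+1 x + q ^+ m *: A m x.
Proof.
rewrite /A big_ord_recr /= mulrBr -[in RHS]scalerAr mulr1 subrK.
elim: m => [|m IH]; first by rewrite !big_ord0 mulr1 mul1r.
rewrite !big_ord_recr /= mulrA IH -!mulrA; congr (_ * _).
by rewrite mulrBr mulrBl -scalerAr -scalerAl mulr1 mul1r.
Qed.

Let q_newton k x : (k < p)%N -> x ^+ k = \sum_(m < p) N m (q ^+ k) *: A m x.
Proof.
elim: k => [|k IH] kp.
  rewrite (bigD1 (Ordinal kp)) //= N0 /A big_ord0 scale1r big1 ?addr0 // => m.
  rewrite -(inj_eq val_inj) /= => m0.
  by rewrite N_eq0 ?lt0n ?scale0r.
rewrite exprS IH ?(ltnW kp) // mulr_sumr.
have p0 : p = p.-1.+1 by rewrite prednK // (leq_trans _ kp).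
transitivity (\sum_(m < p) N m (q ^+ k) *: A m.+1 x + \sum_(m < p) (q ^+ m * N m (q ^+ k)) *: A m x).
  rewrite -big_split; apply: eq_bigr => m _ /=.
  by rewrite -scalerAr A_S scalerDr scalerA [N _ _ * _]mulrC.
have kp' : (k < p.-1)%N by rewrite -ltnS -p0.
rewrite p0 big_ord_recr /= N_eq0 // scale0r addr0 big_ord_recl /= [RHS]big_ord_recl /=.
rewrite !N0 expr0 mul1r addrCA -big_split /=; congr (_ + _); apply: eq_bigr => m _.
rewrite /bump /= ?add1n [q ^+ k.+1]exprS N_pascal; last by rewrite {2}p0 ltnS ltn_ord.
by rewrite scalerDl.
Qed.

Section Eigen.
Variable y : B.
Hypothesis yp : y ^+ p = 1.
Let E k := p%:R^-1 *: \sum_(l < p) q^-1 ^+ (k * l) *: y ^+ l.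

Let E_eigen k : y * E k = q ^+ k *: E k.
Proof.
rewrite /E -scalerAr scalerA [_ * _^-1]mulrC -scalerA; congr (_ *: _).
rewrite mulr_sumr scaler_sumr.
rewrite -[RHS](@sum_shift1 _ p (fun l => q ^+ k *: (q^-1 ^+ (k * l) *: y ^+ l))).
  apply: eq_bigr => l _; rewrite -scalerAr -exprS scalerA mulnS exprD mulrA -exprMn.
  by rewrite mulfV // expr1n mul1r.
rewrite yp mulnC exprM muln0 exprVn (prim_expr_order q_prim) invr1 expr1n.
by rewrite !expr0.
Qed.

Let E_sum : \sum_(k < p) E k = 1.
Proof.
rewrite -scaler_sumr exchange_big /=.
have p0 := prim_order_gt0 q_prim.
rewrite (bigD1 (Ordinal p0)) //= [X in _ + X]big1 => [|l].
  rewrite addr0 (eq_bigr (fun=> 1)) => [|k _]; last by rewrite muln0 !expr0 scale1r.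
  by rewrite sumr_const card_ord -scaler_nat scalerA mulVf // scale1r.
rewrite -(inj_eq val_inj) /= => l0.
rewrite -scaler_suml.
have -> : \sum_(k < p) q^-1 ^+ (k * l) = (\sum_(k < p) (q ^+ (p - l)) ^+ k).
  apply: eq_bigr => k _; rewrite mulnC exprM; congr (_ ^+ _).
  apply: (mulfI (expf_neq0 l qn0)); rewrite -exprMn mulfV // expr1n -exprD.
  by rewrite subnKC ?(prim_expr_order q_prim) // ltnW.
rewrite (sum_prim_expr q_prim) ifN ?scale0r //.
have lp := ltn_ord l.
by apply/negP=> /dvdn_leq; lia.
Qed.

Let A_eigen m k : A m y * E k = \prod_(i < m) (q ^+ k - q ^+ i) *: E k.
Proof.
elim: m => [|m IH]; first by rewrite /A !big_ord0 mul1r scale1r.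
rewrite /A !big_ord_recr /= -mulrA mulrBl E_eigen -scalerAl mul1r -scalerBl.
by rewrite -scalerAr -/(A m y) IH scalerA mulrC.
Qed.

(** The q-binomial theorem expands x^k in the products (x - 1)(x - q)...(x - q^(m-1)); on
the eigenspace of y for q^k the coefficients are the same products in y. *)
Lemma rmat_q_newton x :
  rmat x y = \sum_(m < p) kap m *: (A m x * A m y).
Proof.
transitivity (\sum_(k < p) x ^+ k * E k).
  rewrite /rmat scaler_sumr; apply: eq_bigr => k _.
  rewrite /E -scalerAr; congr (_ *: _); rewrite mulr_sumr.
  by apply: eq_bigr => l _; rewrite scalerAr.
transitivity (\sum_(k < p) \sum_(m < p) kap m *: (A m x * (A m y * E k))).
  apply: eq_bigr => k _; rewrite [x ^+ k]q_newton // mulr_suml.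
  by apply: eq_bigr => m _; rewrite A_eigen -scalerAl -[in RHS]scalerAr scalerA.
rewrite exchange_big /=; apply: eq_bigr => m _.
by rewrite -scaler_sumr -!mulr_sumr E_sum mulr1.
Qed.

End Eigen.

Section Integrality.
Variables (R : subringClosed K) (L : B -> Prop) (LR : Rsubalg R L).
Variables (c : K) (t : B).
Hypothesis c_neq0 : c != 0.
Hypothesis tC : forall x, t * x = x * t.
Hypothesis tt : t * t = c%:A.
Hypothesis Lt : L t.
Hypothesis q_in : q \in R.
Hypothesis q1_c : (q - 1) / c \in R.
Hypothesis c_q1 : forall i, (0 < i < p)%N -> c / (q ^+ i - 1) \in R.

(** Congruence to 1 modulo t. A root of unity of p-power order in a commutative ring is
congruent to 1 modulo the primes above p; here this is what makes an element of order p
integral enough. *)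
Definition near1 (x : B) : Prop := exists2 u, L u & x = 1 + t * u.

Lemma near1M x y : near1 x -> near1 y -> near1 (x * y).
Proof.
move=> [u hu ->] [v hv ->]; exists (u + v + t * u * v); last first.
  rewrite mulrDl mul1r mulrDr mulr1 -!addrA; congr (_ + _).
  rewrite (mulrDr t u) (mulrDr t v) addrCA; congr (_ + (_ + _)).
  by rewrite -!mulrA; congr (_ * _); rewrite mulrA -tC -mulrA.
apply: (RsubalgD LR); first exact: (RsubalgD LR).
by apply: (RsubalgM LR) hv; apply: (RsubalgM LR).
Qed.

Lemma near1_1 : near1 1.
Proof. by exists 0; [exact: (Rsubalg0 LR)|rewrite mulr0 addr0]. Qed.

Lemma near1X x n : near1 x -> near1 (x ^+ n).
Proof.
move=> hx; elim: n => [|n IH]; rewrite ?expr0 ?exprS; first exact: near1_1.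
exact: near1M.
Qed.

Lemma near1_root : near1 q%:A.
Proof.
exists (t * ((q - 1) / c)%:A).
  by apply: (RsubalgM LR) Lt _; apply: (Rsubalg_scalar LR).
by rewrite mulrA tt -scalerAl mul1r scalerA mulrC divfK // -[X in X + _]scale1r -scalerDl addrC subrK.
Qed.

(** The two components of a unit along a central idempotent may be changed separately. *)
Lemma near1_glue e0 e1 x y : e0 + e1 = 1 -> L e0 -> L e1 -> near1 x -> near1 y ->
  near1 (e0 * x + e1 * y).
Proof.
move=> e01 h0 h1 [u hu ->] [v hv ->]; exists (e0 * u + e1 * v).
  by apply: (RsubalgD LR); apply: (RsubalgM LR).
by rewrite !mulrDr !mulr1 addrACA e01 !mulrA -!(tC e0) -!(tC e1).
Qed.

(** Each factor x - q^i is divisible by t, and t^2 = c cancels the denominators 1 - q^i. *)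
Lemma rmat_in x y : near1 x -> near1 y -> y ^+ p = 1 -> L (rmat x y).
Proof.
move=> hx hy yp; rewrite rmat_q_newton //; apply: (Rsubalg_sum LR) => m _.
have dvd i z : near1 z -> exists2 u, L u & z - (q ^+ i)%:A = t * u.
  move=> [u hu ->]; have [v hv ev] := near1X i near1_root.
  exists (u - v); first exact: (RsubalgB LR).
  have -> : (q ^+ i)%:A = 1 + t * v.
    by rewrite -ev; elim: (i) => [|j IH]; rewrite ?scale1r // !exprS -IH -scalerAl mul1r scalerA.
  by rewrite mulrBr opprD addrACA subrr add0r.
have dvdA j z : near1 z -> exists2 u, L u & A j z = t ^+ j * u.
  move=> hz; elim: j => [|j [u hu e]]; first by exists 1; [exact: (Rsubalg1 LR)|rewrite mulr1 /A big_ord0].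
  have [v hv ev] := dvd j z hz; exists (u * v); first exact: (RsubalgM LR).
  rewrite /A big_ord_recr /= -/(A j z) e ev exprSr -!mulrA; congr (_ * _).
  by rewrite [in LHS]mulrA -tC mulrA.
have [u hu ->] := dvdA m _ hx; have [v hv ->] := dvdA m _ hy.
have -> : t ^+ m * u * (t ^+ m * v) = c ^+ m *: (u * v).
  have tmC z : t ^+ m * z = z * t ^+ m.
    by elim: (nat_of_ord m) => [|j IH]; rewrite ?mulr1 ?mul1r // exprS -mulrA IH mulrA tC -mulrA.
  rewrite tmC !mulrA -[u * t ^+ m * t ^+ m]mulrA.
  have -> : t ^+ m * t ^+ m = (c ^+ m)%:A.
    rewrite -exprMn_comm // tt.
    by elim: (nat_of_ord m) => [|j IH]; rewrite ?scale1r // !exprS IH -scalerAl mul1r scalerA.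
  by rewrite -scalerAr mulr1 scalerAl.
rewrite scalerA; apply: (RsubalgZ LR); last exact: (RsubalgM LR).
have -> : c ^+ m = \prod_(i < m) c by rewrite prodr_const card_ord.
rewrite /kap -big_split /=; apply: rpred_prod => i _.
have -> : ((q ^+ i.+1 - 1) * q ^+ i)^-1 * c = c / (q ^+ i.+1 - 1) * q ^- i.
  by rewrite invfM mulrC mulrA.
apply: rpredM; first by apply: c_q1; rewrite /= (leq_ltn_trans _ (ltn_ord m)).
have -> : q ^- i = q ^+ (p - i).
  apply: (mulfI (expf_neq0 i qn0)); rewrite mulfV ?expf_neq0 // -exprD.
  by rewrite subnKC ?(prim_expr_order q_prim) // ltnW // (ltn_trans (ltn_ord i)).
exact: rpredX.
Qed.
End Integrality.
End QNewton.

(** * Adjoining a square root of c *)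

Section Quad.
Variables (K : fieldType) (A : algType K).

(** A[t] with t^2 = c, the pair (x, y) being x + y t. *)
Definition quad (c : K) : Type := (A * A)%type.

Variable c : K.
Local Notation Q := (quad c).

HB.instance Definition _ := GRing.Lmodule.copy Q (A * A)%type.

Definition quad_mul (x y : Q) : Q :=
  (x.1 * y.1 + c *: (x.2 * y.2), x.1 * y.2 + x.2 * y.1).

Let addE (x y x' y' : A) : (x, y) + (x', y') = (x + x', y + y') :> Q.
Proof. by []. Qed.
Let scaleE a (x y : A) : a *: ((x, y) : Q) = (a *: x, a *: y).
Proof. by []. Qed.

Fact quad_mulDl : left_distributive quad_mul +%R.
Proof.
move=> [x x'] [y y'] [z z']; rewrite addE /quad_mul /= addE !mulrDl scalerDr.
by rewrite addrACA [x * z' + _ + _]addrACA.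
Qed.
Fact quad_mulDr : right_distributive quad_mul +%R.
Proof.
move=> [x x'] [y y'] [z z']; rewrite addE /quad_mul /= addE !mulrDr scalerDr.
by rewrite addrACA [x * y' + _ + _]addrACA.
Qed.
Fact quad_mul1 : left_id ((1, 0) : Q) quad_mul.
Proof. by case=> x y; rewrite /quad_mul /= !mul1r !mul0r scaler0 !addr0. Qed.
Fact quad_mulr1 : right_id ((1, 0) : Q) quad_mul.
Proof. by case=> x y; rewrite /quad_mul /= !mulr1 !mulr0 scaler0 addr0 add0r. Qed.
Fact quad_mulA : associative quad_mul.
Proof.
move=> [x x'] [y y'] [z z']; rewrite /quad_mul /=.
rewrite !mulrDl !mulrDr !scalerDr -!scalerAr -!scalerAl !mulrA -!addrA.
have rot (u v w : A) : u + (v + w) = w + (u + v) by rewrite addrA addrC.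
by congr (_ + _, _ + _); rewrite rot.
Qed.
Fact quad_mulZl a (x y : Q) : a *: quad_mul x y = quad_mul (a *: x) y.
Proof.
case: x y => x x' [y y']; rewrite /quad_mul !scaleE /= !scalerDr -!scalerAl.
by rewrite !scalerA [a * c]mulrC.
Qed.
Fact quad_mulZr a (x y : Q) : a *: quad_mul x y = quad_mul x (a *: y).
Proof.
case: x y => x x' [y y']; rewrite /quad_mul !scaleE /= !scalerDr -!scalerAr.
by rewrite !scalerA [a * c]mulrC.
Qed.
Fact quad_oner_neq0 : ((1, 0) : Q) != 0.
Proof. by apply/eqP=> -[/eqP]; rewrite oner_eq0. Qed.

HB.instance Definition _ := GRing.Zmodule_isNzRing.Build Q
  quad_mulA quad_mul1 quad_mulr1 quad_mulDl quad_mulDr quad_oner_neq0.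
HB.instance Definition _ := GRing.Lmodule_isLalgebra.Build K Q quad_mulZl.
HB.instance Definition _ := GRing.Lalgebra_isAlgebra.Build K Q quad_mulZr.

Definition mkq (x y : A) : Q := (x, y).
Definition qroot : Q := mkq 0 1.

Lemma mkqM x y x' y' :
  mkq x y * mkq x' y' = mkq (x * x' + c *: (y * y')) (x * y' + y * x').
Proof. by []. Qed.
Lemma mkqD x y x' y' : mkq x y + mkq x' y' = mkq (x + x') (y + y').
Proof. by []. Qed.
Lemma mkqZ a x y : a *: mkq x y = mkq (a *: x) (a *: y).
Proof. by []. Qed.
Lemma mkqN x y : - mkq x y = mkq (- x) (- y).
Proof. by []. Qed.
Lemma mkq1 : mkq 1 0 = 1.
Proof. by []. Qed.
Lemma mkqMl x x' y' : mkq x 0 * mkq x' y' = mkq (x * x') (x * y').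
Proof. by rewrite mkqM !mul0r scaler0 !addr0. Qed.
Lemma mkqMr x y x' : mkq x y * mkq x' 0 = mkq (x * x') (y * x').
Proof. by rewrite mkqM !mulr0 scaler0 add0r addr0. Qed.

Lemma qrootM x y : qroot * mkq x y = mkq (c *: y) x.
Proof. by rewrite mkqM !mul0r !mul1r !add0r. Qed.
Lemma qrootC x : qroot * x = x * qroot.
Proof. by case: x => x y; congr (_, _); rewrite /= !(mul0r, mulr0) !(mul1r, mulr1) ?add0r ?addr0. Qed.
Lemma qroot_sqr : qroot * qroot = c%:A.
Proof. by rewrite -mkq1 mkqZ scaler0 qrootM. Qed.

(** This is where the congruence for c modulo 4 acts: theta = (t + c delta) / 2 satisfies
theta^2 = c delta theta - c mu, so that Y + Y theta is a ring although t has a denominator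
2 in it. *)
Section Lattice.
Variables (R : subringClosed K) (delta mu : K) (Y : A -> Prop).
Hypothesis YR : Rsubalg R Y.
Hypothesis two_neq0 : 2%:R != 0 :> K.
Hypothesis c_neq0 : c != 0.
Hypotheses (c_in : c \in R) (delta_in : delta \in R) (mu_in : mu \in R).
Hypothesis mu_def : 4%:R * mu = c * delta ^+ 2 - 1.

(** Y + Y theta, in the coordinates with respect to 1 and t. *)
Definition lat (x : Q) : Prop :=
  Y (2%:R *: x.2) /\ Y (x.1 - (c * delta) *: x.2).

Let n4 : 4%:R != 0 :> K.
Proof. by rewrite (natrM _ 2 2) mulf_neq0. Qed.
Let muE : mu = (c * delta ^+ 2 - 1) / 4%:R.
Proof. by rewrite -mu_def mulrC mulKf. Qed.

Let th (a b : A) : Q := mkq (a + (c * delta / 2%:R) *: b) (2%:R^-1 *: b).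

Let lat_th a b : Y a -> Y b -> lat (th a b).
Proof.
move=> ha hb; split; rewrite /= scalerA; first by rewrite mulfV // scale1r.
by rewrite addrK.
Qed.

Let latP x : lat x -> exists2 a, Y a & exists2 b, Y b & x = th a b.
Proof.
case: x => x y [/= h1 h2]; exists (x - (c * delta) *: y) => //; exists (2%:R *: y) => //.
congr (_, _); last by rewrite scalerA mulVf // scale1r.
by rewrite scalerA divfK // subrK.
Qed.

Let thM a b a' b' :
  th a b * th a' b' = th (a * a' - (c * mu) *: (b * b'))
                         (a * b' + b * a' + (c * delta) *: (b * b')).
Proof.
rewrite /th mkqM; congr (mkq _ _); rewrite !mulrDl !mulrDr -!scalerAl -!scalerAr !scalerDr !scalerA.
  rewrite -!addrA; congr (_ + _).
  set P := b * b'; set P1 := a * b'; set P2 := b * a'.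
  rewrite [in RHS]addrC -!addrA; congr (_ + (_ + _)).
  rewrite -scaleNr -!scalerDl; congr (_ *: _); rewrite muE.
  by field; rewrite two_neq0 n4.
set P := b * b'; set P1 := a * b'; set P2 := b * a'.
rewrite addrACA -scalerDl; congr (_ + _ + _ *: _); by field.
Qed.

Lemma lat_Rsubalg : Rsubalg R lat.
Proof.
have cd : c * delta \in R by apply: rpredM.
split.
- by split=> /=; rewrite !scaler0 ?subr0; [exact: (Rsubalg0 YR)|exact: (Rsubalg1 YR)].
- move=> x y [h1 h2] [h3 h4]; split=> /=.
    by rewrite scalerDr; apply: (RsubalgD YR).
  by rewrite scalerDr opprD addrACA; apply: (RsubalgD YR).
- move=> x y /latP[a ha [b hb ->]] /latP[a' ha' [b' hb' ->]]; rewrite thM; apply: lat_th.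
    apply: (RsubalgB YR); first exact: (RsubalgM YR).
    by apply: (RsubalgZ YR); [exact: rpredM|exact: (RsubalgM YR)].
  apply: (RsubalgD YR); first by apply: (RsubalgD YR); exact: (RsubalgM YR).
  by apply: (RsubalgZ YR) => //; exact: (RsubalgM YR).
move=> r x hr [h1 h2]; split=> /=.
  by rewrite scalerA mulrC -scalerA; apply: (RsubalgZ YR).
by rewrite scalerA mulrC -scalerA -scalerBr; apply: (RsubalgZ YR).
Qed.

Lemma lat_qroot : lat qroot.
Proof.
split=> /=; first by apply: (Rsubalg_scalar YR); exact: rpred_nat.
by rewrite sub0r; apply: (RsubalgN YR); apply: (Rsubalg_scalar YR); apply: rpredM.
Qed.

(** Integrality of an element of A may be tested after adjoining theta, because 1 and theta
are linearly independent. *)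
Lemma lat_base x : lat (mkq x 0) <-> Y x.
Proof.
split=> [[_] /=|hx]; first by rewrite scaler0 subr0.
by split; rewrite /= !scaler0 ?subr0 //; apply: (Rsubalg0 YR).
Qed.

(** Elements of 1 + t (Y + Y theta) in terms of Y. For a unit x of norm 1, the first
coordinate below is (x - x^-1) / t. *)
Lemma near1_lat (x y : A) :
  near1 lat qroot (mkq x y) <-> Y (2%:R *: y) /\ Y (c^-1 *: (x - 1) - delta *: y).
Proof.
have cd : c * delta \in R by apply: rpredM.
have m2 : - (2%:R * mu) \in R by rewrite rpredN rpredM ?rpred_nat.
have mu2E : - (2%:R * mu) * 2%:R = 1 - c * delta ^+ 2.
  by rewrite mulNr -mulrA [mu * _]mulrC mulrA -natrM mu_def opprB.
set z := c^-1 *: (x - 1).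
have xE : x = 1 + c *: z by rewrite /z scalerA mulfV // scale1r addrC subrK.
clearbody z; have zP : near1 lat qroot (mkq x y) <-> Y (2%:R *: z) /\ Y (y - (c * delta) *: z).
  split=> [[[u v] [h1 h2]]|hz]; last first.
    by exists (mkq y z) => //; rewrite qrootM -mkq1 mkqD add0r -xE.
  rewrite -/(mkq u v) qrootM -mkq1 mkqD add0r => -[xu ->].
  suff -> : z = v by [].
  apply: (scalerI c_neq0); apply: (addrI 1); by rewrite -xE.
rewrite zP; split=> -[h1 h2]; split.
- have -> : 2%:R *: y = 2%:R *: (y - (c * delta) *: z) + (c * delta) *: (2%:R *: z).
    by rewrite scalerBr !scalerA [_ * 2%:R]mulrC subrK.
  by apply: (RsubalgD YR); apply: (RsubalgZ YR) => //; exact: rpred_nat.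
- have -> : z - delta *: y = - (2%:R * mu) *: (2%:R *: z) - delta *: (y - (c * delta) *: z).
    rewrite scalerA mu2E [in RHS]scalerBr scalerBl scale1r scalerA opprB addrA.
    by rewrite [delta * (c * delta)]mulrCA -expr2 subrK.
  by apply: (RsubalgB YR); apply: (RsubalgZ YR).
- have -> : 2%:R *: z = 2%:R *: (z - delta *: y) + delta *: (2%:R *: y).
    by rewrite scalerBr !scalerA [delta * _]mulrC subrK.
  by apply: (RsubalgD YR); apply: (RsubalgZ YR) => //; exact: rpred_nat.
have -> : y - (c * delta) *: z = - (2%:R * mu) *: (2%:R *: y) - (c * delta) *: (z - delta *: y).
  rewrite scalerA mu2E [in RHS]scalerBr scalerBl scale1r scalerA opprB addrA.
  by rewrite -mulrA -expr2 subrK.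
by apply: (RsubalgB YR); apply: (RsubalgZ YR).
Qed.

End Lattice.
End Quad.

(** * Comparing an algebra with its twist *)

Section GradedEmbedding.
Variables (K : fieldType) (A : algType K) (G : grading A) (c : K).
Hypothesis c_neq0 : c != 0.
Local Notation A' := (twist G c).
Local Notation mk := (@mkq K A' c).

(** A embeds into the twist with t adjoined: t^-1 = t / c makes an odd element of A out of
an odd element of the twist. *)
Definition grade_emb (x : A) : quad A' c := mk (x - G x) (c^-1 *: G x).

Lemma grade_embD : {morph grade_emb : x y / x + y}.
Proof.
move=> x y; rewrite /grade_emb mkqD; congr (mkq _ _ _).
  by rewrite linearD /= opprD addrACA.
by rewrite linearD scalerDr.
Qed.

Lemma grade_embZ k x : grade_emb (k *: x) = k *: grade_emb x.
Proof.
rewrite /grade_emb mkqZ; congr (mkq _ _ _); first by rewrite linearZZ -scalerBr.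
by rewrite linearZZ !scalerA mulrC.
Qed.

Lemma grade_emb_homog i x : homog G i x ->
  grade_emb x = if i then mk 0 (c^-1 *: x) else mk x 0.
Proof.
by rewrite /grade_emb /homog => ->; case: i; rewrite ?subrr ?subr0 ?scaler0.
Qed.

Lemma grade_embM : {morph grade_emb : x y / x * y}.
Proof.
move=> x y; elim/(homog_ind (G := G)): x => [x x' IH IH'|i x hx].
  by rewrite mulrDl !grade_embD IH IH' mulrDl.
elim/(homog_ind (G := G)): y => [y y' IH IH'|j y hy].
  by rewrite mulrDr !grade_embD IH IH' mulrDr.
rewrite (grade_emb_homog (homogM hx hy)) (grade_emb_homog hx) (grade_emb_homog hy).
case: i hx => hx; case: j hy => hy /=; rewrite mkqM !(mul0r, mulr0) ?scaler0 ?addr0 ?add0r;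
  congr (mkq _ _ _).
- rewrite -scalerAl -scalerAr (twistM c hx hy) /twist_coef /= !scalerA.
  by rewrite mulrA mulfV // mul1r mulVf // scale1r.
- by rewrite -scalerAl (twistM c hx hy) /twist_coef /= scale1r.
- by rewrite -scalerAr (twistM c hx hy) /twist_coef /= scale1r.
by rewrite (twistM c hx hy) scale1r.
Qed.

Lemma grade_emb1 : grade_emb 1 = 1.
Proof. exact: grade_emb_homog (homog1 G). Qed.

Lemma grade_embX x n : grade_emb (x ^+ n) = grade_emb x ^+ n.
Proof. by elim: n => [|n IH]; rewrite ?grade_emb1 // !exprS grade_embM IH. Qed.

End GradedEmbedding.

Section TensorEmbedding.
Variables (K : fieldType) (H : hopfAlgebra K) (G : grading H) (c : K).
Hypothesis c_neq0 : c != 0.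
Hypothesis comult_odd : forall h, comult H (G h) = tens_odd G (comult H h).
Hypothesis counit_odd : forall h, counit H (G h) = 0.
Hypothesis antipode_odd : forall h, antipode H (G h) = G (antipode H h).
Local Notation H' := (twist_hopf c_neq0 comult_odd counit_odd antipode_odd).
Local Notation TT := (tensor H' H').
Local Notation tw := (tens_twist G c : tensor H H -> TT).
Local Notation mk := (@mkq K TT c).

(** The same for the tensor square, with values in the tensor square of the twist. *)
Definition tens_emb (s : tensor H H) : quad TT c :=
  mk (tw (s - tens_odd G s)) (c^-1 *: tw (tens_odd G s)).

Let twD : {morph tw : s t / s + t}.
Proof. exact: (@tens_twistD K H G c). Qed.

Let twZ k s : tw (k *: s) = k *: tw s.
Proof. exact: (linear_fZ (@tens_twist_linear K H G c)). Qed.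

Let tw0 : tw 0 = 0.
Proof. exact: (linear_f0 (@tens_twist_linear K H G c)). Qed.

Let twM i j s t : homog (tens_grading G) i s -> homog (tens_grading G) j t ->
  tw s * tw t = twist_coef c i j *: tw (s * t).
Proof. exact: tens_twistM. Qed.

Lemma tens_embD : {morph tens_emb : x y / x + y}.
Proof.
move=> x y; rewrite /tens_emb mkqD; congr (mkq _ _ _).
  by rewrite (tens_oddD G x) [- (tens_odd G x + _)]opprD addrACA (twD (x - _)).
by rewrite (tens_oddD G x) twD scalerDr.
Qed.

Lemma tens_embZ k x : tens_emb (k *: x) = k *: tens_emb x.
Proof.
have oZ : tens_odd G (k *: x) = k *: tens_odd G x := linear_fZ (tens_odd_linear G) k x.
rewrite /tens_emb mkqZ oZ; congr (mkq _ _ _); first by rewrite -scalerBr twZ.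
by rewrite twZ !scalerA mulrC.
Qed.

Lemma tens_emb_homog i s : homog (tens_grading G) i s ->
  tens_emb s = if i then mk 0 (c^-1 *: tw s) else mk (tw s) 0.
Proof.
rewrite /tens_emb /homog /= => ->.
by case: i; rewrite ?subrr ?subr0 ?tw0 ?scaler0.
Qed.

Lemma tens_embM : {morph tens_emb : x y / x * y}.
Proof.
move=> x y; elim/(homog_ind (G := tens_grading G)): x => [x x' IH IH'|i x hx].
  by rewrite mulrDl !tens_embD IH IH' mulrDl.
elim/(homog_ind (G := tens_grading G)): y => [y y' IH IH'|j y hy].
  by rewrite mulrDr !tens_embD IH IH' mulrDr.
rewrite (tens_emb_homog (homogM hx hy)) (tens_emb_homog hx) (tens_emb_homog hy).
case: i hx => hx; case: j hy => hy /=; rewrite mkqM !(mul0r, mulr0) ?scaler0 ?addr0 ?add0r;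
  congr (mkq _ _ _).
- rewrite -scalerAl -scalerAr (twM hx hy) /twist_coef /= !scalerA.
  by rewrite mulrA mulfV // mul1r mulVf // scale1r.
- by rewrite -scalerAl (twM hx hy) /twist_coef /= scale1r.
- by rewrite -scalerAr (twM hx hy) /twist_coef /= scale1r.
by rewrite (twM hx hy) scale1r.
Qed.

Lemma tens_emb1 : tens_emb 1 = 1.
Proof.
rewrite (tens_emb_homog (homog1 (tens_grading G))) -[RHS]mkq1; congr (mkq _ _ _).
exact: tens_twist1.
Qed.

Lemma tens_embX x n : tens_emb (x ^+ n) = tens_emb x ^+ n.
Proof. by elim: n => [|n IH]; rewrite ?tens_emb1 // !exprS tens_embM IH. Qed.

Lemma tens_emb_sum I (s : seq I) (P : pred I) (F : I -> tensor H H) :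
  tens_emb (\sum_(i <- s | P i) F i) = \sum_(i <- s | P i) tens_emb (F i).
Proof.
elim/big_rec2: _ => [|i x y _ <-]; last exact: tens_embD.
by rewrite (tens_emb_homog (homog0 (tens_grading G) false)) tw0.
Qed.

Lemma tens_emb_l (x : H) :
  tens_emb (x ⊗ 1) = mk ((x - G x : H') ⊗ 1) ((c^-1 *: G x : H') ⊗ 1).
Proof.
have E i y : homog G i y -> tw (y ⊗ 1) = (y : H') ⊗ (1 : H').
  by move=> hy; rewrite (tens_twistE c hy (homog1 G)) /twist_coef andbF scale1r.
have D y z : (y + z : H') ⊗ (1 : H') = (y : H') ⊗ (1 : H') + (z : H') ⊗ (1 : H') :> TT.
  exact: tensDl.
have Z k y : (k *: y : H') ⊗ (1 : H') = k *: ((y : H') ⊗ (1 : H')) :> TT.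
  exact: tensZl.
elim/(homog_ind (G := G)): x => [x x' IH IH'|i x hx].
  rewrite tensDl tens_embD IH IH' mkqD -!D.
  congr (mkq _ (_ ⊗ _) (_ ⊗ _)); first by rewrite linearD /= opprD addrACA.
  by rewrite linearD scalerDr.
rewrite (tens_emb_homog (homog_tens hx (homog1 G))) addbF (E _ _ hx) hx.
case: i {hx}; rewrite ?subrr ?subr0.
  by congr (mkq _ _ _); [exact/esym/tens0l|exact/esym/Z].
by congr (mkq _ _ _); rewrite scaler0; exact/esym/tens0l.
Qed.

Lemma tens_emb_r (x : H) :
  tens_emb (1 ⊗ x) = mk (1 ⊗ (x - G x : H')) (1 ⊗ (c^-1 *: G x : H')).
Proof.
have E i y : homog G i y -> tw (1 ⊗ y) = (1 : H') ⊗ (y : H').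
  by move=> hy; rewrite (tens_twistE c (homog1 G) hy) /twist_coef scale1r.
have D y z : (1 : H') ⊗ (y + z : H') = (1 : H') ⊗ (y : H') + (1 : H') ⊗ (z : H') :> TT.
  exact: tensDr.
have Z k y : (1 : H') ⊗ (k *: y : H') = k *: ((1 : H') ⊗ (y : H')) :> TT.
  exact: tensZr.
elim/(homog_ind (G := G)): x => [x x' IH IH'|i x hx].
  rewrite tensDr tens_embD IH IH' mkqD -!D.
  congr (mkq _ (_ ⊗ _) (_ ⊗ _)); first by rewrite linearD /= opprD addrACA.
  by rewrite linearD scalerDr.
rewrite (tens_emb_homog (homog_tens (homog1 G) hx)) addFb (E _ _ hx) hx.
case: i {hx}; rewrite ?subrr ?subr0.
  by congr (mkq _ _ _); [exact/esym/tens0r|exact/esym/Z].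
by congr (mkq _ _ _); rewrite scaler0; exact/esym/tens0r.
Qed.

(** Comultiplying in the twist is comultiplying in H, coordinate by coordinate; thus closure
of an order under the twisted comultiplication is checked on formulas in H. *)
Lemma tens_emb_comult (h : H) :
  tens_emb (comult H h) = mk (comult H' (h - G h : H)) (comult H' (c^-1 *: G h : H)).
Proof.
congr (mkq _ _ _).
  rewrite [RHS]/(tens_twist G c (comult H (h - G h))); congr (tens_twist G c _).
  by rewrite linearB /= comult_odd.
rewrite [RHS]/(tens_twist G c (comult H (c^-1 *: G h))).
rewrite linearZZ /= comult_odd; exact/esym/twZ.
Qed.

End TensorEmbedding.

(** * Nikshych's Hopf algebra *)

Section QCommute.
Variables (K : fieldType) (A : algType K) (e x y : A) (k : K).
Hypotheses (ex : e * x = x * e) (ey : e * y = y * e).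
Hypothesis exy : e * (x * y) = k *: (e * (y * x)).

Lemma commX_l n : e * x ^+ n = x ^+ n * e.
Proof. by elim: n => [|n IH]; rewrite ?mulr1 ?mul1r // exprS mulrA ex -mulrA IH mulrA. Qed.

(** Elements that commute up to a scalar on the block cut out by e. *)
Lemma q_commuteX i j : e * (x ^+ i * y ^+ j) = k ^+ (i * j) *: (e * (y ^+ j * x ^+ i)).
Proof.
have eyX n : e * y ^+ n = y ^+ n * e.
  by elim: n => [|n IH]; rewrite ?mulr1 ?mul1r // exprS mulrA ey -mulrA IH mulrA.
have step n : e * (x * y ^+ n) = k ^+ n *: (e * (y ^+ n * x)).
  elim: n => [|n IH]; first by rewrite !expr0 scale1r mulr1 mul1r.
  rewrite [y ^+ n.+1]exprS [x * _]mulrA [e * _]mulrA exy -scalerAl exprS -scalerA; congr (_ *: _).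
  rewrite [e * (y * x)]mulrA ey -!mulrA IH -!scalerAr !mulrA ey -!mulrA.
  by [].
elim: i => [|i IH]; first by rewrite mul0n !expr0 scale1r mulr1 mul1r.
rewrite mulSn exprD -scalerA exprSr.
have -> : e * (x ^+ i * x * y ^+ j) = x ^+ i * (e * (x * y ^+ j)).
  by rewrite -mulrA mulrA commX_l -mulrA.
rewrite step -scalerAr; congr (_ *: _).
have -> : x ^+ i * (e * (y ^+ j * x)) = e * (x ^+ i * y ^+ j) * x.
  by rewrite mulrA -commX_l !mulrA.
by rewrite IH -scalerAl -!mulrA.
Qed.

End QCommute.

(** The relations in terms of the units a = u_a + v_a and b = u_b + v_b, of which u and v
are the components in the two blocks. *)
Record nik_units (K : fieldType) (A : algType K) (p : nat) (z : K) (e0 e1 a b g : A) : Prop :=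
  NikUnits {
    nik_sum : e0 + e1 = 1;
    nik_e00 : e0 * e0 = e0; nik_e11 : e1 * e1 = e1;
    nik_e01 : e0 * e1 = 0; nik_e10 : e1 * e0 = 0;
    nik_e0a : e0 * a = a * e0; nik_e0b : e0 * b = b * e0; nik_e0g : e0 * g = g * e0;
    nik_ap : a ^+ p = 1; nik_bp : b ^+ p = 1;
    nik_ab0 : e0 * (a * b) = 1 *: (e0 * (b * a));
    nik_ab1 : e1 * (a * b) = z *: (e1 * (b * a));
    nik_gg : g * g = 1;
    nik_ga0 : e0 * (g * a) = e0 * (b * g); nik_gb0 : e0 * (g * b) = e0 * (a * g);
    nik_ga1 : e1 * (g * a) = 1 *: (e1 * (a * g)); nik_gb1 : e1 * (g * b) = 1 *: (e1 * (b * g))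
  }.

Section UnitsOfRelations.
Variables (K : fieldType) (A : algType K) (p : nat) (z : K) (x : nikshych_gens A).
Hypothesis p_gt1 : (1 < p)%N.
Hypothesis rel : nikshych_relations p z x.
Local Notation e0 := (gen_e0 x).
Local Notation e1 := (gen_e1 x).
Local Notation ua := (gen_ua x).
Local Notation ub := (gen_ub x).
Local Notation va := (gen_va x).
Local Notation vb := (gen_vb x).
Local Notation g := (gen_g x).

Let in_block (e w : A) := e * w = w /\ w * e = w.

Let relE : [/\ [/\ e0 + e1 = 1, e0 * e1 = 0 & e1 * e0 = 0],
      [/\ ua ^+ p = e0, ub ^+ p = e0, e0 * ua = ua, e0 * ub = ub & ua * ub = ub * ua],
      [/\ va ^+ p = e1, vb ^+ p = e1, e1 * va = va, e1 * vb = vb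
        & va * vb = z *: (vb * va)]
    & [/\ g ^+ 2 = 1, g * ua = ub * g, g * ub = ua * g, g * va = va * g
        & g * vb = vb * g]].
Proof. by move: rel; case: (x). Qed.

Let blk e w : w ^+ p = e -> e * w = w -> in_block e w.
Proof. by move=> we ew; split=> //; rewrite -[in LHS]we -exprS exprSr we. Qed.

Lemma nik_block_ua : in_block e0 ua. Proof. by case: relE => _ [? ? ? ? ?] _ _; apply: blk. Qed.
Lemma nik_block_ub : in_block e0 ub. Proof. by case: relE => _ [? ? ? ? ?] _ _; apply: blk. Qed.
Lemma nik_block_va : in_block e1 va. Proof. by case: relE => _ _ [? ? ? ? ?] _; apply: blk. Qed.
Lemma nik_block_vb : in_block e1 vb. Proof. by case: relE => _ _ [? ? ? ? ?] _; apply: blk. Qed.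

Let idem : e0 * e0 = e0 /\ e1 * e1 = e1.
Proof.
case: relE => -[e01 e0e1 e1e0] _ _ _.
have e1E : e1 = 1 - e0 by rewrite -e01 addrC addKr.
have e00 : e0 * e0 = e0.
  by apply/eqP; rewrite -subr_eq0 -{3}[e0]mulr1 -mulrBr -opprB -e1E mulrN e0e1 oppr0.
by split=> //; rewrite -[RHS]mul1r -e01 mulrDl e0e1 add0r.
Qed.

Let mixed u v : in_block e0 u -> in_block e1 v -> u * v = 0 /\ v * u = 0.
Proof.
case: relE => -[_ e0e1 e1e0] _ _ _ [eu ue] [ev ve]; split.
  by rewrite -ue -ev -mulrA [e0 * _]mulrA e0e1 mul0r mulr0.
by rewrite -eu -ve -mulrA [e1 * _]mulrA e1e0 mul0r mulr0.
Qed.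

Let block_e0 : in_block e0 e0. Proof. by case: idem. Qed.
Let block_e1 : in_block e1 e1. Proof. by case: idem. Qed.

Let blockE u v : in_block e0 u -> in_block e1 v ->
  [/\ e0 * (u + v) = u, (u + v) * e0 = u, e1 * (u + v) = v & (u + v) * e1 = v].
Proof.
move=> hu hv; have [ev ve] := mixed block_e0 hv; have [ue eu] := mixed hu block_e1.
by case: hu => h1 h2; case: hv => h3 h4; rewrite !mulrDl !mulrDr h1 h2 h3 h4 ev ve ue eu !addr0 !add0r.
Qed.

Let blockX0 u v n : in_block e0 u -> in_block e1 v -> e0 * (u + v) ^+ n = block_exp e0 u n.
Proof.
move=> hu hv; elim: n => [|n IH]; first by rewrite mulr1.
rewrite exprSr mulrA IH /block_exp /=; case: n {IH} => [|n] /=.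
  by have [-> _ _ _] := blockE hu hv; rewrite expr1.
by rewrite [u ^+ n.+1]exprSr -mulrA mulrDr (mixed hu hv).1 addr0 mulrA -!exprSr.
Qed.

Let blockX1 u v n : in_block e0 u -> in_block e1 v -> e1 * (u + v) ^+ n = block_exp e1 v n.
Proof.
move=> hu hv; elim: n => [|n IH]; first by rewrite mulr1.
rewrite exprSr mulrA IH /block_exp /=; case: n {IH} => [|n] /=.
  by have [_ _ -> _] := blockE hu hv; rewrite expr1.
by rewrite [v ^+ n.+1]exprSr -mulrA mulrDr (mixed hu hv).2 add0r mulrA -!exprSr.
Qed.

Lemma nik_block_expa0 n : e0 * (ua + va) ^+ n = block_exp e0 ua n.
Proof. exact: blockX0 nik_block_ua nik_block_va. Qed.
Lemma nik_block_expa1 n : e1 * (ua + va) ^+ n = block_exp e1 va n.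
Proof. exact: blockX1 nik_block_ua nik_block_va. Qed.
Lemma nik_block_expb0 n : e0 * (ub + vb) ^+ n = block_exp e0 ub n.
Proof. exact: blockX0 nik_block_ub nik_block_vb. Qed.
Lemma nik_block_expb1 n : e1 * (ub + vb) ^+ n = block_exp e1 vb n.
Proof. exact: blockX1 nik_block_ub nik_block_vb. Qed.

Lemma nik_units_of_relations : nik_units p z e0 e1 (ua + va) (ub + vb) g.
Proof.
case: relE => -[e01 e0e1 e1e0] [uap ubp _ _ uab] [vap vbp _ _ vab] [gg gua gub gva gvb].
have [A0 A0' A1 A1'] := blockE nik_block_ua nik_block_va.
have [B0 B0' B1 B1'] := blockE nik_block_ub nik_block_vb.
have p0 : (p == 0)%N = false by case: (p) p_gt1.
have wp w : e0 * w ^+ p = e0 -> e1 * w ^+ p = e1 -> w ^+ p = 1.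
  by move=> h0 h1; rewrite -[LHS]mul1r -e01 mulrDl h0 h1.
have e0g : e0 * g = g * e0.
  suff gX n : g * ub ^+ n = ua ^+ n * g by have := gX p; rewrite uap ubp.
  elim: n => [|n IH]; first by rewrite mulr1 mul1r.
  by rewrite exprS mulrA gub -mulrA IH mulrA -exprS.
have e1E : e1 = 1 - e0 by rewrite -e01 addrC addKr.
have e1g : e1 * g = g * e1 by rewrite e1E mulrBl mulrBr e0g mul1r mulr1.
have [uv0 vu0] := mixed nik_block_ua nik_block_vb.
have [uv1 vu1] := mixed nik_block_ub nik_block_va.
split=> //.
- by case: idem.
- by case: idem.
- by rewrite A0 A0'.
- by rewrite B0 B0'.
- by apply: wp; rewrite ?nik_block_expa0 ?nik_block_expa1 /block_exp p0.
- by apply: wp; rewrite ?nik_block_expb0 ?nik_block_expb1 /block_exp p0.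
- by rewrite scale1r !mulrA A0 B0 !mulrDr uv0 uv1 !addr0.
- by rewrite !mulrA A1 B1 !mulrDr vu0 vu1 !add0r.
- by rewrite mulrA e0g -mulrA A0 mulrA B0.
- by rewrite mulrA e0g -mulrA B0 mulrA A0.
- by rewrite scale1r mulrA e1g -mulrA A1 mulrA A1.
by rewrite scale1r mulrA e1g -mulrA B1 mulrA B1.
Qed.

End UnitsOfRelations.

Section UnitsTheory.
Variables (K : fieldType) (A : algType K) (p : nat) (z : K) (e0 e1 a b g : A).
Hypothesis N : nik_units p z e0 e1 a b g.

Lemma nik_e1E : e1 = 1 - e0.
Proof. by rewrite -(nik_sum N) addrC addKr. Qed.
Lemma nik_e1a : e1 * a = a * e1.
Proof. by rewrite nik_e1E mulrBl mulrBr (nik_e0a N) mul1r mulr1. Qed.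
Lemma nik_e1b : e1 * b = b * e1.
Proof. by rewrite nik_e1E mulrBl mulrBr (nik_e0b N) mul1r mulr1. Qed.
Lemma nik_e1g : e1 * g = g * e1.
Proof. by rewrite nik_e1E mulrBl mulrBr (nik_e0g N) mul1r mulr1. Qed.

Lemma nik_abX0 i j : e0 * (a ^+ i * b ^+ j) = e0 * (b ^+ j * a ^+ i).
Proof.
by rewrite (q_commuteX (nik_e0a N) (nik_e0b N) (nik_ab0 N)) expr1n scale1r.
Qed.

Lemma nik_abX1 i j : e1 * (a ^+ i * b ^+ j) = z ^+ (i * j) *: (e1 * (b ^+ j * a ^+ i)).
Proof. exact: q_commuteX nik_e1a nik_e1b (nik_ab1 N) i j. Qed.

Lemma nik_gaX0 i : e0 * (g * a ^+ i) = e0 * (b ^+ i * g).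
Proof.
elim: i => [|i IH]; first by rewrite mulr1 mul1r.
rewrite exprSr [g * _]mulrA [e0 * _]mulrA IH [b ^+ i.+1]exprSr.
have -> : e0 * (b ^+ i * g) * a = b ^+ i * (e0 * (g * a)).
  by rewrite !mulrA (commX_l (nik_e0b N)).
by rewrite (nik_ga0 N) !mulrA (commX_l (nik_e0b N)).
Qed.

Lemma nik_gbX0 i : e0 * (g * b ^+ i) = e0 * (a ^+ i * g).
Proof.
elim: i => [|i IH]; first by rewrite mulr1 mul1r.
rewrite exprSr [g * _]mulrA [e0 * _]mulrA IH [a ^+ i.+1]exprSr.
have -> : e0 * (a ^+ i * g) * b = a ^+ i * (e0 * (g * b)).
  by rewrite !mulrA (commX_l (nik_e0a N)).
by rewrite (nik_gb0 N) !mulrA (commX_l (nik_e0a N)).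
Qed.

Lemma nik_gaX1 i : e1 * (g * a ^+ i) = e1 * (a ^+ i * g).
Proof.
have := q_commuteX nik_e1g nik_e1a (nik_ga1 N) 1 i.
by rewrite expr1n scale1r expr1.
Qed.

Lemma nik_gbX1 i : e1 * (g * b ^+ i) = e1 * (b ^+ i * g).
Proof.
have := q_commuteX nik_e1g nik_e1b (nik_gb1 N) 1 i.
by rewrite expr1n scale1r expr1.
Qed.

(* The exponents are not reduced modulo p, which keeps products of monomials simple. *)
Definition nik_monom (k : bool) (i j : nat) (eps : bool) : A :=
  (if k then e1 else e0) * (a ^+ i * b ^+ j) * g ^+ eps.

End UnitsTheory.

Section MonomialSpan.
Variables (K : fieldType) (A : algType K) (p : nat) (z : K) (e0 e1 a b g : A).
Hypothesis N : nik_units p z e0 e1 a b g.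
Hypothesis z_neq0 : z != 0.
Local Notation mon := (nik_monom e0 e1 a b g).


Let gab1 i j : e1 * (g * (a ^+ i * b ^+ j)) = e1 * (a ^+ i * b ^+ j) * g.
Proof.
rewrite [g * _]mulrA [e1 * _]mulrA (nik_gaX1 N).
have -> : e1 * (a ^+ i * g) * b ^+ j = a ^+ i * (e1 * (g * b ^+ j)).
  by rewrite [RHS]mulrA -(commX_l (nik_e1a N)) !mulrA.
by rewrite (nik_gbX1 N) [LHS]mulrA -(commX_l (nik_e1a N)) !mulrA.
Qed.

Let gab0 i j : e0 * (g * (a ^+ i * b ^+ j)) = e0 * (a ^+ j * b ^+ i) * g.
Proof.
rewrite [g * _]mulrA [e0 * _]mulrA (nik_gaX0 N).
have -> : e0 * (b ^+ i * g) * b ^+ j = b ^+ i * (e0 * (g * b ^+ j)).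
  by rewrite [RHS]mulrA -(commX_l (nik_e0b N)) !mulrA.
rewrite (nik_gbX0 N) [LHS]mulrA -(commX_l (nik_e0b N)) (nik_abX0 N).
by rewrite !mulrA.
Qed.

Lemma nik_monom_g k i j eps : g * mon k i j eps =
  if k then mon k i j (~~ eps) else mon k j i (~~ eps).
Proof.
have gX : g * g ^+ eps = g ^+ ~~ eps.
  by case: eps; rewrite /= ?expr0 ?expr1 ?mulr1 // (nik_gg N).
rewrite /nik_monom; case: k; rewrite -gX.
  by rewrite mulrA [g * (_ * _)]mulrA -(nik_e1g N) -[e1 * g * _]mulrA gab1 -mulrA.
by rewrite mulrA [g * (_ * _)]mulrA -(nik_e0g N) -[e0 * g * _]mulrA gab0 -mulrA.
Qed.

Lemma nik_monom_a k i j eps : a * mon k i j eps = mon k i.+1 j eps.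
Proof.
rewrite /nik_monom exprS; case: k.
  by rewrite !mulrA -(nik_e1a N) -!mulrA.
by rewrite !mulrA -(nik_e0a N) -!mulrA.
Qed.

Lemma nik_monom_b k i j eps : b * mon k i j eps =
  if k then z^-1 ^+ i *: mon k i j.+1 eps else mon k i j.+1 eps.
Proof.
rewrite /nik_monom; case: k.
  have -> : b * (e1 * (a ^+ i * b ^+ j) * g ^+ eps) = e1 * (b * a ^+ i) * b ^+ j * g ^+ eps.
    by rewrite !mulrA (nik_e1b N).
  have -> : e1 * (b * a ^+ i) = z^-1 ^+ i *: (e1 * (a ^+ i * b)).
    have := nik_abX1 N i 1; rewrite expr1 muln1 => ->.
    by rewrite scalerA -exprMn mulVf // expr1n scale1r.
  by rewrite -!scalerAl exprS !mulrA.
have -> : b * (e0 * (a ^+ i * b ^+ j) * g ^+ eps) = e0 * (b * a ^+ i) * b ^+ j * g ^+ eps.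
  by rewrite !mulrA (nik_e0b N).
have <- : e0 * (a ^+ i * b) = e0 * (b * a ^+ i) by have := nik_abX0 N i 1; rewrite expr1.
by rewrite exprS !mulrA.
Qed.

Lemma nik_monom_e0 k i j eps : e0 * mon k i j eps = if k then 0 else mon k i j eps.
Proof.
by rewrite /nik_monom !mulrA; case: k; rewrite ?(nik_e01 N) ?mul0r ?(nik_e00 N) // -!mulrA.
Qed.

Lemma nik_monom_e1 k i j eps : e1 * mon k i j eps = if k then mon k i j eps else 0.
Proof.
by rewrite /nik_monom !mulrA; case: k; rewrite ?(nik_e10 N) ?mul0r ?(nik_e11 N) // -!mulrA.
Qed.

Lemma nik_monom1 : mon false 0 0 false + mon true 0 0 false = 1.
Proof. by rewrite /nik_monom !expr0 !mulr1 (nik_sum N). Qed.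

Lemma nik_monom_modp k i j eps : mon k i j eps = mon k (i %% p) (j %% p) eps.
Proof.
have modX (x : A) n : x ^+ p = 1 -> x ^+ n = x ^+ (n %% p).
  by move=> xp; rewrite {1}(divn_eq n p) exprD mulnC exprM xp expr1n mul1r.
by rewrite /nik_monom -(modX a) ?(nik_ap N) // -(modX b) ?(nik_bp N).
Qed.

Hypothesis gen : forall P : A -> Prop, P 1 ->
  (forall x y, P x -> P y -> P (x + y)) -> (forall k x, P x -> P (k *: x)) ->
  (forall x y, P x -> P y -> P (x * y)) ->
  P e0 -> P e1 -> P a -> P b -> P g -> forall x, P x.

(** The span of the monomials contains 1 and is stable under left multiplication by the
generators. *)
Lemma nik_span_ind (P : A -> Prop) :
    (forall x y, P x -> P y -> P (x + y)) -> (forall k x, P x -> P (k *: x)) ->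
    (forall k i j eps, P (mon k i j eps)) ->
  forall x, P x.
Proof.
move=> PD PZ Pmon.
pose M x := forall P : A -> Prop, (forall x y, P x -> P y -> P (x + y)) ->
  (forall k x, P x -> P (k *: x)) -> (forall k i j eps, P (mon k i j eps)) -> P x.
have MD x y : M x -> M y -> M (x + y) by move=> hx hy Q QD QZ Qm; apply: (QD); [apply: hx|apply: hy].
have MZ k x : M x -> M (k *: x) by move=> hx Q QD QZ Qm; apply: (QZ); apply: hx.
have Mm k i j eps : M (mon k i j eps) by move=> Q QD QZ Qm; apply: Qm.
have M0 : M 0 by rewrite -(scale0r (mon true 0 0 true)); apply: MZ.
have stab h : (forall k i j eps, M (h * mon k i j eps)) -> forall m, M m -> M (h * m).
  move=> hm m Mm'; apply: (Mm' (fun m => M (h * m))) => [x y|k x|k i j eps] //.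
    by rewrite mulrDr; apply: MD.
  by rewrite -scalerAr; apply: MZ.
suff stable x : forall m, M m -> M (x * m).
  move=> x; have hx : M x by rewrite -[x]mulr1; apply: stable; rewrite -nik_monom1; apply: MD.
  exact: hx.
elim/gen: x => [m|x y hx hy m hm|k x hx m hm|x y hx hy m hm|||||].
- by rewrite mul1r.
- by rewrite mulrDl; apply: MD; [apply: hx|apply: hy].
- by rewrite -scalerAl; apply: MZ; apply: hx.
- by rewrite -mulrA; apply: hx; apply: hy.
- by apply: stab => k i j eps; rewrite nik_monom_e0; case: k.
- by apply: stab => k i j eps; rewrite nik_monom_e1; case: k.
- by apply: stab => k i j eps; rewrite nik_monom_a.
- by apply: stab => k i j eps; rewrite nik_monom_b; case: k => //; apply: MZ.
by apply: stab => k i j eps; rewrite nik_monom_g; case: k.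
Qed.

End MonomialSpan.

Section UnitsMorphism.
Variables (K : fieldType) (A B : algType K) (f : A -> B).
Hypothesis f1 : f 1 = 1.
Hypothesis fD : {morph f : x y / x + y}.
Hypothesis fM : {morph f : x y / x * y}.
Hypothesis fZ : forall k x, f (k *: x) = k *: f x.

Lemma nik_units_morph p z e0 e1 a b g :
  nik_units p z e0 e1 a b g -> nik_units p z (f e0) (f e1) (f a) (f b) (f g).
Proof.
have f0 : f 0 = 0 by rewrite -(scale0r (0 : A)) fZ scale0r.
have fX x n : f (x ^+ n) = f x ^+ n by elim: n => [|n IH]; rewrite ?f1 // !exprS fM IH.
case=> h1 h2 h3 h4 h5 h6 h7 h8 h9 h10 h11 h12 h13 h14 h15 h16 h17.
split; rewrite -?fM -?fD -?fX -?fZ -?fM -?fZ -?f1 -?f0;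
  congr (f _); assumption.
Qed.

End UnitsMorphism.

Section SubalgebraInduction.
Variables (K : fieldType) (A : algType K) (P : A -> Prop).
Hypotheses (P1 : P 1) (PD : forall x y, P x -> P y -> P (x + y))
  (PZ : forall k x, P x -> P (k *: x)) (PM : forall x y, P x -> P y -> P (x * y)).

Definition subalg_pred : {pred A} := fun x => `[< P x >].

Fact subalg_pred_closed : GRing.subalg_closed subalg_pred.
Proof.
split=> [|k x y /asboolP hx /asboolP hy|x y /asboolP hx /asboolP hy]; apply/asboolP => //.
  by apply: PD => //; apply: PZ.
exact: PM.
Qed.

HB.instance Definition _ := GRing.isSubalgClosed.Build K A subalg_pred subalg_pred_closed.

(** Generation by subalgebras as an induction principle. *)
Lemma nikshych_ind p z (x : nikshych_gens A) : nikshych_presentation p z x ->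
    P (gen_e0 x) -> P (gen_e1 x) -> P (gen_ua x) -> P (gen_ub x) -> P (gen_va x) ->
    P (gen_vb x) -> P (gen_g x) ->
  forall h, P h.
Proof.
case=> _ gen _ h1 h2 h3 h4 h5 h6 h7 h.
have inP w : P w -> w \in subalg_pred by move=> hw; apply/asboolP.
by apply/asboolP; apply: (gen subalg_pred); rewrite /= !inP.
Qed.
End SubalgebraInduction.

Lemma sum_opp_index (V : nmodType) p (f : nat -> V) : (0 < p)%N ->
  (forall n, f n = f (n %% p)%N) -> \sum_(i < p) f (p.-1 * i)%N = \sum_(i < p) f i.
Proof.
move=> p0 fmod.
have aux q n : (n < q)%N -> (q.-1 * q.-1 * n = n + (q - 2) * n * q)%N.
  case: q => // -[|q] /=; first by case: n.
  by rewrite subSS subSS subn0 => _; ring.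
pose h (i : 'I_p) := Ordinal (ltn_pmod (p.-1 * i) p0).
have hK : involutive h.
  move=> i; apply: val_inj => /=.
  by rewrite modnMmr mulnA aux ?ltn_ord // addnC modnMDl modn_small.
rewrite [RHS](reindex_inj (inv_inj hK)) /=.
by apply: eq_bigr => i _; rewrite fmod.
Qed.

Lemma sum2_opp_index (V : nmodType) p (f : nat -> nat -> V) : (0 < p)%N ->
  (forall m n, f (m %% p)%N n = f m n) -> (forall m n, f m (n %% p)%N = f m n) ->
  \sum_(i < p) \sum_(j < p) f (p.-1 * i)%N (p.-1 * j)%N = \sum_(i < p) \sum_(j < p) f i j.
Proof.
move=> p0 f1 f2; rewrite -[RHS](@sum_opp_index _ _ (fun i => \sum_(j < p) f i j)) //.
  by apply: eq_bigr => i _; rewrite sum_opp_index // => n; rewrite f2.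
by move=> n; apply: eq_bigr => j _; rewrite f1.
Qed.

Lemma orth_exprX (A : pzRingType) (x y : A) n : (0 < n)%N -> x * y = 0 -> y * x = 0 ->
  (x + y) ^+ n = x ^+ n + y ^+ n.
Proof.
case: n => // n _ xy yx; elim: n => // n IH.
rewrite exprS IH mulrDl !mulrDr [x ^+ n.+1]exprS [y ^+ n.+1]exprS ![x * (y * _)]mulrA xy.
by rewrite ![y * (x * _)]mulrA yx !mul0r addr0 add0r -!exprS.
Qed.

Section ComultG.
Variables (K : fieldType) (p : nat) (z : K) (A : algType K) (e0 e1 a b g : A).
Local Notation gu i j := (g * (e0 * (a ^+ i * b ^+ j))).
Local Notation gv i j := (g * (e1 * (a ^+ i * b ^+ j))).

(* The block powers of u and v are the components of powers of a and b, and all exponents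
   of z are made natural numbers. *)
Definition nik_comult_g : tensor A A :=
  (p%:R ^+ 2)^-1 *: (\sum_(i < p) \sum_(j < p) \sum_(k < p) \sum_(l < p)
     (z ^+ (k * j) * z^-1 ^+ (i * l)) *: (gu i j ⊗ gu k l))
  + p%:R^-1 *: (\sum_(k < p) \sum_(l < p)
     z^-1 ^+ ((k + l) * k) *: (gu k l ⊗ gv (k + l)%N (k + l)%N))
  + p%:R^-1 *: (\sum_(k < p) \sum_(l < p)
     z ^+ (k * (k + l)) *: (gv (k + l)%N (p.-1 * (k + l))%N ⊗ gu k l))
  + p%:R^-1 *: (\sum_(k < p) \sum_(l < p) gv k l ⊗ gv (p.-1 * l)%N k).

End ComultG.

(** The Hopf algebra in terms of a, b and g, with the grading G = (1 - psi) / 2 where psi is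
the involution inverting a and b. Here a is group-like, while the coproduct of b twists b
by an inversion on the second block. *)
Record nik_hopf (K : fieldType) (p : nat) (z : K) (H : hopfAlgebra K) (G : grading H)
    (e0 e1 a b g : H) : Prop := NikHopf {
  nik_rel :> nik_units p z e0 e1 a b g;
  nik_gen : forall P : H -> Prop, P 1 ->
    (forall x y, P x -> P y -> P (x + y)) -> (forall k x, P x -> P (k *: x)) ->
    (forall x y, P x -> P y -> P (x * y)) ->
    P e0 -> P e1 -> P a -> P b -> P g -> forall x, P x;
  nik_De0 : comult H e0 = e0 ⊗ e0 + e1 ⊗ e1;
  nik_De1 : comult H e1 = e0 ⊗ e1 + e1 ⊗ e0;
  nik_Da : comult H a = a ⊗ a;
  nik_Db : comult H b = (e0 * b) ⊗ b + (e1 * b) ⊗ b ^+ p.-1;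
  nik_Dg : comult H g = nik_comult_g p z e0 e1 a b g;
  nik_ce0 : counit H e0 = 1; nik_ce1 : counit H e1 = 0;
  nik_ca : counit H a = 1; nik_cb : counit H b = 1; nik_cg : counit H g = 1;
  nik_Se0 : antipode H e0 = e0; nik_Se1 : antipode H e1 = e1;
  nik_Sa : antipode H a = a ^+ p.-1; nik_Sb : antipode H b = e0 * b ^+ p.-1 + e1 * b;
  nik_Sg : antipode H g = g;
  nik_Ge0 : G e0 = 0; nik_Ge1 : G e1 = 0; nik_Gg : G g = 0;
  nik_Ga : G a = 2%:R^-1 *: (a - a ^+ p.-1); nik_Gb : G b = 2%:R^-1 *: (b - b ^+ p.-1);
  nik_comult_odd : forall h, comult H (G h) = tens_odd G (comult H h);
  nik_counit_odd : forall h, counit H (G h) = 0;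
  nik_antipode_odd : forall h, antipode H (G h) = G (antipode H h)
}.

Section FromPresentation.
Variables (K : fieldType) (p : nat) (z : K) (H : hopfAlgebra K) (x : nikshych_gens H).
Hypothesis p_gt1 : (1 < p)%N.
Hypothesis z_prim : p.-primitive_root z.
Hypothesis two_neq0 : 2%:R != 0 :> K.
Hypothesis pres : nikshych_presentation p z x.
Hypothesis costr : nikshych_costructure p z x.
Local Notation e0 := (gen_e0 x).
Local Notation e1 := (gen_e1 x).
Local Notation ua := (gen_ua x).
Local Notation ub := (gen_ub x).
Local Notation va := (gen_va x).
Local Notation vb := (gen_vb x).
Local Notation g := (gen_g x).
Local Notation a := (ua + va).
Local Notation b := (ub + vb).

Let rel : nikshych_relations p z x. Proof. by case: pres. Qed.
Let N := nik_units_of_relations p_gt1 rel.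
Let z0 : z != 0 := prim_neq0 z_prim.

Let coE : [/\ [/\ comult H ua = ua ⊗ ua + va ⊗ va,
          comult H ub = ub ⊗ ub + vb ⊗ vb ^+ (p - 1),
          comult H va = ua ⊗ va + va ⊗ ua,
          comult H vb = ub ⊗ vb + vb ⊗ ub ^+ (p - 1)
        & comult H g = nikshych_comult_g p z x],
      [/\ counit H ua = 1, counit H ub = 1, counit H va = 0, counit H vb = 0
        & counit H g = 1]
    & [/\ antipode H ua = ua ^+ (p - 1), antipode H ub = ub ^+ (p - 1),
          antipode H va = va ^+ (p - 1), antipode H vb = vb & antipode H g = g]].
Proof. by move: costr; rewrite /nikshych_costructure; case: (x). Qed.

Let relE : [/\ [/\ e0 + e1 = 1, e0 * e1 = 0 & e1 * e0 = 0],
      [/\ ua ^+ p = e0, ub ^+ p = e0, e0 * ua = ua, e0 * ub = ub & ua * ub = ub * ua],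
      [/\ va ^+ p = e1, vb ^+ p = e1, e1 * va = va, e1 * vb = vb
        & va * vb = z *: (vb * va)]
    & [/\ g ^+ 2 = 1, g * ua = ub * g, g * ub = ua * g, g * va = va * g
        & g * vb = vb * g]].
Proof. by move: rel; case: (x). Qed.

Let e0a : e0 * a = ua.
Proof. by have := nik_block_expa0 rel 1; rewrite /block_exp /= !expr1. Qed.
Let e0b : e0 * b = ub.
Proof. by have := nik_block_expb0 rel 1; rewrite /block_exp /= !expr1. Qed.
Let e1a : e1 * a = va.
Proof. by have := nik_block_expa1 rel 1; rewrite /block_exp /= !expr1. Qed.
Let e1b : e1 * b = vb.
Proof. by have := nik_block_expb1 rel 1; rewrite /block_exp /= !expr1. Qed.

Let gen (P : H -> Prop) : P 1 ->
  (forall u v, P u -> P v -> P (u + v)) -> (forall k u, P u -> P (k *: u)) ->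
  (forall u v, P u -> P v -> P (u * v)) ->
  P e0 -> P e1 -> P a -> P b -> P g -> forall u, P u.
Proof.
move=> Q1 QD QZ QM h0 h1 ha hb hg; apply: (nikshych_ind Q1 QD QZ QM pres) => //.
- by rewrite -e0a; apply: QM.
- by rewrite -e0b; apply: QM.
- by rewrite -e1a; apply: QM.
by rewrite -e1b; apply: QM.
Qed.

Let p1 : (p - 1 = p.-1)%N. Proof. by rewrite subn1. Qed.
Let p_gt0 : (0 < p)%N. Proof. exact: ltnW. Qed.

Let split01 (u : H) : u = e0 * u + e1 * u.
Proof. by rewrite -mulrDl (nik_sum N) mul1r. Qed.

Let aX n : (0 < n)%N -> a ^+ n = ua ^+ n + va ^+ n.
Proof.
move=> n0; rewrite [LHS]split01 (nik_block_expa0 rel) (nik_block_expa1 rel) /block_exp.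
by rewrite eqn0Ngt n0.
Qed.
Let bX n : (0 < n)%N -> b ^+ n = ub ^+ n + vb ^+ n.
Proof.
move=> n0; rewrite [LHS]split01 (nik_block_expb0 rel) (nik_block_expb1 rel) /block_exp.
by rewrite eqn0Ngt n0.
Qed.
Let pp0 : (0 < p.-1)%N. Proof. by rewrite -subn1 subn_gt0. Qed.


Let De0 : comult H e0 = e0 ⊗ e0 + e1 ⊗ e1.
Proof.
case: relE => _ [uap _ _ _ _] [vap _ _ _ _] _; case: coE => -[Dua _ _ _ _] _ _.
have uv : ua * va = 0.
  by have := (nik_block_ua rel).2; move=> <-; rewrite -(nik_block_va rel).1 -mulrA [e0 * _]mulrA (nik_e01 N) mul0r mulr0.
have vu : va * ua = 0.
  by have := (nik_block_va rel).2; move=> <-; rewrite -(nik_block_ua rel).1 -mulrA [e1 * _]mulrA (nik_e10 N) mul0r mulr0.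
rewrite -{1}uap rmorphXn /= Dua orth_exprX ?tensM ?uv ?vu ?tens0l //.
by rewrite !tensMX uap vap.
Qed.

Let De1 : comult H e1 = e0 ⊗ e1 + e1 ⊗ e0.
Proof.
rewrite [in LHS](nik_e1E N) rmorphB rmorph1 /= De0 -tens1 -(nik_sum N) !tensDl !tensDr.
by rewrite opprD addrA -addrA addrACA [e0 ⊗ e0 + _]addrC addrK addrK.
Qed.

Let ce0 : counit H e0 = 1.
Proof.
case: relE => _ [uap _ _ _ _] _ _; case: coE => _ [cua _ _ _ _] _.
by rewrite -uap rmorphXn /= cua expr1n.
Qed.
Let ce1 : counit H e1 = 0.
Proof. by rewrite (nik_e1E N) rmorphB rmorph1 /= ce0 subrr. Qed.

Let SX u n : antipode H (u ^+ n) = antipode H u ^+ n.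
Proof. by elim: n => [|n IH]; rewrite ?antipode1 // exprSr antipodeM IH -exprS. Qed.

Let idemX (e : H) n : e * e = e -> (0 < n)%N -> e ^+ n = e.
Proof. by move=> ee; case: n => // n _; elim: n => // n IH; rewrite exprS IH. Qed.

Let Se0 : antipode H e0 = e0.
Proof.
case: relE => _ [uap _ _ _ _] _ _; case: coE => _ _ [Sua _ _ _ _].
rewrite -{1}uap SX Sua -exprM mulnC exprM uap.
by rewrite p1 idemX // (nik_e00 N).
Qed.
Let Se1 : antipode H e1 = e1.
Proof. by rewrite (nik_e1E N) linearB /= antipode1 Se0. Qed.

Let Da : comult H a = a ⊗ a.
Proof.
case: coE => -[Dua _ Dva _ _] _ _.
by rewrite rmorphD /= Dua Dva !tensDl !tensDr addrACA [va ⊗ va + _]addrC.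
Qed.

Let Db : comult H b = (e0 * b) ⊗ b + (e1 * b) ⊗ b ^+ p.-1.
Proof.
case: coE => -[_ Dub _ Dvb _] _ _; rewrite e0b e1b bX // -p1.
by rewrite rmorphD /= Dub Dvb !tensDr addrACA [vb ⊗ ub ^+ _ + _]addrC.
Qed.

Let ca : counit H a = 1.
Proof. by case: coE => _ [cua _ cva _ _] _; rewrite rmorphD /= cua cva addr0. Qed.
Let cb : counit H b = 1.
Proof. by case: coE => _ [_ cub _ cvb _] _; rewrite rmorphD /= cub cvb addr0. Qed.

Let Sa : antipode H a = a ^+ p.-1.
Proof. by case: coE => _ _ [Sua _ Sva _ _]; rewrite linearD /= Sua Sva p1 -aX. Qed.
Let Sb : antipode H b = e0 * b ^+ p.-1 + e1 * b.
Proof.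
case: coE => _ _ [_ Sub _ Svb _]; rewrite linearD /= Sub Svb p1 e1b; congr (_ + _).
by rewrite (nik_block_expb0 rel) /block_exp eqn0Ngt pp0.
Qed.

Let zV n : z ^ (- n%:Z) = z^-1 ^+ n.
Proof. by rewrite -exprnN exprVn. Qed.

Let Dg : comult H g = nik_comult_g p z e0 e1 a b g.
Proof.
case: coE => -[_ _ _ _ ->] _ _; rewrite /nikshych_comult_g /nik_comult_g.
have gu i j : g * block_exp e0 ua i * block_exp e0 ub j = g * (e0 * (a ^+ i * b ^+ j)).
  rewrite -(nik_block_expa0 rel) -(nik_block_expb0 rel) -mulrA; congr (_ * _).
  by rewrite -mulrA [a ^+ i * (_ * _)]mulrA -(commX_l (nik_e0a N)) !mulrA (nik_e00 N).
have gv i j : g * block_exp e1 va i * block_exp e1 vb j = g * (e1 * (a ^+ i * b ^+ j)).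
  rewrite -(nik_block_expa1 rel) -(nik_block_expb1 rel) -mulrA; congr (_ * _).
  by rewrite -mulrA [a ^+ i * (_ * _)]mulrA -(commX_l (nik_e1a N)) !mulrA (nik_e11 N).
move: gu gv; case: (x) => E0 E1 UA UB VA VB GG /= gu gv.
congr (_ *: _ + _ *: _ + _ *: _ + _ *: _).
- apply: eq_bigr => i _; apply: eq_bigr => j _; apply: eq_bigr => k _; apply: eq_bigr => l _.
  by rewrite !gu expfzDr // zV.
- by apply: eq_bigr => k _; apply: eq_bigr => l _; rewrite gu gv zV.
- by apply: eq_bigr => k _; apply: eq_bigr => l _; rewrite gu gv subn1.
by apply: eq_bigr => k _; apply: eq_bigr => l _; rewrite !gv subn1.
Qed.

Let p2 n : (p.-1 * (p.-1 * n) = n + (p - 2) * n * p)%N.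
Proof.
case: (p) p_gt1 => // -[|q] //= _; rewrite subSS subSS subn0; ring.
Qed.
Let invX (u : H) n : u ^+ p = 1 -> u ^+ (p.-1 * (p.-1 * n)) = u ^+ n.
Proof. by move=> up; rewrite p2 exprD mulnC exprM up expr1n mulr1. Qed.

(* The automorphism inverting a and b. *)
Let psi_gens : nikshych_gens H :=
  NikshychGens e0 e1 (ua ^+ p.-1) (ub ^+ p.-1) (va ^+ p.-1) (vb ^+ p.-1) g.

Let psi_rel : nikshych_relations p z psi_gens.
Proof.
case: relE => -[h1 h2 h3] [uap ubp e0ua e0ub uab] [vap vbp e1va e1vb vab] [gg gua gub gva gvb].
have swapX (u v : H) n : g * u = v * g -> g * u ^+ n = v ^+ n * g.
  move=> guv; elim: n => [|n IH]; first by rewrite mulr1 mul1r.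
  by rewrite !exprS mulrA guv -mulrA IH mulrA.
have eX (e u : H) n : e * u = u -> (0 < n)%N -> e * u ^+ n = u ^+ n.
  by move=> eu; case: n => // n _; rewrite exprS mulrA eu.
have pX (e u : H) : e * e = e -> u ^+ p = e -> (u ^+ p.-1) ^+ p = e.
  by move=> ee up; rewrite -exprM mulnC exprM up idemX.
have e00 := nik_e00 N; have e11 := nik_e11 N.
split; split=> //; do ?[exact: swapX | exact: pX | exact: eX].
- have c : GRing.comm ua ub := uab.
  exact: commrX (commr_sym (commrX _ (commr_sym c))).
have vab1 : 1 * (va * vb) = z *: (1 * (vb * va)) by rewrite !mul1r.
have comm1 (u : H) : 1 * u = u * 1 by rewrite mul1r mulr1.
have := q_commuteX (comm1 va) (comm1 vb) vab1 p.-1 p.-1.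
have -> : z ^+ (p.-1 * p.-1) = z.
  have -> : (p.-1 * p.-1 = 1 + (p - 2) * p)%N by rewrite -[X in (_ * X)%N]muln1 p2 muln1.
  by rewrite exprD mulnC exprM (prim_expr_order z_prim) expr1n mulr1.
by rewrite !mul1r.
Qed.

(** The inverses of u_a, v_a, u_b, v_b satisfy the defining relations again, since inverting
both of two elements with v_a v_b = z v_b v_a does not change the scalar; this gives psi. It
respects the coproduct of g because the sums there run over full periods of all exponents,
so that the signs of the exponents can be changed. *)
Lemma nik_hopf_of_presentation :
  exists G : grading H, nik_hopf p z G e0 e1 a b g.
Proof.
case: pres => _ _ univ; have [psi] := univ H psi_gens psi_rel.
rewrite /map_gens /psi_gens => -[h0 h1 hua hub hva hvb hg].
have ha : psi a = a ^+ p.-1 by rewrite aX // rmorphD /= hua hva.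
have hb : psi b = b ^+ p.-1 by rewrite bX // rmorphD /= hub hvb.
have psiX u n : psi (u ^+ n) = psi u ^+ n by rewrite rmorphXn.
have ppX (u : H) : u ^+ p = 1 -> (u ^+ p.-1) ^+ p.-1 = u.
  by move=> up; have := @invX u 1 up; rewrite muln1 exprM expr1.
have psiK h : psi (psi h) = h.
  elim/gen: h => [|u v IH IH'|k u IH|u v IH IH'|||||]; rewrite ?rmorph1 //.
  - by rewrite !rmorphD /= IH IH'.
  - by rewrite !linearZZ /= IH.
  - by rewrite !rmorphM /= IH IH'.
  - by rewrite !h0.
  - by rewrite !h1.
  - by rewrite ha psiX ha ppX // (nik_ap N).
  - by rewrite hb psiX hb ppX // (nik_bp N).
  by rewrite !hg.
have two1 h : h - 2%:R^-1 *: (h - psi h) = 2%:R^-1 *: (h + psi h).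
  rewrite scalerBr opprB addrA -{1}[h]scale1r addrAC -scalerBl scalerDr; congr (_ *: _ + _).
  by field.
pose odd h := 2%:R^-1 *: (h - psi h).
have odd_lin : linear odd.
  move=> k u v; rewrite /odd linearP opprD addrACA scalerDr -scalerBr !scalerA.
  by rewrite [k * _]mulrC.
pose oddH := HB.pack_for {linear H -> H} odd (GRing.isLinear.Build K H H _ odd odd_lin).
have half u : 2%:R^-1 *: u + 2%:R^-1 *: u = u :> H.
  by rewrite -scalerDl -mulr2n -[_ *+ 2]mulr_natl mulfV // scale1r.
have psi_odd h : psi (odd h) = - odd h.
  by rewrite /odd [LHS]linearZZ rmorphB /= psiK -scalerN opprB.
have oddK h : oddH (oddH h) = oddH h.
  by rewrite /= {1}/odd psi_odd opprK scalerDr half.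
have oddM u v : oddH (u * v) = oddH u * (v - oddH v) + (u - oddH u) * oddH v.
  rewrite /= !two1 /odd -!scalerAl -!scalerAr !scalerA -scalerDr rmorphM /=.
  have -> : (u - psi u) * (v + psi v) + (u + psi u) * (v - psi v)
     = 2%:R *: (u * v - psi u * psi v).
    rewrite scaler_nat mulr2n !mulrBl !mulrDl !mulrBr !mulrDr.
    set X := u * v; set Y := psi u * psi v; set Z := u * psi v; set W := psi u * v.
    by rewrite opprD addrACA [X + Z + _]addrACA subrr addr0 [- W - Y + _]addrACA addNr add0r addrACA.
  by rewrite scalerA -mulrA mulVf // mulr1.
pose G : grading H := Grading oddK oddM.
have psi_lin := lin_linear psi.
pose PP := tmap psi psi.
have PPD : {morph PP : s t / s + t} := linear_fD (tmap_linear psi_lin psi_lin).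
have PPZ k s : PP (k *: s) = k *: PP s := linear_fZ (tmap_linear psi_lin psi_lin) k s.
have PPE u v : PP (u ⊗ v) = psi u ⊗ psi v := tmapE u v psi_lin psi_lin.
have PP0 : PP 0 = 0 := linear_f0 (tmap_linear psi_lin psi_lin).
have PPs I (r : seq I) (F : I -> tensor H H) :
    PP (\sum_(i <- r) F i) = \sum_(i <- r) PP (F i).
  by elim/big_rec2: _ => // i u v _ <-.
have PPM : {morph PP : s t / s * t}.
  move=> s t; elim/tensor_ind: s => [u v|s s' IH IH']; last by rewrite mulrDl !PPD IH IH' mulrDl.
  elim/tensor_ind: t => [u' v'|t t' IH IH']; last by rewrite mulrDr !PPD IH IH' mulrDr.
  by rewrite tensM !PPE !rmorphM tensM.
have eXM (e u : H) n : e * e = e -> e * u = u * e -> (0 < n)%N -> (e * u) ^+ n = e * u ^+ n.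
  by move=> ee eu n0; rewrite exprMn_comm // (idemX ee n0).
have orth0 (u v : H) : u * e0 = e0 * u -> (e0 * u) * (e1 * v) = 0.
  by move=> eu; rewrite -eu mulrA -[u * e0 * e1]mulrA (nik_e01 N) mulr0 mul0r.
have orth1 (u v : H) : v * e1 = e1 * v -> (e1 * v) * (e0 * u) = 0.
  by move=> ev; rewrite -ev mulrA -[v * e1 * e0]mulrA (nik_e10 N) mulr0 mul0r.
have e0bC := nik_e0b N; have e1bC := nik_e1b N.
have ob0 (v : H) := orth0 b v (esym e0bC).
have ob1 (u : H) := orth1 u b (esym e1bC).
have Dbn : (comult H b) ^+ p.-1
    = (e0 * b ^+ p.-1) ⊗ b ^+ p.-1 + (e1 * b ^+ p.-1) ⊗ b.
  rewrite Db orth_exprX ?tensM ?ob0 ?ob1 ?tens0l // !tensMX.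
  by rewrite !eXM ?(nik_e00 N) ?(nik_e11 N) // ppX // (nik_bp N).
have Dpsi h : comult H (psi h) = PP (comult H h).
  elim/gen: h => [|u v IH IH'|k u IH|u v IH IH'|||||].
  - by rewrite !rmorph1 -tens1 PPE rmorph1.
  - by rewrite !rmorphD /= IH IH' PPD.
  - by rewrite !linearZZ /= IH PPZ.
  - by rewrite !rmorphM /= IH IH' PPM.
  - by rewrite h0 De0 PPD !PPE h0 h1.
  - by rewrite h1 De1 PPD !PPE h0 h1.
  - by rewrite ha rmorphXn /= Da PPE ha tensMX.
  - rewrite hb rmorphXn /= Dbn Db PPD !PPE !rmorphM /= h0 h1 psiX hb.
    by rewrite ppX // (nik_bp N).
  have zm (w : K) m n : w ^+ p = 1 -> (m = n %[mod p])%N -> w ^+ m = w ^+ n.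
    by move=> wp mn; rewrite -(expr_mod m wp) mn (expr_mod n wp).
  have zp := prim_expr_order z_prim.
  have zip : z^-1 ^+ p = 1 by rewrite exprVn zp invr1.
  have aper n : a ^+ (n %% p) = a ^+ n by rewrite (expr_mod n (nik_ap N)).
  have bper n : b ^+ (n %% p) = b ^+ n by rewrite (expr_mod n (nik_bp N)).
  have aper1 k l : a ^+ (k %% p + l) = a ^+ (k + l) by rewrite -aper modnDml aper.
  have aper2 k l : a ^+ (k + l %% p) = a ^+ (k + l) by rewrite -aper modnDmr aper.
  have bper1 k l : b ^+ (k %% p + l) = b ^+ (k + l) by rewrite -bper modnDml bper.
  have bper2 k l : b ^+ (k + l %% p) = b ^+ (k + l) by rewrite -bper modnDmr bper.
  have bper3 k : b ^+ (p.-1 * (k %% p)) = b ^+ (p.-1 * k) by rewrite -bper modnMmr bper.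
  have aper3 k : a ^+ (p.-1 * (k %% p)) = a ^+ (p.-1 * k) by rewrite -aper modnMmr aper.
  have bper4 k l : b ^+ (p.-1 * (k %% p + l)) = b ^+ (p.-1 * (k + l)).
    by rewrite -bper -modnMmr modnDml modnMmr bper.
  have bper5 k l : b ^+ (p.-1 * (k + l %% p)) = b ^+ (p.-1 * (k + l)).
    by rewrite -bper -modnMmr modnDmr modnMmr bper.
  have sq m n : (p.-1 * m * (p.-1 * n) = m * n %[mod p])%N.
    have -> : (p.-1 * m * (p.-1 * n) = p.-1 * (p.-1 * (m * n)))%N by ring.
    by rewrite p2 addnC modnMDl.
  pose U i j := g * (e0 * (a ^+ i * b ^+ j)).
  pose V i j := g * (e1 * (a ^+ i * b ^+ j)).
  have hU i j : psi (U i j) = U (p.-1 * i)%N (p.-1 * j)%N.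
    by rewrite /U !rmorphM /= hg h0 !psiX ha hb !exprM.
  have hV i j : psi (V i j) = V (p.-1 * i)%N (p.-1 * j)%N.
    by rewrite /V !rmorphM /= hg h1 !psiX ha hb !exprM.
  have mm m m' n n' : m = m' %[mod p] -> n = n' %[mod p] -> (m * n = m' * n' %[mod p])%N.
    by move=> em en; rewrite -modnMm em en modnMm.
  have md m m' n n' : m = m' %[mod p] -> n = n' %[mod p] -> (m + n = m' + n' %[mod p])%N.
    by move=> em en; rewrite -modnDm em en modnDm.
  have mo m : m %% p = m %[mod p] by rewrite modn_mod.
  rewrite hg Dg /nik_comult_g !PPD !PPZ; congr (_ *: _ + _ *: _ + _ *: _ + _ *: _); apply: esym.
  - pose f i j k l := (z ^+ (k * j) * z^-1 ^+ (i * l)) *: (U i j ⊗ U k l).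
    transitivity (\sum_(i < p) \sum_(j < p) \sum_(k < p) \sum_(l < p)
        f (p.-1 * i)%N (p.-1 * j)%N (p.-1 * k)%N (p.-1 * l)%N).
      rewrite PPs; apply: eq_bigr => i _; rewrite PPs; apply: eq_bigr => j _.
      rewrite PPs; apply: eq_bigr => k _; rewrite PPs; apply: eq_bigr => l _.
      by rewrite PPZ PPE !hU /f; congr (_ * _ *: _); apply: zm.
    transitivity (\sum_(i < p) \sum_(j < p) \sum_(k < p) \sum_(l < p)
        f (p.-1 * i)%N (p.-1 * j)%N k l).
      apply: eq_bigr => i _; apply: eq_bigr => j _.
      apply: (sum2_opp_index (f := f (p.-1 * i)%N (p.-1 * j)%N)) => // m n;
        rewrite /f /U ?aper ?bper; congr (_ * _ *: _); apply: zm => //; exact: mm.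
    apply: (sum2_opp_index (f := fun i j => \sum_(k < p) \sum_(l < p) f i j k l)) => // m n;
      apply: eq_bigr => k _; apply: eq_bigr => l _;
      rewrite /f /U ?aper ?bper; congr (_ * _ *: _); apply: zm => //; exact: mm.
  - pose f k l := z^-1 ^+ ((k + l) * k) *: (U k l ⊗ V (k + l)%N (k + l)%N).
    transitivity (\sum_(k < p) \sum_(l < p) f (p.-1 * k)%N (p.-1 * l)%N).
      rewrite PPs; apply: eq_bigr => k _; rewrite PPs; apply: eq_bigr => l _.
      by rewrite PPZ PPE hU hV /f -mulnDr; congr (_ *: _); apply: zm.
    apply: sum2_opp_index => // m n;
      rewrite /f /U /V ?(aper, bper, aper1, aper2, bper1, bper2); congr (_ *: _); apply: zm => //;
      by apply: mm => //; apply: md.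
  - pose f k l := z ^+ (k * (k + l)) *: (V (k + l)%N (p.-1 * (k + l))%N ⊗ U k l).
    transitivity (\sum_(k < p) \sum_(l < p) f (p.-1 * k)%N (p.-1 * l)%N).
      rewrite PPs; apply: eq_bigr => k _; rewrite PPs; apply: eq_bigr => l _.
      by rewrite PPZ PPE hU hV /f -mulnDr; congr (_ *: _); apply: zm.
    apply: sum2_opp_index => // m n;
      rewrite /f /U /V ?(aper, bper, aper1, aper2, bper4, bper5); congr (_ *: _); apply: zm => //;
      by apply: mm => //; apply: md.
  pose f k l := V k l ⊗ V (p.-1 * l)%N k.
  transitivity (\sum_(k < p) \sum_(l < p) f (p.-1 * k)%N (p.-1 * l)%N).
    rewrite PPs; apply: eq_bigr => k _; rewrite PPs; apply: eq_bigr => l _.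
    by rewrite PPE !hV.
  by apply: sum2_opp_index => // m n; rewrite /f /V ?(aper, bper, aper3).
have oddE h : G h = 2%:R^-1 *: (h - psi h) by [].
have Dodd h : comult H (G h) = tens_odd G (comult H h).
  have E s : tens_odd G s = 2%:R^-1 *: (s - PP s).
    have GL : linear G by exact: linearP.
    have evL : linear (fun u => u - G u).
      by move=> k u v; rewrite GL opprD addrACA scalerBr.
    elim/tensor_ind: s => [u v|s t IH IH'].
      rewrite /tens_odd !tmapE // !oddE !two1 PPE !tensZl !tensZr -!scalerDr scalerA.
      have -> : (u - psi u) ⊗ (v + psi v) + (u + psi u) ⊗ (v - psi v)
         = 2%:R *: (u ⊗ v - psi u ⊗ psi v).
        rewrite scaler_nat mulr2n !tensBl !tensDl !tensBr !tensDr.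
        set X := u ⊗ v; set Y := psi u ⊗ psi v; set Z := u ⊗ psi v; set W := psi u ⊗ v.
        by rewrite opprD addrACA [X + Z + _]addrACA subrr addr0 [- W - Y + _]addrACA addNr add0r addrACA.
      by rewrite scalerA -mulrA mulVf // mulr1.
    rewrite (tens_oddD G s) IH IH' PPD [- (PP s + _)]opprD -scalerDr.
    by rewrite [in RHS]addrACA.
  by rewrite E oddE linearZZ rmorphB /= Dpsi.
have codd h : counit H (G h) = 0.
  have cpsi u : counit H (psi u) = counit H u.
    elim/gen: u => [|u v IH IH'|k u IH|u v IH IH'|||||]; rewrite ?h0 ?h1 ?hg //.
    - by rewrite !rmorph1.
    - by rewrite !rmorphD /= IH IH'.
    - by rewrite !linearZZ /= IH.
    - by rewrite !rmorphM /= IH IH'.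
    - by rewrite ha rmorphXn /= ca expr1n.
    by rewrite hb rmorphXn /= cb expr1n.
  by rewrite oddE linearZZ rmorphB /= cpsi subrr scaler0.
have Sodd h : antipode H (G h) = G (antipode H h).
  have Spsi u : antipode H (psi u) = psi (antipode H u).
    case: coE => _ _ [_ _ _ _ Sg].
    elim/gen: u => [|u v IH IH'|k u IH|u v IH IH'|||||].
    - by rewrite rmorph1 !antipode1 rmorph1.
    - by rewrite rmorphD !linearD /= IH IH'.
    - by rewrite !linearZZ /= IH.
    - by rewrite rmorphM !antipodeM /= IH IH' rmorphM.
    - by rewrite h0 Se0 h0.
    - by rewrite h1 Se1 h1.
    - by rewrite ha SX Sa psiX ha.
    - rewrite hb SX Sb rmorphD !rmorphM /= h0 h1 psiX hb.
      rewrite orth_exprX ?orth1 ?ob1 //; last first.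
        by rewrite orth0 // -(commX_l e0bC).
      by rewrite !eXM ?(nik_e00 N) ?(nik_e11 N) // (commX_l e0bC).
    by rewrite hg Sg hg.
  by rewrite !oddE linearZZ linearB /= Spsi.
exists G; split=> //.
- by case: coE => _ [_ _ _ _ ?] _.
- by case: coE => _ _ [_ _ _ _ ?].
- by rewrite oddE h0 subrr scaler0.
- by rewrite oddE h1 subrr scaler0.
- by rewrite oddE hg subrr scaler0.
- by rewrite oddE ha.
by rewrite oddE hb.
Qed.

End FromPresentation.

(** * The trace form *)

Section Representations.
Variables (K : fieldType) (q : nat) (z : K).
Local Notation p := q.+1.
Hypothesis z_prim : p.-primitive_root z.

Let zp : z ^+ p = 1 := prim_expr_order z_prim.

Let mk2 (a b c d : K) : 'M[K]_2 :=
  \matrix_(i, j) if i == ord0 then (if j == ord0 then a else b)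
                 else (if j == ord0 then c else d).

Let mk2M a b c d a' b' c' d' : mk2 a b c d * mk2 a' b' c' d' =
  mk2 (a * a' + b * c') (a * b' + b * d') (c * a' + d * c') (c * b' + d * d').
Proof.
apply/matrixP=> i j; rewrite !mxE !big_ord_recl big_ord0 !mxE /= addr0.
by case: (i == ord0); case: (j == ord0).
Qed.

Let mk2_1 : mk2 1 0 0 1 = 1.
Proof.
apply/matrixP=> i j; rewrite !mxE.
by case: i => [[|[|?]] ?] //; case: j => [[|[|?]] ?].
Qed.

Let tr_mk2 a b c d : \tr (mk2 a b c d) = a + d.
Proof. by rewrite /mxtrace !big_ord_recl big_ord0 !mxE /= addr0. Qed.

Let dg (u v : K) := mk2 u 0 0 v.
Let dgM u v u' v' : dg u v * dg u' v' = dg (u * u') (v * v').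
Proof. by rewrite /dg mk2M !mulr0 !mul0r !addr0 !add0r. Qed.
Let dgX u v n : dg u v ^+ n = dg (u ^+ n) (v ^+ n).
Proof. by elim: n => [|n IH]; rewrite ?mk2_1 // !exprS IH dgM. Qed.

(* On the block e0: induced from the character a -> z^r, b -> z^s. *)
Definition rep0 (r s : nat) : nikshych_gens 'M[K]_2 :=
  NikshychGens 1 0 (dg (z ^+ r) (z ^+ s)) (dg (z ^+ s) (z ^+ r)) 0 0 (mk2 0 1 1 0).

Lemma rep0_rel r s : nikshych_relations p z (rep0 r s).
Proof.
have zXp n : (z ^+ n) ^+ p = 1 by rewrite -exprM mulnC exprM zp expr1n.
split; split; rewrite ?addr0 ?mulr0 ?mul0r ?mul1r ?scaler0 ?dgX ?zXp ?mk2_1 ?expr0n //.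
- by rewrite !dgM [z ^+ r * _]mulrC.
- by rewrite expr2 mk2M !mulr0 !mul0r !mulr1 !addr0 !add0r mk2_1.
- by rewrite /dg !mk2M !mulr0 !mul0r !mul1r !mulr1 !addr0 !add0r.
by rewrite /dg !mk2M !mulr0 !mul0r !mul1r !mulr1 !addr0 !add0r.
Qed.

Lemma rep0_trace r s i j (eps : bool) :
  \tr ((dg (z ^+ r) (z ^+ s)) ^+ i * (dg (z ^+ s) (z ^+ r)) ^+ j * (mk2 0 1 1 0) ^+ eps)
  = if eps then 0 else (z ^+ i) ^+ r * (z ^+ j) ^+ s + (z ^+ i) ^+ s * (z ^+ j) ^+ r.
Proof.
rewrite !dgX dgM -!exprM [(r * i)%N]mulnC [(s * j)%N]mulnC [(s * i)%N]mulnC [(r * j)%N]mulnC.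
case: eps => /=; last by rewrite mulr1 tr_mk2.
by rewrite /dg mk2M tr_mk2 !mulr0 !mul0r !addr0.
Qed.

Let M (n : nat) (s : 'I_p) : 'M[K]_p := \matrix_(i, j) ((z ^+ i) ^+ n * (i == j + s)%:R).

Let MM0 n m t : M n 0 * M m t = M (n + m) t.
Proof.
apply/matrixP=> i j; rewrite !mxE (bigD1 i) //= big1 => [|k ki].
  by rewrite !mxE !addr0 eqxx mulr1 mulrA -exprD.
by rewrite !mxE addr0 eq_sym (negbTE ki) mulr0 mul0r.
Qed.

Let M0M s t : M 0 s * M 0 t = M 0 (s + t).
Proof.
apply/matrixP=> i j; rewrite !mxE (bigD1 (j + t)) //= big1 => [|k kj].
  by rewrite !mxE eqxx !expr0 !mul1r mulr1 addr0 -addrA [t + s]addrC.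
by rewrite !mxE (negbTE kj) !mulr0.
Qed.

Let one : 'I_p := inord 1.

Let oneE : nat_of_ord one = (1 %% p)%N.
Proof. by rewrite /one /inord val_insubd; case: (q) => [|q'] //=; rewrite modn_small. Qed.

Let M_comm : M 1 0 * M 0 one = z *: (M 0 one * M 1 0).
Proof.
rewrite MM0 addn0; apply/matrixP=> i j; rewrite !mxE (bigD1 j) //= big1 => [|k kj].
  rewrite !mxE !addr0 eqxx !expr1 expr0; case: eqP => [->|_]; last by rewrite /= mulr0n; ring.
    suff -> : z ^+ (j + one)%R = z * z ^+ j by rewrite /= mulr1n; ring.
  by rewrite /= oneE modnDmr expr_mod // addn1 exprS.
by rewrite !mxE addr0 (negPf kj) !mulr0.
Qed.

Let MnX n m : M n 0 ^+ m = M (n * m) 0.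
Proof.
elim: m => [|m IH]; last by rewrite exprS IH MM0 mulnS.
by rewrite muln0; apply/matrixP=> i j; rewrite expr0 !mxE mul1r addr0.
Qed.

Let M0X s m : M 0 s ^+ m = M 0 (s *+ m).
Proof.
elim: m => [|m IH]; last by rewrite exprS IH M0M mulrS.
by rewrite mulr0n; apply/matrixP=> i j; rewrite expr0 !mxE mul1r addr0.
Qed.

Let one_mul m : (one *+ m == 0) = (p %| m)%N.
Proof.
by rewrite -val_eqE /= Zp_mulrn /= oneE modnMml mul1n.
Qed.

(* On the block e1: clock and shift matrices, with g acting by a sign. *)
Definition rep1 (eps : bool) : nikshych_gens 'M[K]_p :=
  NikshychGens 0 1 0 0 (M 1 0) (M 0 one) ((-1) ^+ eps).

Lemma rep1_rel eps : nikshych_relations p z (rep1 eps).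
Proof.
have Mp : M 1 0 ^+ p = 1.
  rewrite MnX mul1n; apply/matrixP=> i j; rewrite !mxE -exprM mulnC exprM zp expr1n mul1r.
  by rewrite addr0.
have M0p : M 0 one ^+ p = 1.
  rewrite M0X; have /eqP -> : one *+ p == 0 by rewrite one_mul.
  by apply/matrixP=> i j; rewrite !mxE mul1r addr0.
have sgC (x : 'M[K]_p) : (-1) ^+ eps * x = x * (-1) ^+ eps by exact/commr_sym/commr_sign.
split; split; rewrite ?add0r ?mulr0 ?mul0r ?mul1r ?expr0n //.
by rewrite -exprM mulnC exprM sqrrN !expr1n.
Qed.

Lemma rep1_trace i j (e eps : bool) :
  \tr (M 1 0 ^+ i * M 0 one ^+ j * ((-1) ^+ e) ^+ eps)
  = (-1) ^+ (e && eps) * (if (p %| i)%N && (p %| j)%N then p%:R else 0).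
Proof.
have -> : ((-1) ^+ e) ^+ eps = ((-1) ^+ (e && eps))%:M :> 'M[K]_p.
  by case: e; case: eps; rewrite /= ?expr1 ?expr0 // ?raddfN //= rmorphN1.
set P := _ ^+ i * _; rewrite -mulmxE mul_mx_scalar {}/P linearZ /=; congr (_ * _).
rewrite MnX M0X mul1n MM0 addn0 /mxtrace.
under eq_bigr do rewrite mxE -subr_eq0 opprD addNKr oppr_eq0 one_mul.
case: (p %| j)%N; last by rewrite andbF big1 // => k _; rewrite mulr0.
rewrite andbT -(sum_prim_expr z_prim); apply: eq_bigr => k _.
by rewrite mulr1 -!exprM mulnC.
Qed.

Section Trace.
Variables (H : algType K) (x : nikshych_gens H).
Hypothesis p_gt1 : (1 < p)%N.
Hypothesis p_neq0 : p%:R != 0 :> K.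
Hypothesis two_neq0 : 2%:R != 0 :> K.
Hypothesis pres : nikshych_presentation p z x.
Local Notation mon := (nik_monom (gen_e0 x) (gen_e1 x) (gen_ua x + gen_va x)
                         (gen_ub x + gen_vb x) (gen_g x)).

(** The normalized traces of the representations above, each of which occurs in the regular
representation, isolate the coefficients of e_0 and e_1. *)
Lemma nik_trace : exists tau : H -> K, scalar tau /\
  forall k i j eps, tau (mon k i j eps) = [&& (p %| i)%N, (p %| j)%N & ~~ eps]%:R.
Proof.
case: pres => _ _ univ.
pose chi r s := projT1 (cid (univ _ _ (rep0_rel r s))).
have chiE r s : map_gens (chi r s) x = rep0 r s := projT2 (cid (univ _ _ (rep0_rel r s))).
pose rho e := projT1 (cid (univ _ _ (rep1_rel e))).
have rhoE e : map_gens (rho e) x = rep1 e := projT2 (cid (univ _ _ (rep1_rel e))).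
pose tau h := (2%:R * p%:R ^+ 2)^-1 * (\sum_(r < p) \sum_(s < p) \tr (chi r s h))
   + (2%:R * p%:R)^-1 * (\tr (rho false h) + \tr (rho true h)).
exists tau; split=> [k u v|k i j eps].
  have trL n (f : {lrmorphism H -> 'M[K]_n.+1}) :
      \tr (f (k *: u + v)) = k * \tr (f u) + \tr (f v).
    by rewrite linearP /= mxtraceD mxtraceZ.
  rewrite /tau !trL.
  have -> : \sum_(r < p) \sum_(s < p) \tr (chi r s (k *: u + v)) =
      k * (\sum_(r < p) \sum_(s < p) \tr (chi r s u)) + \sum_(r < p) \sum_(s < p) \tr (chi r s v).
    rewrite mulr_sumr -big_split; apply: eq_bigr => r _ /=.
    by rewrite mulr_sumr -big_split; apply: eq_bigr => s _ /=.
  by ring.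
have chi_mon r s : chi r s (mon k i j eps) =
   if k then 0 else (dg (z ^+ r) (z ^+ s)) ^+ i * (dg (z ^+ s) (z ^+ r)) ^+ j * (mk2 0 1 1 0) ^+ eps.
  have [h0 h1 hua hub hva hvb hg] := chiE r s.
  rewrite /nik_monom !rmorphM !rmorphXn !rmorphD /= hua hub hva hvb hg !addr0.
  by case: k; rewrite ?h0 ?h1 ?mul0r ?mul1r.
have rho_mon e : rho e (mon k i j eps) =
   if k then M 1 0 ^+ i * M 0 one ^+ j * ((-1) ^+ e) ^+ eps else 0.
  have [h0 h1 hua hub hva hvb hg] := rhoE e.
  rewrite /nik_monom !rmorphM !rmorphXn !rmorphD /= hua hub hva hvb hg !add0r.
  by case: (k); rewrite ?h0 ?h1 ?mul0r ?mul1r.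
rewrite /tau !rho_mon; under eq_bigr do under eq_bigr do rewrite chi_mon.
case: k chi_mon rho_mon => _ _.
  rewrite big1 => [|r _]; last by rewrite big1 // => s _; rewrite linear0.
  rewrite mulr0 add0r !rep1_trace andFb expr0 mul1r andTb.
  case: ifP => [/andP[-> ->]|]; last first.
    by rewrite !mulr0 addr0 mulr0; case: (p %| i)%N => //= ->.
  case: eps => /=; first by rewrite expr1 mulN1r subrr mulr0.
  by rewrite expr0 mul1r -mulr2n -[p%:R *+ 2]mulr_natl mulVf // mulf_neq0.
rewrite !linear0 addr0 mulr0 addr0.
under eq_bigr do under eq_bigr do rewrite rep0_trace.
case: eps; first by rewrite !andbF big1 ?mulr0 // => r _; rewrite big1.
rewrite andbT.
have E i' j' : \sum_(r < p) \sum_(s < p) (z ^+ i') ^+ r * (z ^+ j') ^+ s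
   = p%:R ^+ 2 * ((p %| i')%N && (p %| j')%N)%:R.
  under eq_bigr do rewrite -mulr_sumr.
  rewrite -mulr_suml !(sum_prim_expr z_prim).
  by case: (p %| i')%N; case: (p %| j')%N; rewrite /= ?mulr1 ?mulr0 ?mul0r.
under eq_bigr do rewrite big_split.
rewrite big_split /= E.
have -> : \sum_(r < p) \sum_(s < p) (z ^+ i) ^+ s * (z ^+ j) ^+ r
   = p%:R ^+ 2 * ((p %| i)%N && (p %| j)%N)%:R.
  by rewrite exchange_big /= E.
rewrite -mulr2n -[(_ * _) *+ 2]mulr_natl mulrA mulKf // mulf_neq0 // expf_neq0 //.
Qed.
End Trace.
End Representations.

(** * Integrality of the canonical elements on a block *)

Section RmatFacts.
Variables (K : fieldType) (p : nat) (q : K).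

(** Naturality, used to compute in H ⊗ H and to conclude in the twisted tensor square. *)
Lemma rmat_morph (A B : algType K) (f : A -> B) (x y : A) :
    f 1 = 1 -> {morph f : x y / x + y} -> {morph f : x y / x * y} ->
    (forall k x, f (k *: x) = k *: f x) ->
  f (rmat p q x y) = rmat p q (f x) (f y).
Proof.
move=> f1 fD fM fZ.
have f0 : f 0 = 0 by rewrite -(scale0r (0 : A)) fZ scale0r.
have fX u n : f (u ^+ n) = f u ^+ n by elim: n => [|n IH]; rewrite ?f1 // !exprS fM IH.
have fs n (F : nat -> A) : f (\sum_(i < n) F i) = \sum_(i < n) f (F i).
  by elim/big_rec2: _ => // i u v _ <-.
rewrite /rmat fZ (fs _ (fun k => \sum_(l < p) q^-1 ^+ (k * l) *: (x ^+ k * y ^+ l))).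
congr (_ *: _); apply: eq_bigr => k _.
rewrite (fs _ (fun l => q^-1 ^+ (k * l) *: (x ^+ k * y ^+ l))); apply: eq_bigr => l _.
by rewrite fZ fM !fX.
Qed.

Variable B : algType K.
Variables (R : subringClosed K) (L : B -> Prop) (LR : Rsubalg R L).
Variables (c : K) (t : B).
Hypothesis q_prim : p.-primitive_root q.
Hypothesis p_neq0 : p%:R != 0 :> K.
Hypothesis c_neq0 : c != 0.
Hypothesis tC : forall x, t * x = x * t.
Hypothesis tt : t * t = c%:A.
Hypothesis Lt : L t.
Hypothesis q_in : q \in R.
Hypothesis q1_c : (q - 1) / c \in R.
Hypothesis c_q1 : forall i, (0 < i < p)%N -> c / (q ^+ i - 1) \in R.

(** Off the block, y can be replaced by 1; so it is enough that e y^p = e. *)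
Lemma rmat_block_in e x y : L e -> e * e = e -> e * x = x * e -> e * y = y * e ->
  near1 L t x -> near1 L t y -> e * y ^+ p = e -> L (e * rmat p q x y).
Proof.
move=> Le ee ex ey hx hy eyp; pose y' := e * y + (1 - e) * 1.
have L1e : L (1 - e) by apply: (RsubalgB LR) => //; exact: (Rsubalg1 LR).
have hy' : near1 L t y'.
  by apply: (near1_glue LR) => //; [rewrite addrC subrK|exact: (near1_1 LR)].
have ey' n : e * y' ^+ n = e * y ^+ n.
  elim: n => // n IH; rewrite !exprSr !mulrA IH /y' mulr1 mulrDr.
  have eyn : e * y ^+ n = y ^+ n * e by apply: commX_l.
  have z0 : e * y ^+ n * (1 - e) = 0 by rewrite eyn -mulrA mulrBr mulr1 ee subrr mulr0.
  by rewrite z0 addr0 mulrA -[e * y ^+ n * e]mulrA -eyn !mulrA ee.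
have e1y' n : (1 - e) * y' ^+ n = 1 - e.
  elim: n => [|n IH]; first by rewrite mulr1.
  have f0 : (1 - e) * e = 0 by rewrite mulrBl mul1r ee subrr.
  by rewrite exprSr mulrA IH /y' mulr1 mulrDr mulrA f0 mul0r add0r mulrBr mulr1 f0 subr0.
have y'p : y' ^+ p = 1.
  by rewrite -[LHS]mul1r -[1 in LHS](subrK e) mulrDl e1y' ey' eyp subrK.
have -> : e * rmat p q x y = e * rmat p q x y'.
  rewrite /rmat -!scalerAr; congr (_ *: _); rewrite !mulr_sumr.
  apply: eq_bigr => k _; rewrite !mulr_sumr; apply: eq_bigr => l _.
  by rewrite -!scalerAr !mulrA (commX_l ex) -!mulrA ey'.
by apply: (RsubalgM LR) => //; apply: (rmat_in q_prim p_neq0 LR c_neq0 tC tt Lt).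
Qed.

(** The sum of the powers of x is the product of the x - q^i with 0 < i < p, each of
which is divisible by t. *)
Lemma geom_in x y : near1 L t x -> near1 L t y ->
  L ((c ^+ p.-1)^-1 *: ((\sum_(i < p) x ^+ i) * (\sum_(i < p) y ^+ i))).
Proof.
have p0 := prim_order_gt0 q_prim.
have polyE : \sum_(i < p) 'X^i = \prod_(i < p.-1) ('X - (q ^+ i.+1)%:P) :> {poly K}.
  have X1 : 'X - 1%:P != 0 :> {poly K} by rewrite polyXsubC_eq0.
apply: (mulfI X1); rewrite {1}polyC1 -subrX1 -(factor_Xn_sub_1 q_prim).
  by rewrite -{1}(prednK p0) big_mkord big_ord_recl expr0.
have geomE z : \sum_(i < p) z ^+ i = \prod_(i < p.-1) (z - (q ^+ i.+1)%:A) :> B.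
  have := congr1 (horner_alg z) polyE; rewrite rmorph_sum rmorph_prod /=.
  under eq_bigr do rewrite rmorphXn /= horner_algX.
  by under [in RHS]eq_bigr do rewrite rmorphB /= horner_algX horner_algC.
have dvd z : near1 L t z -> exists2 u, L u & \sum_(i < p) z ^+ i = t ^+ p.-1 * u.
  move=> hz; rewrite geomE.
  elim: (p.-1) => [|n [u hu e]].
    by exists 1; [exact: (Rsubalg1 LR)|rewrite big_ord0 mulr1].
  have [v hv ez] := hz; have [w hw ew] := near1X LR tC Lt n.+1 (near1_root LR c_neq0 tt Lt q1_c).
  exists (u * (v - w)); first by apply: (RsubalgM LR) => //; apply: (RsubalgB LR).
  rewrite big_ord_recr /= e; have -> : (q ^+ n.+1)%:A = 1 + t * w.
    rewrite -ew; elim: (n.+1) => [|j IH]; rewrite ?scale1r // !exprS -IH.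
    by rewrite -scalerAl mul1r scalerA.
  rewrite [X in _ * (X - _)]ez opprD addrACA subrr add0r -mulrBr exprSr -!mulrA; congr (_ * _).
  by rewrite [in LHS]mulrA -tC mulrA.
move=> /dvd[u hu ->] /dvd[v hv ->].
have tmC n z : t ^+ n * z = z * t ^+ n.
  by elim: n => [|j IH]; rewrite ?mulr1 ?mul1r // exprS -mulrA IH mulrA tC -mulrA.
have -> : t ^+ p.-1 * u * (t ^+ p.-1 * v) = c ^+ p.-1 *: (u * v).
  rewrite tmC !mulrA -[u * t ^+ p.-1 * t ^+ p.-1]mulrA.
  have -> : t ^+ p.-1 * t ^+ p.-1 = (c ^+ p.-1)%:A.
    rewrite -exprMn_comm // tt.
    by elim: (p.-1) => [|j IH]; rewrite ?scale1r // !exprS IH -scalerAl mul1r scalerA.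
  by rewrite -scalerAr mulr1 scalerAl.
by rewrite scalerA mulVf ?expf_neq0 // scale1r; apply: (RsubalgM LR).
Qed.

End RmatFacts.

Section QPower.
Variables (K : fieldType) (A : algType K) (e x y : A) (k : K).
Hypotheses (ex : e * x = x * e) (ey : e * y = y * e).
Hypothesis exy : e * (x * y) = k *: (e * (y * x)).

Lemma q_power s : e * (x ^+ s * y ^+ s) = k ^+ 'C(s, 2) *: (e * (x * y) ^+ s).
Proof.
elim: s => [|s IH]; first by rewrite !expr0 scale1r !mulr1.
have -> : e * (x ^+ s.+1 * y ^+ s.+1) = x ^+ s * (e * (x * y ^+ s)) * y.
  by rewrite exprSr [y ^+ s.+1]exprSr !mulrA (commX_l ex).
have := q_commuteX ex ey exy 1 s; rewrite expr1 mul1n => ->.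
rewrite -scalerAr -scalerAl.
have -> : x ^+ s * (e * (y ^+ s * x)) * y = e * (x ^+ s * y ^+ s) * (x * y).
  by rewrite !mulrA (commX_l ex).
by rewrite IH -scalerAl scalerA -exprD binS bin1 addnC -mulrA -exprSr.
Qed.
End QPower.

(** * The order *)

(** The arithmetic of the base ring: c = w (z - 1) is a discriminant which is a square
modulo 4, up to a unit there. *)
Record order_scalars (K : fieldType) (R : subringClosed K) (p : nat) (z c delta mu : K) : Prop :=
  OrderScalars {
    os_prim : p.-primitive_root z;
    os_odd : odd p; os_gt1 : (1 < p)%N;
    os_p : p%:R != 0 :> K; os_two : 2%:R != 0 :> K; os_c : c != 0;
    os_z_in : z \in R; os_c_in : c \in R; os_delta_in : delta \in R; os_mu_in : mu \in R;
    os_mu : 4%:R * mu = c * delta ^+ 2 - 1;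
    os_z1c : (z - 1) / c \in R;
    os_cz1 : forall i, (0 < i < p)%N -> c / (z ^+ i - 1) \in R
  }.

Section Scalars.
Variables (K : fieldType) (R : subringClosed K) (p : nat) (z c delta mu : K).
Hypothesis S : order_scalars R p z c delta mu.

Let z0 : z != 0 := prim_neq0 (os_prim S).
Let p_gt0 : (0 < p)%N := prim_order_gt0 (os_prim S).

Lemma os_zV : z^-1 = z ^+ p.-1.
Proof.
apply: (mulfI z0); rewrite mulfV // -exprS prednK //.
by rewrite (prim_expr_order (os_prim S)).
Qed.

Lemma os_zV_prim : p.-primitive_root z^-1.
Proof. by rewrite os_zV (prim_root_exp_coprime _ (os_prim S)) coprime_sym coprimenP. Qed.

Lemma os_zV_in : z^-1 \in R.
Proof. by rewrite os_zV rpredX // (os_z_in S). Qed.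

Lemma os_zV1c : (z^-1 - 1) / c \in R.
Proof.
have -> : (z^-1 - 1) / c = - ((z - 1) / c * z^-1).
  by rewrite mulrAC -mulNr; congr (_ / _); rewrite mulrBl mulfV // mul1r opprB.
by rewrite rpredN rpredM ?(os_z1c S) ?os_zV_in.
Qed.

Lemma os_czV1 i : (0 < i < p)%N -> c / (z^-1 ^+ i - 1) \in R.
Proof.
move=> ip; have n1 : z ^+ i - 1 != 0 by rewrite subr_eq0 (prim_expr_neq1 (os_prim S)).
have zi : z ^+ i != 0 by rewrite expf_neq0.
have -> : c / (z^-1 ^+ i - 1) = - (c / (z ^+ i - 1) * z ^+ i).
  rewrite exprVn; have -> : z ^- i - 1 = - (z ^+ i - 1) / z ^+ i.
    by rewrite opprB mulrBl mul1r mulfV.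
  by rewrite invfM invrK invrN mulNr mulrN mulrA.
by rewrite rpredN rpredM ?rpredX ?(os_z_in S) // (os_cz1 S).
Qed.

Lemma os_zX1c i : (z ^+ i - 1) / c \in R.
Proof.
rewrite subrX1 mulrAC rpredM ?(os_z1c S) // rpred_sum // => k _.
by rewrite rpredX // (os_z_in S).
Qed.

(** p is the product of the p - 1 factors 1 - z^i, all of them divisible by c. *)
Lemma os_p_c : p%:R / c ^+ p.-1 \in R.
Proof.
have -> : p%:R = \prod_(i < p.-1) (1 - z ^+ i.+1) :> K.
  have X1 : 'X - 1%:P != 0 :> {poly K} by rewrite polyXsubC_eq0.
  have polyE : \sum_(i < p) 'X^i = \prod_(i < p.-1) ('X - (z ^+ i.+1)%:P) :> {poly K}.
    apply: (mulfI X1); rewrite {1}polyC1 -subrX1 -(factor_Xn_sub_1 (os_prim S)).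
    by rewrite -{1}(prednK p_gt0) big_mkord big_ord_recl expr0.
  have <- : (\sum_(i < p) 'X^i : {poly K}).[1] = p%:R.
    rewrite horner_sum (eq_bigr (fun=> 1)) ?sumr_const ?card_ord // => i _.
    by rewrite hornerXn expr1n.
  by rewrite polyE horner_prod; apply: eq_bigr => i _; rewrite hornerXsubC.
rewrite -[X in c ^+ X]card_ord -prodr_const -prodf_div; apply: rpred_prod => i _.
by rewrite -opprB mulNr rpredN os_zX1c.
Qed.

Section Lattice.
Variables (A : algType K) (Y : A -> Prop).
Hypothesis YR : Rsubalg R Y.
Local Notation L := (lat delta Y : quad A c -> Prop).
Local Notation t := (qroot A c).

Lemma os_lat : Rsubalg R L.
Proof. exact: (lat_Rsubalg YR (os_two S) (os_c_in S) (os_delta_in S) (os_mu_in S) (os_mu S)). Qed.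

Lemma os_lat_t : L t.
Proof. exact: (lat_qroot YR (os_c_in S) (os_delta_in S)). Qed.

Lemma os_near1 x y :
  near1 L t (mkq c x y) <-> Y (2%:R *: y) /\ Y (c^-1 *: (x - 1) - delta *: y).
Proof. exact: (near1_lat YR (os_c S) (os_c_in S) (os_delta_in S) (os_mu_in S) (os_mu S)). Qed.

Lemma os_near1M x y : near1 L t x -> near1 L t y -> near1 L t (x * y).
Proof. exact: (near1M os_lat (@qrootC K A c) os_lat_t). Qed.

Lemma os_near1X x n : near1 L t x -> near1 L t (x ^+ n).
Proof. exact: (near1X os_lat (@qrootC K A c) os_lat_t). Qed.

Lemma os_near1Z n x : near1 L t x -> near1 L t (z ^+ n *: x).
Proof.
move=> hx; have -> : z ^+ n *: x = (z%:A) ^+ n * x.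
  by elim: n => [|n IH]; rewrite ?expr0 ?scale1r ?mul1r // !exprS -mulrA -IH -scalerAl mul1r scalerA.
apply: os_near1M => //; apply: os_near1X.
exact: (near1_root os_lat (os_c S) (qroot_sqr A c) os_lat_t (os_z1c S)).
Qed.

Lemma os_near1ZV n x : near1 L t x -> near1 L t (z^-1 ^+ n *: x).
Proof. by rewrite os_zV -exprM; exact: os_near1Z. Qed.

Lemma os_near1_glue e0 e1 x y : e0 + e1 = 1 -> L e0 -> L e1 ->
  near1 L t x -> near1 L t y -> near1 L t (e0 * x + e1 * y).
Proof. exact: (near1_glue os_lat (@qrootC K A c)). Qed.

Lemma os_rmat e x y : L e -> e * e = e -> e * x = x * e -> e * y = y * e ->
  near1 L t x -> near1 L t y -> e * y ^+ p = e -> L (e * rmat p z x y).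
Proof.
exact: (rmat_block_in os_lat (os_prim S) (os_p S) (os_c S) (@qrootC K A c) (qroot_sqr A c)
  os_lat_t (os_z_in S) (os_z1c S) (os_cz1 S)).
Qed.

Lemma os_rmatV e x y : L e -> e * e = e -> e * x = x * e -> e * y = y * e ->
  near1 L t x -> near1 L t y -> e * y ^+ p = e -> L (e * rmat p z^-1 x y).
Proof.
exact: (rmat_block_in os_lat os_zV_prim (os_p S) (os_c S) (@qrootC K A c) (qroot_sqr A c)
  os_lat_t os_zV_in os_zV1c os_czV1).
Qed.

Lemma os_geom x y : near1 L t x -> near1 L t y ->
  L ((c ^+ p.-1)^-1 *: ((\sum_(i < p) x ^+ i) * (\sum_(i < p) y ^+ i))).
Proof.
exact: (geom_in os_lat (os_prim S) (os_c S) (@qrootC K A c) (qroot_sqr A c)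
  os_lat_t (os_z1c S)).
Qed.

End Lattice.
End Scalars.

Section Order.
Variables (K : fieldType) (R : subringClosed K) (p : nat) (z c delta mu : K).
Hypothesis S : order_scalars R p z c delta mu.
Variables (H : hopfAlgebra K) (G : grading H) (e0 e1 a b g : H).
Hypothesis N : nik_hopf p z G e0 e1 a b g.

Definition nik_form : hopfAlgebra K :=
  twist_hopf (os_c S) (nik_comult_odd N) (nik_counit_odd N) (nik_antipode_odd N).
Local Notation H' := nik_form.
Local Notation TT := (tensor H' H').
Local Notation io := (grade_emb G c : H -> quad H' c).
Local Notation te := (tens_emb (os_c S) (nik_comult_odd N) (nik_counit_odd N)
  (nik_antipode_odd N) : tensor H H -> quad TT c).
Local Notation nr Y := (near1 (lat delta Y) (qroot _ c)).

(** The R-subalgebra of the form generated by e_0, e_1, g and by what is needed for a and b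
to be congruent to 1 modulo t. *)
Definition nik_order (x : H') : Prop := forall Y : H' -> Prop,
  Rsubalg R Y -> Y e0 -> Y e1 -> Y g -> nr Y (io a) -> nr Y (io b) -> Y x.
Local Notation X := nik_order.

Lemma nik_order_Rsubalg : Rsubalg R X.
Proof.
split=> [|x y hx hy|x y hx hy|r x hr hx] Y YR h0 h1 hg ha hb.
- exact: (Rsubalg1 YR).
- by apply: (RsubalgD YR); [exact: hx|exact: hy].
- by apply: (RsubalgM YR); [exact: hx|exact: hy].
by apply: (RsubalgZ YR) => //; exact: hx.
Qed.

Lemma nik_order_e0 : X e0. Proof. by []. Qed.
Lemma nik_order_e1 : X e1. Proof. by []. Qed.
Lemma nik_order_g : X g. Proof. by []. Qed.

Lemma nik_order_a : nr X (io a).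
Proof.
apply/(os_near1 S nik_order_Rsubalg); split=> Y YR h0 h1 hg ha hb;
  by have [] := (os_near1 S YR _ _).1 ha.
Qed.
Lemma nik_order_b : nr X (io b).
Proof.
apply/(os_near1 S nik_order_Rsubalg); split=> Y YR h0 h1 hg ha hb;
  by have [] := (os_near1 S YR _ _).1 hb.
Qed.

(** The image of X ⊗ X in the tensor square over K; it has to be described without the
tensor product over R, which is only mapped to it. *)
Definition nik_order2 (s : TT) : Prop :=
  exists r : seq (H' * H'), (forall u, List.In u r -> X u.1 /\ X u.2) /\ s = \sum_(u <- r) u.1 ⊗ u.2.
Local Notation Y2 := nik_order2.

Lemma nik_order2_pure x y : X x -> X y -> Y2 (x ⊗ y).
Proof. by move=> hx hy; exists [:: (x, y)]; rewrite big_seq1; split=> // u [<-|]. Qed.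

Lemma nik_order2D s t : Y2 s -> Y2 t -> Y2 (s + t).
Proof.
move=> [r [hr ->]] [r' [hr' ->]]; exists (r ++ r'); rewrite big_cat; split=> // u.
by move=> hu; have [] := List.in_app_or r r' u hu; [exact: hr|exact: hr'].
Qed.

Lemma nik_order2_ind (P : TT -> Prop) : (forall s t, P s -> P t -> P (s + t)) ->
  (forall x y, X x -> X y -> P (x ⊗ y)) -> forall s, Y2 s -> P s.
Proof.
move=> PD Pp s [r [hr ->]]; elim: r hr => [|[x y] r IH] hr.
  rewrite big_nil -(tens0l _ (0 : H')).
  by apply: Pp; apply: (Rsubalg0 nik_order_Rsubalg).
rewrite big_cons; apply: PD; last by apply: IH => u hu; apply: hr; right.
by have [hx hy] := hr _ (or_introl erefl); apply: Pp.
Qed.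

Lemma nik_order2_Rsubalg : Rsubalg R Y2.
Proof.
have XR := nik_order_Rsubalg.
split=> [|s t|s t hs ht|r s hr hs].
- by rewrite -tens1; apply: nik_order2_pure; apply: (Rsubalg1 XR).
- exact: nik_order2D.
- move: s hs; apply: nik_order2_ind => [s1 s2 IH IH'|x y hx hy].
    by rewrite mulrDl; apply: nik_order2D.
  move: t ht; apply: nik_order2_ind => [s1 s2 IH IH'|x' y' hx' hy'].
    by rewrite mulrDr; apply: nik_order2D.
  by rewrite tensM; apply: nik_order2_pure; apply: (RsubalgM XR).
move: s hs; apply: nik_order2_ind => [s1 s2 IH IH'|x y hx hy].
  by rewrite scalerDr; apply: nik_order2D.
by rewrite -tensZl; apply: nik_order2_pure => //; apply: (RsubalgZ XR).
Qed.

End Order.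

(** * The comultiplication of g *)

Section Words.
Variables (K : fieldType) (A : algType K) (p : nat) (a b : A).

Definition nik_w : A := a * b ^+ p.-1.
(** (p + 1) / 2 is half of 1 modulo p: this power of w makes the quadratic exponents in the
mixed blocks bilinear. *)
Definition nik_u : A := nik_w ^+ (p.+1)./2 * b.

End Words.

Section ComultGRmat.
Variables (K : fieldType) (p : nat) (z : K) (H : hopfAlgebra K) (e0 e1 a b g : H).
Hypothesis N : nik_units p z e0 e1 a b g.
Hypothesis z_prim : p.-primitive_root z.
Hypothesis p_odd : odd p.
Hypothesis p_neq0 : p%:R != 0 :> K.

Let zp : z ^+ p = 1 := prim_expr_order z_prim.
Let z0 : z != 0 := prim_neq0 z_prim.
Let p_gt0 : (0 < p)%N := prim_order_gt0 z_prim.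
Let zi := z^-1.
Let zip : zi ^+ p = 1. Proof. by rewrite /zi exprVn zp invr1. Qed.
Let ziE : zi = z ^+ p.-1.
Proof. by apply: (mulfI z0); rewrite -exprS prednK // zp /zi divff. Qed.
Let h := (p.+1)./2.
Let pE : p = (2 * h - 1)%N.
Proof. by rewrite /h; have := odd_double_half p; rewrite p_odd; lia. Qed.

(* h s^2 = h s + s (s - 1) / 2 modulo p, since 2 h = 1. *)
Let half_index (y : K) k s : y ^+ p = 1 ->
  y ^+ (s * (k + h * s)) = y ^+ (k * s) * y ^+ h ^+ s * y ^+ 'C(s, 2).
Proof.
move=> yp; rewrite -exprM -!exprD -addnA.
have -> : (s * (k + h * s) = k * s + (h * s + 'C(s, 2)) + p * 'C(s, 2))%N.
  have : (2 * 'C(s, 2) = s * s.-1)%N by rewrite mul2n bin2 even_halfK // ; case: s => //= s; rewrite oddM /=; case: odd.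
  by have := pE; case: s => [|s] /=; nia.
by rewrite exprD exprM yp expr1n mulr1.
Qed.

Let modX (A : pzRingType) (x : A) m n : x ^+ p = 1 -> m = n %[mod p] -> x ^+ m = x ^+ n.
Proof. by move=> xp mn; rewrite -(expr_mod m xp) mn (expr_mod n xp). Qed.

Local Notation bi := (b ^+ p.-1).
Local Notation mono i j := (a ^+ i * b ^+ j).

Let e1bi : e1 * (a * bi) = zi *: (e1 * (bi * a)).
Proof.
have := nik_abX1 N 1 p.-1; rewrite expr1 mul1n => ->; congr (_ *: _).
by apply: (mulfI z0); rewrite -exprS prednK // zp mulfV.
Qed.
Let e0bi : e0 * (a * bi) = 1 *: (e0 * (bi * a)).
Proof. by have := nik_abX0 N 1 p.-1; rewrite expr1 scale1r => ->. Qed.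
Let e0biC : e0 * bi = bi * e0. Proof. exact: commX_l (nik_e0b N) _. Qed.
Let e1biC : e1 * bi = bi * e1. Proof. exact: commX_l (nik_e1b N) _. Qed.

Let w := nik_w p a b.
Let wE : w = a * bi. Proof. by []. Qed.
Let e0w : e0 * w = w * e0. Proof. by rewrite wE mulrA (nik_e0a N) -!mulrA e0biC. Qed.
Let e1w : e1 * w = w * e1. Proof. by rewrite wE mulrA (nik_e1a N) -!mulrA e1biC. Qed.

Let w0X n : e0 * w ^+ n = e0 * mono n (p.-1 * n).
Proof.
have := q_power (nik_e0a N) e0biC e0bi n.
by rewrite expr1n scale1r -wE => <-; rewrite exprM.
Qed.
Let w1X n : e1 * w ^+ n = z ^+ 'C(n, 2) *: (e1 * mono n (p.-1 * n)).
Proof.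
have := q_power (nik_e1a N) e1biC e1bi n; rewrite -exprM -wE => ->.
by rewrite scalerA -exprMn /zi mulfV // expr1n scale1r.
Qed.
Let ab1X n : e1 * (a * b) ^+ n = zi ^+ 'C(n, 2) *: (e1 * mono n n).
Proof.
have := q_power (nik_e1a N) (nik_e1b N) (nik_ab1 N) n => ->.
by rewrite scalerA -exprMn /zi mulVf // expr1n scale1r.
Qed.

Let u := nik_u p a b.
Let uE : u = w ^+ h * b. Proof. by []. Qed.
Let w0u k s : e0 * (w ^+ k * u ^+ s) = e0 * mono (k + h * s) (s + p.-1 * (k + h * s)).
Proof.
have e0wb : e0 * (w * b) = 1 *: (e0 * (b * w)).
  rewrite scale1r wE -!mulrA -exprSr [b * _]mulrA [e0 * _]mulrA.
  have e0ab : e0 * (b * a) = e0 * (a * b) by rewrite (nik_ab0 N) scale1r.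
  by rewrite [e0 * (b * a * bi)]mulrA e0ab -!mulrA -exprS.
have e0whb : e0 * (w ^+ h * b) = 1 *: (e0 * (b * w ^+ h)).
  by have := q_commuteX e0w (nik_e0b N) e0wb h 1; rewrite expr1 expr1n scale1r.
have e0wh : e0 * w ^+ h = w ^+ h * e0 by apply: commX_l.
have := q_power e0wh (nik_e0b N) e0whb s; rewrite expr1n scale1r -uE => us.
have -> : e0 * (w ^+ k * u ^+ s) = w ^+ k * (e0 * u ^+ s) by rewrite !mulrA (commX_l e0w).
rewrite -us; have -> : w ^+ k * (e0 * (w ^+ h ^+ s * b ^+ s)) = e0 * w ^+ (k + h * s) * b ^+ s.
  by rewrite exprD exprM !mulrA (commX_l e0w).
by rewrite w0X -!mulrA -exprD [(s + _)%N]addnC.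
Qed.

Let eTens (x y e e' : H) : (e ⊗ e') * (x ⊗ y) = (e * x) ⊗ (e' * y) :> tensor H H.
Proof. exact: tensM. Qed.

Let E00 := e0 ⊗ e0 : tensor H H.
Let E01 := e0 ⊗ e1 : tensor H H.
Let E10 := e1 ⊗ e0 : tensor H H.
Let E11 := e1 ⊗ e1 : tensor H H.

Let S1E : (p%:R ^+ 2)^-1 *: (\sum_(i < p) \sum_(j < p) \sum_(k < p) \sum_(l < p)
     (z ^+ (k * j) * zi ^+ (i * l)) *: (E00 * (mono i j ⊗ mono k l)))
  = E00 * (rmat p z (a ⊗ 1) (1 ⊗ b) * rmat p zi (b ⊗ 1) (1 ⊗ a)).
Proof.
have E (A B : nat -> nat -> tensor H H) :
   (\sum_(i < p) \sum_(l < p) A i l) * (\sum_(j < p) \sum_(k < p) B j k)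
   = \sum_(i < p) \sum_(l < p) \sum_(j < p) \sum_(k < p) A i l * B j k.
  rewrite mulr_suml; apply: eq_bigr => i _; rewrite mulr_suml; apply: eq_bigr => l _.
  by rewrite mulr_sumr; apply: eq_bigr => j _; rewrite mulr_sumr.
rewrite /rmat -scalerAl -!scalerAr scalerA -invfM -expr2; congr (_ *: _).
pose FA i l := zi ^+ (i * l) *: ((a ⊗ 1 : tensor H H) ^+ i * (1 ⊗ b : tensor H H) ^+ l).
pose FB j k := zi^-1 ^+ (j * k) *: ((b ⊗ 1 : tensor H H) ^+ j * (1 ⊗ a : tensor H H) ^+ k).
transitivity (E00 * ((\sum_(i < p) \sum_(l < p) FA i l) * (\sum_(j < p) \sum_(k < p) FB j k))) => //.
rewrite E mulr_sumr.
apply: eq_bigr => i _.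
under eq_bigr do rewrite exchange_big; rewrite exchange_big mulr_sumr.
apply: eq_bigr => l _; rewrite mulr_sumr; apply: eq_bigr => j _.
rewrite mulr_sumr; apply: eq_bigr => k _; rewrite /FA /FB.
rewrite !tensMX !expr1n !tensM -scalerAl -!scalerAr scalerA /E00 !tensM.
by rewrite !(mulr1, mul1r) -(nik_abX0 N) /zi invrK mulrC [(j * k)%N]mulnC.
Qed.

Let S4E : p%:R^-1 *: (\sum_(k < p) \sum_(l < p) E11 * (mono k l ⊗ mono (p.-1 * l)%N k))
  = E11 * rmat p z (a ⊗ b) (b ⊗ a ^+ p.-1).
Proof.
rewrite /rmat -scalerAr; congr (_ *: _); rewrite mulr_sumr; apply: eq_bigr => k _.
rewrite mulr_sumr; apply: eq_bigr => l _.
rewrite !tensMX tensM -scalerAr !eTens -exprM -tensZr; congr (_ ⊗ _).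
rewrite (nik_abX1 N); congr (_ *: _); rewrite -/zi.
rewrite ziE.
by rewrite -exprM; congr (_ ^+ _); rewrite mulnAC mulnA.
Qed.

Let S2E : p%:R^-1 *: (\sum_(k < p) \sum_(l < p)
     zi ^+ ((k + l) * k) *: (E01 * (mono k l ⊗ mono (k + l)%N (k + l)%N)))
  = E01 * rmat p z (w ⊗ 1) (zi ^+ h *: (u ⊗ (a * b))).
Proof.
rewrite /rmat -scalerAr; congr (_ *: _); rewrite mulr_sumr.
pose F k s := zi ^+ (s * k) *: (E01 * (mono k (s + p.-1 * k) ⊗ mono s s)).
have bp := nik_bp N; have ap := nik_ap N.
transitivity (\sum_(k < p) \sum_(s < p) F k s).
  apply: eq_bigr => k _; rewrite -[RHS](@sum_shift _ p (F k) k) => [|n]; last first.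
    rewrite /F; congr (_ *: (_ * ((_ * _) ⊗ (_ * _)))); apply: modX => //.
    - by rewrite -modnMml modnDr modnMml.
    - by rewrite addnAC modnDr.
    - by rewrite modnDr.
    by rewrite modnDr.
  apply: eq_bigr => l _; rewrite /F addnC; congr (_ *: (_ * ((_ * _) ⊗ _))).
  apply: modX => //; rewrite -addnA; have -> : (k + p.-1 * k = k * p)%N.
    by rewrite -mulSn prednK // mulnC.
  by rewrite addnC modnMDl.
rewrite exchange_big [RHS](eq_bigr (fun k : 'I_p => \sum_(s < p) F (k + h * s)%N s)) => [|k _].
  rewrite [RHS]exchange_big; apply: eq_bigr => s _; symmetry.
  apply: (@sum_shift _ p (fun k => F k s)) => k; rewrite /F.
  congr (_ *: (_ * ((_ * _) ⊗ _))); apply: modX => //.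
  - by rewrite -modnMmr modnDr modnMmr.
  - by rewrite modnDr.
  by rewrite mulnDr addnA addnC modnMDl.
rewrite mulr_sumr; apply: eq_bigr => s _; rewrite /F.
rewrite exprZn !tensMX expr1n -!scalerAr scalerA !tensM mul1r w0u ab1X tensZr scalerA.
by congr (_ *: _); rewrite half_index.
Qed.

Let S3E : p%:R^-1 *: (\sum_(k < p) \sum_(l < p)
     z ^+ (k * (k + l)) *: (E10 * (mono (k + l)%N (p.-1 * (k + l))%N ⊗ mono k l)))
  = E10 * rmat p zi (1 ⊗ w) (z ^+ h *: (w ⊗ u)).
Proof.
rewrite /rmat -scalerAr; congr (_ *: _); rewrite mulr_sumr.
pose F k s := z ^+ (s * k) *: (E10 * (mono s (p.-1 * s) ⊗ mono k (s + p.-1 * k))).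
have bp := nik_bp N; have ap := nik_ap N.
transitivity (\sum_(k < p) \sum_(s < p) F k s).
  apply: eq_bigr => k _; rewrite -[RHS](@sum_shift _ p (F k) k) => [|n]; last first.
    rewrite /F; congr (_ *: (_ * ((_ * _) ⊗ (_ * _)))); apply: modX => //.
    - by rewrite -modnMml modnDr modnMml.
    - by rewrite modnDr.
    - by rewrite -modnMmr modnDr modnMmr.
    by rewrite addnAC modnDr.
  apply: eq_bigr => l _; rewrite /F addnC [(k * _)%N]mulnC.
  congr (_ *: (_ * (_ ⊗ (_ * _)))).
  apply: modX => //; rewrite -addnA; have -> : (k + p.-1 * k = k * p)%N.
    by rewrite -mulSn prednK // mulnC.
  by rewrite addnC modnMDl.
rewrite exchange_big [RHS](eq_bigr (fun k : 'I_p => \sum_(s < p) F (k + h * s)%N s)) => [|k _].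
  rewrite [RHS]exchange_big; apply: eq_bigr => s _; symmetry.
  apply: (@sum_shift _ p (fun k => F k s)) => k; rewrite /F.
  congr (_ *: (_ * (_ ⊗ (_ * _)))); apply: modX => //.
  - by rewrite -modnMmr modnDr modnMmr.
  - by rewrite modnDr.
  by rewrite mulnDr addnA addnC modnMDl.
rewrite mulr_sumr; apply: eq_bigr => s _; rewrite /F.
rewrite exprZn !tensMX expr1n -!scalerAr scalerA !tensM mul1r w0u w1X tensZl scalerA.
by congr (_ *: _); rewrite /zi invrK half_index.
Qed.

Local Notation W := (nik_w p a b).
Local Notation U := (nik_u p a b).

(** On each of the four blocks, the comultiplication of g is that of a group-like element
multiplied by canonical elements of pairings of cyclic groups. *)
Lemma nik_comult_gE : nik_comult_g p z e0 e1 a b g =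
  (g ⊗ g) * ((e0 ⊗ e0) * (rmat p z (a ⊗ 1) (1 ⊗ b) * rmat p z^-1 (b ⊗ 1) (1 ⊗ a))
    + (e0 ⊗ e1) * rmat p z (W ⊗ 1) (z^-1 ^+ (p.+1)./2 *: (U ⊗ (a * b)))
    + (e1 ⊗ e0) * rmat p z^-1 (1 ⊗ W) (z ^+ (p.+1)./2 *: (W ⊗ U))
    + (e1 ⊗ e1) * rmat p z (a ⊗ b) (b ⊗ a ^+ p.-1)).
Proof.
rewrite -/E00 -/E01 -/E10 -/E11 -/w -/u -/h -/zi.
rewrite -S1E -S2E -S3E -S4E /nik_comult_g !mulrDr -!scalerAr /zi.
congr (_ *: _ + _ *: _ + _ *: _ + _ *: _).
- rewrite mulr_sumr; apply: eq_bigr => i _; rewrite mulr_sumr; apply: eq_bigr => j _.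
  rewrite mulr_sumr; apply: eq_bigr => k _; rewrite mulr_sumr; apply: eq_bigr => l _.
  by rewrite -scalerAr !tensM.
- rewrite mulr_sumr; apply: eq_bigr => i _; rewrite mulr_sumr; apply: eq_bigr => j _.
  by rewrite -scalerAr !tensM.
- rewrite mulr_sumr; apply: eq_bigr => i _; rewrite mulr_sumr; apply: eq_bigr => j _.
  by rewrite -scalerAr !tensM.
rewrite mulr_sumr; apply: eq_bigr => i _; rewrite mulr_sumr; apply: eq_bigr => j _.
by rewrite !tensM.
Qed.

Lemma nik_e0w : e0 * W = W * e0. Proof. exact: e0w. Qed.
Lemma nik_e1w : e1 * W = W * e1. Proof. exact: e1w. Qed.
Lemma nik_e0u : e0 * U = U * e0.
Proof. by rewrite -/u uE mulrA (commX_l e0w) -!mulrA (nik_e0b N). Qed.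

Lemma nik_u_p : e0 * U ^+ p = e0.
Proof.
have := w0u 0 p; rewrite expr0 mul1r add0n => ->.
rewrite [(h * p)%N]mulnC [(p.-1 * _)%N]mulnCA exprD !exprM (nik_ap N) (nik_bp N) !expr1n.
by rewrite !mulr1.
Qed.

Lemma nik_w_p : e1 * W ^+ p = e1.
Proof.
rewrite -/w w1X mulnC exprM (nik_ap N) (nik_bp N) expr1n !mulr1 bin2odd // exprM zp expr1n.
exact: scale1r.
Qed.

Lemma nik_ab_p : e1 * (a * b) ^+ p = e1.
Proof.
by rewrite -/w ab1X (nik_ap N) (nik_bp N) !mulr1 bin2odd // exprM zip expr1n scale1r.
Qed.

End ComultGRmat.

(** * Closure under comultiplication *)

Section OrderHopf.
Variables (K : fieldType) (R : subringClosed K) (p : nat) (z c delta mu : K).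
Hypothesis S : order_scalars R p z c delta mu.
Variables (H : hopfAlgebra K) (G : grading H) (e0 e1 a b g : H).
Hypothesis N : nik_hopf p z G e0 e1 a b g.
Local Notation H' := (nik_form S N).
Local Notation TT := (tensor H' H').
Local Notation io := (grade_emb G c : H -> quad H' c).
Local Notation te := (tens_emb (os_c S) (nik_comult_odd N) (nik_counit_odd N)
  (nik_antipode_odd N) : tensor H H -> quad TT c).
Local Notation nr Y := (near1 (lat delta Y) (qroot _ c)).
Local Notation X := (nik_order (S:=S) (N:=N)).
Local Notation Y2 := (nik_order2 (S:=S) (N:=N)).

Let XR := nik_order_Rsubalg S N.
Let YR := nik_order2_Rsubalg S N.
Let c0 := os_c S.

Let LR : Rsubalg R (lat delta Y2 : quad TT c -> Prop) := os_lat S YR.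

Let io_eq h : io h = mkq c (h - G h : H') (c^-1 *: G h : H'). Proof. by []. Qed.

Let ioM x y : nr X (io x) -> nr X (io y) -> nr X (io (x * y)).
Proof. by rewrite (grade_embM _ c0); move=> hx hy; exact: (os_near1M S XR hx hy). Qed.
Let ioX x n : nr X (io x) -> nr X (io (x ^+ n)).
Proof. by rewrite (grade_embX _ c0); move=> hx; exact: (os_near1X S XR n hx). Qed.

Let ioa : nr X (io a) := nik_order_a S N.
Let iob : nr X (io b) := nik_order_b S N.

Let nr_l h : nr X (io h) -> nr Y2 (te (h ⊗ 1)).
Proof.
rewrite io_eq => /(os_near1 S XR)[h1 h2]; rewrite tens_emb_l.
apply/(os_near1 S YR); set x : H' := h - G h; set y : H' := c^-1 *: G h.
rewrite -/x -/y in h1 h2; split.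
  by rewrite -tensZl; apply: nik_order2_pure => //; exact: (Rsubalg1 XR).
rewrite -[X in x ⊗ 1 - X]tens1 -tensBl -!tensZl -tensBl.
by apply: nik_order2_pure => //; exact: (Rsubalg1 XR).
Qed.

Let nr_r h : nr X (io h) -> nr Y2 (te (1 ⊗ h)).
Proof.
rewrite io_eq => /(os_near1 S XR)[h1 h2]; rewrite tens_emb_r.
apply/(os_near1 S YR); set x : H' := h - G h; set y : H' := c^-1 *: G h.
rewrite -/x -/y in h1 h2; split.
  by rewrite -tensZr; apply: nik_order2_pure => //; exact: (Rsubalg1 XR).
rewrite -[X in 1 ⊗ x - X]tens1 -tensBr -!tensZr -tensBr.
by apply: nik_order2_pure => //; exact: (Rsubalg1 XR).
Qed.

Let teM s t : te (s * t) = te s * te t. Proof. exact: tens_embM. Qed.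
Let teX s n : te (s ^+ n) = te s ^+ n. Proof. exact: tens_embX. Qed.
Let teZ k s : te (k *: s) = k *: te s. Proof. exact: tens_embZ. Qed.
Let teD s t : te (s + t) = te s + te t. Proof. exact: tens_embD. Qed.
Let te1 : te 1 = 1. Proof. exact: tens_emb1. Qed.

Let tensE (x y : H) : x ⊗ y = (x ⊗ 1) * (1 ⊗ y) :> tensor H H.
Proof. by rewrite tensM mulr1 mul1r. Qed.

(** Elements of H congruent to 1 after the embedding give such elements of H ⊗ H. *)
Lemma nik_near_tens x y : nr X (io x) -> nr X (io y) -> nr Y2 (te (x ⊗ y)).
Proof.
move=> hx hy; rewrite tensE teM.
by apply: (os_near1M S YR); [exact: nr_l|exact: nr_r].
Qed.

Lemma nik_even_tens x y : G x = 0 -> G y = 0 -> X x -> X y -> lat delta Y2 (te (x ⊗ y)).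
Proof.
move=> Gx Gy hx hy; rewrite tensE teM; apply: (RsubalgM LR).
  rewrite tens_emb_l Gx subr0 scaler0 tens0l; apply/(lat_base c delta YR).
  by apply: nik_order2_pure => //; exact: (Rsubalg1 XR).
rewrite tens_emb_r Gy subr0 scaler0 tens0r; apply/(lat_base c delta YR).
by apply: nik_order2_pure => //; exact: (Rsubalg1 XR).
Qed.

Let te_rmat q s t : te (rmat p q s t) = rmat p q (te s) (te t).
Proof. exact: (rmat_morph p q s t te1 teD teM teZ). Qed.

Lemma nik_rmat_tens E s t : lat delta Y2 (te E) -> E * E = E -> E * s = s * E -> E * t = t * E ->
  nr Y2 (te s) -> nr Y2 (te t) -> E * t ^+ p = E -> lat delta Y2 (te (E * rmat p z s t)).
Proof.
move=> LE EE Es Et hs ht Etp; rewrite teM te_rmat; apply: (os_rmat S YR) => //.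
- by rewrite -teM EE.
- by rewrite -!teM Es.
- by rewrite -!teM Et.
by rewrite -teX -teM Etp.
Qed.

Let nik_rmatV_tens E s t : lat delta Y2 (te E) -> E * E = E -> E * s = s * E -> E * t = t * E ->
  nr Y2 (te s) -> nr Y2 (te t) -> E * t ^+ p = E -> lat delta Y2 (te (E * rmat p z^-1 s t)).
Proof.
move=> LE EE Es Et hs ht Etp; rewrite teM te_rmat; apply: (os_rmatV S YR) => //.
- by rewrite -teM EE.
- by rewrite -!teM Es.
- by rewrite -!teM Et.
by rewrite -teX -teM Etp.
Qed.

Let comult_even h : G h = 0 -> lat delta Y2 (te (comult H h)) -> Y2 (comult H' h).
Proof.
move=> Gh; rewrite tens_emb_comult Gh subr0 scaler0.
have -> : comult (twist_hopf (os_c S) (nik_comult_odd N) (nik_counit_odd N)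
  (nik_antipode_odd N)) 0 = 0 by exact: linear0.
by move/(lat_base c delta YR).
Qed.

Let Yd (x : H') : Prop := Y2 (comult H' x).
Let YdR : Rsubalg R Yd.
Proof.
split=> [|x y|x y|r x hr]; rewrite /Yd.
- by rewrite rmorph1; exact: (Rsubalg1 YR).
- by rewrite linearD; exact: (RsubalgD YR).
- by rewrite rmorphM; exact: (RsubalgM YR).
by rewrite linearZ; exact: (RsubalgZ YR).
Qed.

Let comult_nr h : nr Y2 (te (comult H h)) -> nr Yd (io h).
Proof.
rewrite tens_emb_comult => /(os_near1 S YR)[h1 h2].
rewrite io_eq; apply/(os_near1 S YdR); rewrite /Yd; split; first by rewrite linearZ.
by rewrite linearB 2!linearZ linearB rmorph1.
Qed.

Let Xe0 : X e0. Proof. exact: nik_order_e0. Qed.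
Let Xe1 : X e1. Proof. exact: nik_order_e1. Qed.
Let Xg : X g. Proof. exact: nik_order_g. Qed.
Let G0 := nik_Ge0 N.
Let G1 := nik_Ge1 N.
Let z_prim := os_prim S.
Let W := nik_w p a b.
Let U := nik_u p a b.
Let e00 := nik_e00 N.
Let e11 := nik_e11 N.
Let ap := nik_ap N.
Let bp := nik_bp N.

Let ioW : nr X (io W). Proof. by apply: ioM => //; apply: ioX. Qed.
Let ioU : nr X (io U). Proof. by apply: ioM => //; apply: ioX. Qed.

Let L1 : lat delta Y2 (te 1). Proof. by rewrite te1; exact: (Rsubalg1 LR). Qed.

Let comult_g_in : Y2 (comult H' g).
Proof.
apply: comult_even (nik_Gg N) _.
rewrite (nik_Dg N) (nik_comult_gE N z_prim (os_odd S) (os_p S)) -/W -/U teM.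
apply: (RsubalgM LR); first by apply: nik_even_tens => //; exact: nik_Gg N.
rewrite !teD; do ![apply: (RsubalgD LR)].
- rewrite !teM; apply: (RsubalgM LR); first exact: nik_even_tens.
  apply: (RsubalgM LR).
    rewrite -[rmat _ _ _ _]mul1r; apply: nik_rmat_tens; rewrite ?mulr1 ?mul1r //.
    + exact: nr_l. + exact: nr_r. + by rewrite tensMX bp expr1n tens1.
  rewrite -[rmat _ _ _ _]mul1r; apply: nik_rmatV_tens; rewrite ?mulr1 ?mul1r //.
  + exact: nr_l. + exact: nr_r. + by rewrite tensMX ap expr1n tens1.
- apply: nik_rmat_tens.
  + exact: nik_even_tens.
  + by rewrite tensM e00 e11.
  + by rewrite !tensM (nik_e0w N) mulr1 mul1r.
  + rewrite -scalerAr -scalerAl !tensM (nik_e0u N); congr (_ *: (_ ⊗ _)).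
    by rewrite mulrA (nik_e1a N) -!mulrA (nik_e1b N).
  + exact: nr_l.
  + by rewrite teZ; apply: (os_near1ZV S YR); apply: nik_near_tens => //; exact: ioM.
  rewrite exprZn tensMX -scalerAr tensM -exprM mulnC exprM exprVn (prim_expr_order z_prim).
  by rewrite invr1 expr1n scale1r (nik_u_p N) // (nik_ab_p N z_prim) ?(os_odd S).
- apply: nik_rmatV_tens.
  + exact: nik_even_tens.
  + by rewrite tensM e00 e11.
  + by rewrite !tensM (nik_e0w N) mulr1 mul1r.
  + rewrite -scalerAr -scalerAl !tensM (nik_e0u N); congr (_ *: (_ ⊗ _)).
    exact: nik_e1w N.
  + exact: nr_r.
  + by rewrite teZ; apply: (os_near1Z S YR); apply: nik_near_tens.
  rewrite exprZn tensMX -scalerAr tensM -exprM mulnC exprM (prim_expr_order z_prim).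
  by rewrite expr1n scale1r (nik_u_p N) (nik_w_p N z_prim) ?(os_odd S).
apply: nik_rmat_tens.
+ exact: nik_even_tens.
+ by rewrite tensM e11.
+ by rewrite !tensM (nik_e1a N) (nik_e1b N).
+ by rewrite !tensM (nik_e1b N) (commX_l (nik_e1a N)).
+ exact: nik_near_tens.
+ by apply: nik_near_tens => //; exact: ioX.
by rewrite tensMX -exprM mulnC exprM ap bp expr1n tens1 mulr1.
Qed.

(** By multiplicativity it is enough to treat the generators. For g the formula in terms of
canonical elements applies, and these are integral because their arguments are congruent
to 1 modulo t. For b the two block components are glued. *)
Lemma nik_order_comult x : X x -> Y2 (comult H' x).
Proof.
move=> hx; apply: (hx Yd YdR).
- apply: comult_even => //; rewrite (nik_De0 N) teD.
  by apply: (RsubalgD LR); apply: nik_even_tens.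
- apply: comult_even => //; rewrite (nik_De1 N) teD.
  by apply: (RsubalgD LR); apply: nik_even_tens.
- exact: comult_g_in.
- by apply: comult_nr; rewrite (nik_Da N); apply: nik_near_tens.
apply: comult_nr; rewrite (nik_Db N).
have -> : (e0 * b) ⊗ b + (e1 * b) ⊗ b ^+ p.-1
  = (e0 ⊗ 1) * (b ⊗ b) + (e1 ⊗ 1) * (b ⊗ b ^+ p.-1) :> tensor H H by rewrite !tensM !mul1r.
rewrite teD !teM; apply: (os_near1_glue S YR).
- by rewrite -teD -tensDl (nik_sum N) tens1 te1.
- by apply: nik_even_tens => //; [exact: homog1|exact: (Rsubalg1 XR)].
- by apply: nik_even_tens => //; [exact: homog1|exact: (Rsubalg1 XR)].
- exact: nik_near_tens.
by apply: nik_near_tens => //; exact: ioX.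
Qed.

End OrderHopf.

(** * Closure under counit and antipode *)

Section OrderCounit.
Variables (K : fieldType) (R : subringClosed K) (p : nat) (z c delta mu : K).
Hypothesis S : order_scalars R p z c delta mu.
Variables (H : hopfAlgebra K) (G : grading H) (e0 e1 a b g : H).
Hypothesis N : nik_hopf p z G e0 e1 a b g.
Local Notation H' := (nik_form S N).
Local Notation X := (nik_order (S:=S) (N:=N)).
Local Notation io := (grade_emb G c : H -> quad H' c).
Local Notation nr Y := (near1 (lat delta Y) (qroot _ c)).
Let XR := nik_order_Rsubalg S N.
Let c0 := os_c S.

Lemma nik_order_counit x : X x -> counit H' x \in R.
Proof.
pose Y (x : H') := counit H' x \in R.
have YR : Rsubalg R Y.
  split=> [|u v hu hv|u v hu hv|r u hr hu]; rewrite /Y.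
  - by rewrite rmorph1 rpred1.
  - by rewrite linearD rpredD.
  - by rewrite rmorphM rpredM.
  by rewrite linearZ rpredM.
have ce h : counit H' h = counit H h by [].
have eZ k x' : counit H' (k *: x') = k * counit H' x' by rewrite linearZ.
have eB x' y : counit H' (x' - y) = counit H' x' - counit H' y by rewrite linearB.
have ce1 : counit H' 1 = 1 by exact: rmorph1.
have nrY h : counit H h = 1 -> nr Y (io h).
  move=> eh; have eG : counit H' (c^-1 *: G h : H) = 0.
    by rewrite eZ ce (nik_counit_odd N) mulr0.
  have eG' : counit H' (h - G h : H) = 1 by rewrite eB !ce (nik_counit_odd N) eh subr0.
  apply/(os_near1 S YR); rewrite /Y; split; first by rewrite eZ eG mulr0 rpred0.
  by rewrite eB 2!eZ eB eG eG' ce1 subrr !mulr0 subrr rpred0.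
move=> hx; apply: (hx Y YR); rewrite /Y ?ce ?(nik_ce0 N) ?(nik_ce1 N) ?(nik_cg N) ?rpred1 ?rpred0 //.
  by apply: nrY; exact: nik_ca N.
by apply: nrY; exact: nik_cb N.
Qed.

(** The antipode reverses products and commutes with the grading, so that it is enough to
see that the antipodes of a and b are congruent to 1. *)
Lemma nik_order_antipode x : X x -> X (antipode H' x).
Proof.
pose Y (x : H') := X (antipode H' x).
have YR : Rsubalg R Y.
  split=> [|u v hu hv|u v hu hv|r u hr hu]; rewrite /Y.
  - by rewrite antipode1; exact: (Rsubalg1 XR).
  - by rewrite linearD; exact: (RsubalgD XR).
  - by rewrite antipodeM; exact: (RsubalgM XR).
  by rewrite linearZ; exact: (RsubalgZ XR).
have Se h : antipode H' h = antipode H h by [].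
have SZ k (x' : H') : antipode H' (k *: x') = k *: antipode H' x' by rewrite linearZ.
have SB (x' y : H') : antipode H' (x' - y) = antipode H' x' - antipode H' y by rewrite linearB.
have nrS h : nr X (io (antipode H h)) -> nr Y (io h).
  move/(os_near1 S XR) => [h1 h2]; apply/(os_near1 S YR); rewrite /Y.
  have SG : antipode H' (G h : H) = G (antipode H h) by rewrite Se (nik_antipode_odd N).
  have SG' : antipode H' (h - G h : H) = antipode H h - G (antipode H h).
    by rewrite SB !Se (nik_antipode_odd N).
  by rewrite !SZ SB !SZ SB antipode1 SG SG'.
move=> hx; apply: (hx Y YR); rewrite /Y ?Se.
- by rewrite (nik_Se0 N); exact: nik_order_e0.
- by rewrite (nik_Se1 N); exact: nik_order_e1.
- by rewrite (nik_Sg N); exact: nik_order_g.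
- apply: nrS; rewrite (nik_Sa N) (grade_embX _ c0).
  exact: (os_near1X S XR _ (nik_order_a S N)).
apply: nrS; rewrite (nik_Sb N) grade_embD !(grade_embM _ c0) (grade_embX _ c0).
have even h : G h = 0 -> X h -> lat delta X (io h).
  by move=> Gh Xh; rewrite /grade_emb Gh subr0 scaler0; apply/(lat_base c delta XR).
apply: (os_near1_glue S XR).
- by have := grade_embD G c e0 e1; rewrite (nik_sum N) grade_emb1 => ->.
- by apply: even; [exact: nik_Ge0 N|exact: nik_order_e0].
- by apply: even; [exact: nik_Ge1 N|exact: nik_order_e1].
- exact: (os_near1X S XR _ (nik_order_b S N)).
exact: nik_order_b.
Qed.

End OrderCounit.

(** * Integrality of the trace *)

Section NewtonLattice.
Variables (K : fieldType) (B : algType K) (R : subringClosed K) (L : B -> Prop).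
Hypothesis LR : Rsubalg R L.
Hypothesis LC : forall s, L s -> forall x, s * x = x * s.
Variables (c : K) (t : B).
Hypothesis c_neq0 : c != 0.
Hypothesis tC : forall x, t * x = x * t.
Hypothesis tt : t * t = c%:A.
Hypothesis Lt : L t.
Variables (p : nat) (z : K) (e0 e1 a b g : B).
Hypothesis z_prim : p.-primitive_root z.
Hypothesis N : nik_units p z e0 e1 a b g.
Local Notation q := z^-1.
Hypothesis q_prim : p.-primitive_root q.
Hypothesis q_in : q \in R.
Hypothesis qX1c : forall i, (q ^+ i - 1) / c \in R.

Let p_gt0 := prim_order_gt0 z_prim.
Let z0 := prim_neq0 z_prim.

Let ti : B := c^-1 *: t.
Let tit : ti * t = 1. Proof. by rewrite /ti -scalerAl tt scalerA mulVf // scale1r. Qed.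
Let tti : t * ti = 1. Proof. by rewrite /ti -scalerAr tt scalerA mulVf // scale1r. Qed.
Let tiC x : ti * x = x * ti. Proof. by rewrite /ti -scalerAl tC scalerAr. Qed.

Let ti_comm e x : e * x = x * e -> e * (ti * x) = ti * x * e.
Proof. by move=> ex; rewrite mulrA -tiC -mulrA ex mulrA. Qed.
Let sub_comm (e x : B) (k : K) : e * x = x * e -> e * (x - k%:A) = (x - k%:A) * e.
Proof. by move=> ex; rewrite mulrBl mulrBr ex -scalerAr -scalerAl mulr1 mul1r. Qed.
Let sub1_comm (e x : B) : e * x = x * e -> e * (x - 1) = (x - 1) * e.
Proof. by move=> ex; rewrite mulrBl mulrBr ex mulr1 mul1r. Qed.

(** The products (x - 1)(x - q)...(x - q^(m-1)) / t^m: integral when x is congruent to 1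
modulo t. *)
Fixpoint newton (m : nat) (x : B) : B :=
  if m is m'.+1 then newton m' x * (ti * (x - (q ^+ m')%:A)) else 1.

Let r m : K := (q ^+ m - 1) / c.
Let tr m : t * (r m)%:A = ti * (q ^+ m - 1)%:A.
Proof. by rewrite /r /ti -scalerAr -scalerAl -scalerAr scalerA mulrC. Qed.

Lemma newtonE m x : newton m x = (c^-1 *: t) ^+ m * \prod_(i < m) (x - (q ^+ i)%:A).
Proof.
elim: m => [|m IH]; first by rewrite big_ord0 mulr1.
rewrite big_ord_recr exprSr /= IH -/ti -!mulrA; congr (_ * _).
by rewrite !mulrA tiC.
Qed.

Let newton_comm e m x : e * x = x * e -> e * newton m x = newton m x * e.
Proof.
move=> ex; elim: m => [|m IH] /=; first by rewrite mul1r mulr1.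
rewrite mulrA IH -!mulrA; congr (_ * _); rewrite [RHS]mulrA.
by apply: ti_comm; exact: sub_comm.
Qed.

Let newton_step m x : ti * (x - 1) * newton m x = newton m.+1 x + t * (r m *: newton m x).
Proof.
have -> : ti * (x - 1) * newton m x = newton m x * (ti * (x - 1)).
  by apply: esym; apply: ti_comm; apply: sub1_comm; apply: esym; exact: newton_comm.
have -> : t * (r m *: newton m x) = newton m x * (t * (r m)%:A).
  by rewrite -!scalerAr mulr1 -tC.
rewrite tr /= -mulrDr -mulrDr; congr (_ * (_ * _)).
by rewrite scalerBl scale1r addrA subrK.
Qed.

Let newton_order x : x ^+ p = 1 -> newton p x = 0.
Proof.
move=> xp; rewrite newtonE -/ti.
suff -> : \prod_(i < p) (x - (q ^+ i)%:A) = 0 by rewrite mulr0.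
have := congr1 (horner_alg x) (factor_Xn_sub_1 q_prim).
rewrite rmorphB rmorphXn rmorph1 /= horner_algX xp subrr big_mkord rmorph_prod => <-.
by apply: eq_bigr => i _; rewrite rmorphB /= horner_algX horner_algC.
Qed.

Lemma newton_big m x : x ^+ p = 1 -> (p <= m)%N -> newton m x = 0.
Proof.
move=> xp /subnK <-; elim: (m - p)%N => [|k IH] /=; first exact: newton_order.
by rewrite IH mul0r.
Qed.

(* The effect of commuting x past an element with which it q-commutes. *)
Let newton_q m x : newton m (q *: x) =
  q ^+ m *: newton m x + t * ((r m * q ^+ m.-1) *: newton m.-1 x).
Proof.
case: m => [|m]; first by rewrite /r !expr0 subrr !mul0r scale0r mulr0 addr0 scale1r.
have E n : \prod_(i < n.+1) (q *: x - (q ^+ i)%:A) =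
   q ^+ n *: ((q *: x - 1) * \prod_(i < n) (x - (q ^+ i)%:A)).
  rewrite big_ord_recl expr0 scale1r scalerAr; congr (_ * _).
  elim: n => [|n IH]; first by rewrite !big_ord0 scale1r.
  rewrite !big_ord_recr /= IH -scalerAl; have -> : q ^+ n.+1 = q ^+ n * q by rewrite exprSr.
  rewrite -[RHS]scalerA; congr (_ *: _); rewrite scalerAr; congr (_ * _).
  by rewrite scalerBr scalerA [q * _]mulrC.
rewrite !newtonE -/ti E [m.+1.-1]/=; set P := \prod_(i < m) _.
have PC : x * P = P * x.
  rewrite /P; elim: m {E P} => [|m IH]; first by rewrite big_ord0 mulr1 mul1r.
  rewrite big_ord_recr /= mulrA IH -!mulrA; congr (_ * _).
  by rewrite mulrBl mulrBr -scalerAr -scalerAl mul1r mulr1.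
rewrite big_ord_recr /= -/P.
have -> : t * ((r m.+1 * q ^+ m) *: (ti ^+ m * P)) = (q ^+ m.+1 - 1) *: (q ^+ m *: (ti ^+ m.+1 * P)).
  have -> : ti ^+ m.+1 * P = c^-1 *: (t * (ti ^+ m * P)).
    by rewrite exprS /ti -!scalerAl -!mulrA.
  by rewrite -scalerAr !scalerA /r; congr (_ *: _); ring.
have -> : P * (x - (q ^+ m)%:A) = x * P - q ^+ m *: P by rewrite mulrBr -PC -scalerAr mulr1.
have -> : (q *: x - 1) * P = q *: (x * P) - P by rewrite mulrBl scalerAl mul1r.
rewrite -scalerAr !mulrBr -!scalerAr !scalerBr !scalerA -addrA -exprSr; congr (_ + _).
by rewrite -!scaleNr -scalerDl; congr (_ *: _); ring.
Qed.

(** A lattice on which the trace can be computed, in contrast to the order itself: it is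
spanned by explicit elements. Being stable under left multiplication by the generators of
the order and containing 1, it contains the order. *)
Inductive newton_span : B -> Prop :=
| newton_spanD x y : newton_span x -> newton_span y -> newton_span (x + y)
| newton_spanM s x : L s -> newton_span x -> newton_span (s * x)
| newton_span_monom (k : bool) m n (eps : bool) :
    newton_span ((if k then e1 else e0) * (newton m a * newton n b) * g ^+ eps).
Local Notation M := newton_span.

Let MZ k x : k \in R -> M x -> M (k *: x).
Proof.
move=> kR hx; have -> : k *: x = k%:A * x by rewrite -scalerAl mul1r.
by apply: newton_spanM => //; apply: (Rsubalg_scalar LR).
Qed.
Let Mt x : M x -> M (t * x). Proof. exact: newton_spanM. Qed.

Let M_ind (f : B) : (forall k m n (eps : bool),
    M (f * ((if k then e1 else e0) * (newton m a * newton n b) * g ^+ eps))) ->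
  forall x, M x -> M (f * x).
Proof.
move=> hf x; elim=> [u v _ hu _ hv|s u hs _ hu|k m n eps]; last exact: hf.
  by rewrite mulrDr; exact: newton_spanD.
by rewrite mulrA -(LC hs) -mulrA; apply: newton_spanM.
Qed.

Let M0 : M 0.
Proof.
rewrite -(mul0r (e0 * (newton 0 a * newton 0 b) * g ^+ false)); apply: newton_spanM.
  exact: (Rsubalg0 LR).
exact: (newton_span_monom false 0 0 false).
Qed.

Lemma newton_span_e0 x : M x -> M (e0 * x).
Proof.
apply: M_ind => k m n eps; rewrite !mulrA -[_ * newton m a]mulrA.
case: k; first by rewrite mulrA (nik_e01 N) !mul0r; exact: M0.
rewrite [e0 * (_ * _)]mulrA (nik_e00 N) -[e0 * _ * _]mulrA.
exact: (newton_span_monom false m n eps).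
Qed.

Lemma newton_span_e1 x : M x -> M (e1 * x).
Proof.
apply: M_ind => k m n eps; rewrite !mulrA -[_ * newton m a]mulrA.
case: k; last by rewrite mulrA (nik_e10 N) !mul0r; exact: M0.
rewrite [e1 * (_ * _)]mulrA (nik_e11 N) -[e1 * _ * _]mulrA.
exact: (newton_span_monom true m n eps).
Qed.

Lemma newton_span_a x : M x -> M (c^-1 *: t * (a - 1) * x).
Proof.
apply: M_ind => k m n eps; rewrite -/ti; set e := if k then e1 else e0.
have -> : ti * (a - 1) * (e * (newton m a * newton n b) * g ^+ eps)
    = e * ((ti * (a - 1) * newton m a) * newton n b) * g ^+ eps.
  have ea : ti * (a - 1) * e = e * (ti * (a - 1)).
    by apply: esym; apply: ti_comm; apply: sub1_comm; rewrite /e; case: k {e}; rewrite ?(nik_e1a N) ?(nik_e0a N).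
  by rewrite !mulrA ea !mulrA.
rewrite newton_step mulrDl mulrDr mulrDl; apply: newton_spanD; first exact: newton_span_monom.
rewrite -!mulrA [e * _]mulrA -tC -!mulrA; apply: Mt.
rewrite -scalerAl -scalerAr; apply: MZ; first exact: qX1c.
by rewrite [newton m a * _]mulrA mulrA; exact: newton_span_monom.
Qed.

Let b_newton m : e1 * (b * newton m a) = e1 * (newton m (q *: a) * b).
Proof.
have e1ba : e1 * (b * a) = q *: (e1 * (a * b)).
  by rewrite (nik_ab1 N) scalerA mulVf // scale1r.
have tiA x y : x * (ti * y) = ti * (x * y) by rewrite mulrA -tiC -mulrA.
elim: m => [|m IH] /=; first by rewrite mulr1 mul1r.
rewrite [b * _]mulrA [e1 * _]mulrA IH; set A' := newton m (q *: a).
have e1A : e1 * A' = A' * e1.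
  by apply: newton_comm; rewrite -scalerAr -scalerAl (nik_e1a N).
rewrite [e1 * (A' * b)]mulrA e1A -!mulrA [e1 * (A' * _)]mulrA e1A -!mulrA; congr (_ * _).
rewrite !tiA; congr (_ * _).
rewrite mulrBl !mulrBr; congr (_ - _); first by rewrite e1ba -scalerAl -scalerAr.
by rewrite -scalerAr -scalerAl mulr1 mul1r.
Qed.

(** On the second block, moving b past newton(a) replaces a by q a; the error
newton(q a) - newton(a) is divisible by t by the recursion above. *)
Lemma newton_span_b x : M x -> M (c^-1 *: t * (b - 1) * x).
Proof.
pose e (k : bool) := if k then e1 else e0.
have tiA y y' : y * (ti * y') = ti * (y * y') by rewrite mulrA -tiC -mulrA.
have tA y y' : y * (t * y') = t * (y * y') by rewrite mulrA -tC -mulrA.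
have eb k : ti * (b - 1) * e k = e k * (ti * (b - 1)).
  by apply: esym; apply: ti_comm; apply: sub1_comm; case: k; rewrite /= ?(nik_e1b N) ?(nik_e0b N).
have Mmon k m n s (eps : bool) : s \in R ->
    M (e k * ((s *: newton m a) * newton n b) * g ^+ eps).
  by move=> sR; rewrite -scalerAl -scalerAr -scalerAl; apply: MZ => //; exact: newton_span_monom.
have MmonU k m n s (eps : bool) : s \in R ->
    M (e k * ((s *: newton m a) * (ti * (b - 1) * newton n b)) * g ^+ eps).
  move=> sR; rewrite newton_step !mulrDr mulrDl; apply: newton_spanD; first exact: Mmon.
  rewrite !tA -mulrA; apply: Mt; rewrite -scalerAr -scalerAl scalerA scalerAl; apply: Mmon.
  by rewrite rpredM ?qX1c.
apply: M_ind => k m n eps; rewrite -/(e k) -/ti.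
have [A' [bA MA MB]] : exists A', [/\ e k * (b * newton m a) = e k * (A' * b),
    M (e k * (A' * (ti * (b - 1) * newton n b)) * g ^+ eps)
  & M (e k * (ti * (A' - newton m a) * newton n b) * g ^+ eps)].
  case: k; last first.
    exists (newton m a); split.
    - have e0ba : e0 * b * a = a * (e0 * b).
        have := nik_ab0 N; rewrite scale1r mulrA => h.
        by rewrite -mulrA -h (nik_e0a N) mulrA.
      by rewrite mulrA (newton_comm _ e0ba) /= mulrA -(newton_comm _ (nik_e0a N)) -mulrA.
    - by rewrite -[newton m a]scale1r; apply: MmonU; exact: rpred1.
    by rewrite subrr mulr0 !mul0r mulr0 mul0r; exact: M0.
  exists (newton m (q *: a)); split; first exact: b_newton.
    rewrite newton_q mulrDl mulrDr mulrDl; apply: newton_spanD.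
      by apply: MmonU; rewrite rpredX.
    by rewrite -[t * _ * _]mulrA tA -mulrA; apply: Mt; apply: MmonU; rewrite rpredM ?rpredX ?qX1c.
  have -> : ti * (newton m (q *: a) - newton m a)
     = t * (r m *: newton m a) + (r m * q ^+ m.-1) *: newton m.-1 a.
    rewrite newton_q addrAC -[X in _ - X]scale1r -scalerBl mulrDr; congr (_ + _).
      by rewrite /ti -!scalerAl -!scalerAr scalerA mulrC.
    by rewrite mulrA tit mul1r.
  rewrite !mulrDl mulrDr mulrDl; apply: newton_spanD; last first.
    by apply: Mmon; rewrite rpredM ?rpredX ?qX1c.
  by rewrite -[t * _ * _]mulrA tA -mulrA; apply: Mt; apply: Mmon; exact: qX1c.
have -> : ti * (b - 1) * (e k * (newton m a * newton n b) * g ^+ eps)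
    = e k * (A' * (ti * (b - 1) * newton n b)) * g ^+ eps
      + e k * (ti * (A' - newton m a) * newton n b) * g ^+ eps.
  have h1 : e k * (b - 1) * newton m a = e k * (A' * b - newton m a).
    by rewrite -mulrA mulrBl mul1r mulrBr bA -mulrBr.
  transitivity (ti * (e k * (A' * b - newton m a)) * newton n b * g ^+ eps).
    by rewrite -h1 mulrA mulrA eb tiA !mulrA.
  rewrite -mulrDl -mulrDr; congr (_ * _).
  have -> : A' * (ti * (b - 1) * newton n b) = ti * (A' * (b - 1)) * newton n b.
    by rewrite !mulrA tiC.
  rewrite -mulrDl -mulrDr [RHS]mulrA tiA -!mulrA; congr (_ * (_ * (_ * _))).
  by rewrite mulrBr mulr1 addrA subrK.
exact: newton_spanD.
Qed.

Lemma newton_span_g x : M x -> M (g * x).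
Proof.
have gX (eps : bool) : g * g ^+ eps = g ^+ ~~ eps.
  by case: eps; rewrite /= ?expr0 ?expr1 ?mulr1 // (nik_gg N).
apply: M_ind => k m n eps.
have g_newton e y y' i : e * y' = y' * e -> e * (g * y) = e * (y' * g) ->
    e * (g * newton i y) = e * (newton i y' * g).
  move=> ey' gy; elim: i => [|i IH] /=; first by rewrite mulr1 mul1r.
  have tiA u v : u * (ti * v) = ti * (u * v) by rewrite mulrA -tiC -mulrA.
  have ew := newton_comm i ey'.
  rewrite [g * _]mulrA [e * _]mulrA IH [e * (_ * g)]mulrA ew -!mulrA [RHS]mulrA ew -!mulrA.
  congr (_ * _); rewrite !tiA; congr (_ * _); rewrite mulrBl !mulrBr gy; congr (_ - _).
  by rewrite -scalerAr -scalerAl mulr1 mul1r.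
have split e y y' m' n' : e * g = g * e -> e * newton m' y' = newton m' y' * e ->
    e * (g * newton m a) = e * (newton m' y' * g) ->
    e * (g * newton n b) = e * (newton n' y * g) ->
  g * (e * (newton m a * newton n b) * g ^+ eps)
    = e * (newton m' y' * newton n' y) * g ^+ ~~ eps.
  move=> eg em h1 h2; rewrite -gX !mulrA; congr (_ * _).
  rewrite -eg -[e * g * _]mulrA h1 !mulrA em -!mulrA; congr (_ * _).
  by rewrite h2.
case: k.
  rewrite (@split e1 b a m n) ?nik_e1g //; first exact: (newton_span_monom true).
  - exact: nik_e1g N.
  - exact: newton_comm (nik_e1a N).
  - by apply: g_newton; [exact: nik_e1a N|rewrite (nik_ga1 N) scale1r].
  by apply: g_newton; [exact: nik_e1b N|rewrite (nik_gb1 N) scale1r].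
rewrite (@split e0 a b m n) //; last 1 first.
- by apply: g_newton; [exact: nik_e0a N|exact: nik_gb0 N].
- rewrite (_ : e0 * (newton m b * newton n a) = e0 * (newton n a * newton m b)).
    exact: (newton_span_monom false).
  have e0ba : e0 * b * a = a * (e0 * b).
    have := nik_ab0 N; rewrite scale1r mulrA => h.
    by rewrite -mulrA -h (nik_e0a N) mulrA.
  have e0nb : newton n a * e0 * b = b * (newton n a * e0).
    by rewrite -mulrA -(newton_comm n e0ba) (nik_e0b N) -mulrA (newton_comm n (nik_e0a N)).
  rewrite mulrA (newton_comm m (nik_e0b N)) -mulrA (newton_comm n (nik_e0a N)) [RHS]mulrA.
  rewrite (newton_comm n (nik_e0a N)); apply: esym; apply: newton_comm.
  exact: e0nb.
- exact: nik_e0g N.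
- exact: newton_comm (nik_e0b N).
by apply: g_newton; [exact: nik_e0b N|exact: nik_ga0 N].
Qed.

Lemma newton_span1 : M 1.
Proof.
rewrite -(nik_sum N); apply: newton_spanD.
  by have := newton_span_monom false 0 0 false; rewrite /= !mulr1.
by have := newton_span_monom true 0 0 false; rewrite /= !mulr1.
Qed.
End NewtonLattice.

Section TraceIntegral.
Variables (K : fieldType) (R : subringClosed K) (p : nat) (z c delta mu : K).
Hypothesis S : order_scalars R p z c delta mu.
Variables (H : hopfAlgebra K) (G : grading H) (e0 e1 a b g : H).
Hypothesis N : nik_hopf p z G e0 e1 a b g.
Local Notation H' := (nik_form S N).
Local Notation X := (nik_order (S:=S) (N:=N)).
Local Notation B := (quad H' c).
Local Notation io := (grade_emb G c : H -> B).
Local Notation nr Y := (near1 (lat delta Y) (qroot _ c)).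
Local Notation t := (qroot H' c).
Local Notation q := z^-1.
Local Notation mk := (@mkq K H' c).
Variable tau : H -> K.
Hypothesis tau_lin : scalar tau.
Hypothesis tau_monom : forall k i j eps,
  tau (nik_monom e0 e1 a b g k i j eps) = [&& (p %| i)%N, (p %| j)%N & ~~ eps]%:R.

Let XR := nik_order_Rsubalg S N.
Let c0 := os_c S.
Let z_prim := os_prim S.
Let p_gt0 := prim_order_gt0 z_prim.

Let tauD x y : tau (x + y) = tau x + tau y.
Proof. by have := tau_lin 1 x y; rewrite scale1r mul1r. Qed.
Let tau0 : tau 0 = 0.
Proof. by have := tauD 0 0; rewrite addr0 => /eqP; rewrite -subr_eq0 opprD addrA subrr sub0r oppr_eq0 => /eqP. Qed.
Let tauZ k x : tau (k *: x) = k * tau x.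
Proof. by have := tau_lin k x 0; rewrite addr0 tau0 addr0. Qed.
Let tauB x y : tau (x - y) = tau x - tau y.
Proof. by rewrite tauD -scaleN1r tauZ mulN1r. Qed.

(** The automorphism 1 - 2 G inverts a and b, hence permutes the monomials. *)
Lemma nik_trace_odd x : tau (G x) = 0.
Proof.
pose psi y := y - 2%:R *: G y.
have psiE y : psi y = y - 2%:R *: G y by [].
clearbody psi.
have psiD x' y' : psi (x' + y') = psi x' + psi y'.
  by rewrite !psiE [G (_ + _)]linearD /= scalerDr opprD addrACA.
have psiZ k y : psi (k *: y) = k *: psi y.
  by rewrite !psiE [G (_ *: _)]linearZ /= scalerBr !scalerA mulrC.
have psi_homog i y : homog G i y -> psi y = (-1) ^+ i *: y.
  rewrite /homog psiE => ->; case: i; rewrite ?scaler0 ?subr0 ?scale1r //.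
  by rewrite expr1 -{1}[y]scale1r -scalerBl; congr (_ *: _); ring.
have psiM x' y' : psi (x' * y') = psi x' * psi y'.
  elim/(homog_ind (G := G)): x' => [x' x2 IH IH'|i x' hx].
    by rewrite mulrDl !psiD IH IH' mulrDl.
  elim/(homog_ind (G := G)): y' => [y' y2 IH IH'|j y' hy].
    by rewrite mulrDr !psiD IH IH' mulrDr.
  rewrite (psi_homog _ _ (homogM hx hy)) (psi_homog _ _ hx) (psi_homog _ _ hy).
  by rewrite -scalerAl -scalerAr scalerA signr_addb.
have psi_even y : G y = 0 -> psi y = y by move=> Gy; rewrite !psiE Gy scaler0 subr0.
have psiX y n : psi (y ^+ n) = psi y ^+ n.
  elim: n => [|n IH]; last by rewrite !exprS psiM IH.
  exact: psi_even (homog1 G).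
have psi_inv y : G y = 2%:R^-1 *: (y - y ^+ p.-1) -> psi y = y ^+ p.-1.
  by move=> Gy; rewrite !psiE Gy scalerA mulfV ?scale1r ?opprB 1?addrC ?subrK // (os_two S).
have psi_tau : forall y, tau (psi y) = tau y.
  apply: (nik_span_ind N _ (nik_gen N)) => [|u v IH IH'|k u IH|k i j eps].
  - exact: prim_neq0 z_prim.
  - by rewrite psiD !tauD IH IH'.
  - by rewrite psiZ !tauZ IH.
  have -> : psi (nik_monom e0 e1 a b g k i j eps)
      = nik_monom e0 e1 a b g k (p.-1 * i) (p.-1 * j) eps.
    rewrite /nik_monom !psiM !psiX (psi_inv a (nik_Ga N)) (psi_inv b (nik_Gb N)).
    rewrite (psi_even g (nik_Gg N)) -!exprM; congr (_ * _ * _).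
    by case: k; apply: psi_even; [exact: nik_Ge1 N|exact: nik_Ge0 N].
  by rewrite !tau_monom !Gauss_dvdr ?coprimenP.
have := psi_tau x; rewrite !psiE tauB tauZ => /eqP.
rewrite -subr_eq0 addrAC subrr sub0r oppr_eq0 mulf_eq0 (negPf (os_two S)) => /eqP.
by [].
Qed.

(* The scalars k + l t of K[t] lying in R[theta], inside quad H' c. *)
Let Y0 (x : H') : Prop := exists2 r, r \in R & x = r%:A.
Let Y0R : Rsubalg R Y0.
Proof.
split=> [|_ _ [r hr ->] [s hs ->]|_ _ [r hr ->] [s hs ->]|r _ hr [s hs ->]].
- by exists 1; rewrite ?rpred1 ?scale1r.
- by exists (r + s); rewrite ?rpredD ?scalerDl.
- by exists (r * s); rewrite ?rpredM // -scalerAl mul1r scalerA.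
by exists (r * s); rewrite ?rpredM // scalerA.
Qed.
Let L0 : B -> Prop := lat delta Y0.
Let L0R : Rsubalg R L0 := os_lat S Y0R.
Let L0t : L0 t := os_lat_t S Y0R.

Let L0P s : L0 s -> exists k l, s = mk k%:A l%:A.
Proof.
case: s => s1 s2 [/= [l hl el] [k hk ek]].
have e2 : s2 = (2%:R^-1 * l)%:A by rewrite -scalerA -el scalerA mulVf ?scale1r // (os_two S).
exists (k + c * delta * (2%:R^-1 * l)), (2%:R^-1 * l).
rewrite scalerDl -ek -[(_ * (2%:R^-1 * l))%:A]scalerA -e2 subrK.
by [].
Qed.

Let KtC k l (x : B) : mk k%:A l%:A * x = x * mk k%:A l%:A.
Proof.
case: x => x y; rewrite -/(mkq c x y) !mkqM -!scalerAl -!scalerAr !mul1r !mulr1.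
by congr (mk _ _); rewrite addrC.
Qed.

Let L0C s : L0 s -> forall x, s * x = x * s.
Proof. by move=> /L0P[k [l ->]] x; exact: KtC. Qed.

Let NB : nik_units p z (io e0) (io e1) (io a) (io b) (io g).
Proof.
apply: (nik_units_morph (f := io)) N.
- exact: grade_emb1.
- exact: grade_embD.
- exact: grade_embM.
- exact: grade_embZ.
Qed.

Let qX1c i : (q ^+ i - 1) / c \in R.
Proof. by rewrite (os_zV S) -exprM (os_zX1c S). Qed.

Local Notation M := (newton_span L0 c t z (io e0) (io e1) (io a) (io b) (io g)).

Let Xd (x : H') : Prop := forall m, M m -> M (mk x 0 * m).
Let XdR : Rsubalg R Xd.
Proof.
split=> [|x y hx hy|x y hx hy|r x hr hx] m hm.
- by rewrite mkq1 mul1r.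
- have -> : mk (x + y) 0 = mk x 0 + mk y 0 :> B by rewrite mkqD addr0.
  by rewrite mulrDl; apply: newton_spanD; [exact: hx|exact: hy].
- have -> : mk (x * y) 0 = mk x 0 * mk y 0 :> B by rewrite mkqMl mulr0.
  by rewrite -mulrA; apply/hx/hy.
have -> : mk (r *: x) 0 = r%:A * mk x 0 :> B.
  by rewrite -scalerAl mul1r mkqZ scaler0.
rewrite -mulrA; apply: newton_spanM; last exact: hx.
exact: (Rsubalg_scalar L0R).
Qed.

Let Xd_even h : G h = 0 -> (forall m, M m -> M (io h * m)) -> Xd h.
Proof. by move=> Gh; rewrite /grade_emb Gh subr0 scaler0. Qed.

(* With U = (io h - 1) / t, the two coordinates that have to preserve the lattice are
   2 u2 = (io h)^-1 U^2 and u1 - c delta u2 = U - theta (2 u2), where U = u1 + u2 t. *)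
Let Xd_near h : G h = 2%:R^-1 *: (h - h ^+ p.-1) -> io h ^+ p = 1 ->
  (forall m, M m -> M (c^-1 *: t * (io h - 1) * m)) -> nr Xd (io h).
Proof.
move=> Gh hp hU; set al := io h; set U := c^-1 *: t * (al - 1).
have tC x : t * x = x * t := qrootC x.
have tt := qroot_sqr H' c.
have tU : t * U = al - 1.
  by rewrite /U mulrA -scalerAr tt scalerA mulVf // scale1r mul1r.
have alE : al = 1 + t * U by rewrite tU addrC subrK.
have alM n m : M m -> M (al ^+ n * m).
  move=> hm; elim: n => [|n IH]; first by rewrite mul1r.
  rewrite exprS -mulrA {1}alE mulrDl mul1r -mulrA; apply: newton_spanD => //.
  by apply: newton_spanM => //; exact: hU.
have two (x : H) : 2%:R *: x = x + x by rewrite scaler_nat mulr2n.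
have Gh2 : G h + G h = h - h ^+ p.-1.
  by rewrite -two Gh scalerA mulfV ?(os_two S) // scale1r.
have G' : G (h ^+ p.-1) = - G h.
  have GD x y : G (x + y) = G x + G y by exact: raddfD.
  have GN x : G (- x) = - G x by exact: raddfN.
  have GG := odd_partK G h; have := congr1 G Gh2; rewrite !GD GN !GG => E.
  by apply: oppr_inj; rewrite opprK; apply: (addrI (G h)); exact: esym E.
have alV : al ^+ p.-1 = mk (h - G h) (- (c^-1 *: G h)).
  rewrite /al -(grade_embX _ c0) /grade_emb G' scalerN opprK; congr (mkq _ _ _).
  have -> : h ^+ p.-1 = h - (G h + G h) by rewrite Gh2 subKr.
  by rewrite opprD addrA subrK.
pose u1 : H' := c^-1 *: G h; pose u2 : H' := c^-1 *: (h - G h - 1).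
have al1 : al - 1 = mk (h - G h - 1) (c^-1 *: G h).
  by rewrite /al /grade_emb -mkq1 mkqN mkqD oppr0 addr0.
have UE : U = mk u1 u2.
  rewrite /U al1 -scalerAl qrootM mkqZ; congr (mkq _ _ _).
  by rewrite scalerA mulVf // scale1r.
have U2 : mk (2%:R *: u2) 0 = al ^+ p.-1 * (U * U).
  have -> : U * U = c^-1 *: ((al - 1) * (al - 1)).
    rewrite /U -!scalerAl -!scalerAr -!mulrA [(al - 1) * (t * _)]mulrA -tC -!mulrA.
    rewrite [t * (t * _)]mulrA tt -scalerAl mul1r !scalerA; congr (_ *: _).
    by field.
  have e : al ^+ p.-1 * (al - 1) = 1 - al ^+ p.-1.
    by rewrite mulrBr mulr1 -exprSr prednK // hp.
  rewrite -scalerAr mulrA e mulrBl mul1r e.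
  rewrite opprB al1 alV -mkq1 mkqN !mkqD mkqZ; congr (mkq _ _ _).
    rewrite /u2 scalerA mulrC -scalerA two; congr (_ *: _); rewrite -!addrA; congr (_ + _).
  by rewrite /= oppr0 addr0 subrr scaler0.
have Xu2 : Xd (2%:R *: u2).
  move=> m hm; rewrite U2 -mulrA; apply: alM; rewrite -[U * U * m]mulrA.
  by apply: (hU (U * m)); exact: (hU m hm).
have Xu1 : Xd (u1 - (c * delta) *: u2).
  pose th : B := mk (c * delta / 2%:R)%:A (2%:R^-1)%:A.
  have L0th : L0 th.
    split=> /=; first by exists 1; rewrite ?rpred1 // scalerA mulfV // (os_two S).
    by exists 0; rewrite ?rpred0 // scalerA subrr scale0r.
  move=> m hm.
  have -> : mk (u1 - (c * delta) *: u2) 0 = U - th * mk (2%:R *: u2) 0.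
    rewrite UE mkqMr mkqN mkqD -!scalerAl !mul1r; congr (mkq _ _ _).
      by congr (_ - _); rewrite [RHS]scalerA divfK // (os_two S).
    by rewrite scalerA mulVf ?(os_two S) // scale1r subrr.
  rewrite mulrBl; apply: newton_spanD; first exact: (hU m hm).
  rewrite -mulrA -mulNr; apply: newton_spanM; last exact: Xu2.
  exact: (RsubalgN L0R).
by exists U; [rewrite UE; split|].
Qed.

Let T (x : H') : K := c ^+ p.-1 * tau x.
Let TE (s : B) : B := mk (T s.1)%:A (T s.2)%:A.

Let TE_scal k l x : TE (mk k%:A l%:A * x) = mk k%:A l%:A * TE x.
Proof.
case: x => x y; rewrite -/(mkq c x y) !mkqM /TE /= /T -!scalerAl !mul1r !tauD !tauZ.
by congr (mkq _ _ _); rewrite !scalerA -scalerDl; congr (_ *: _); ring.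
Qed.

Let TE_D x y : TE (x + y) = TE x + TE y.
Proof.
by rewrite /TE mkqD -!scalerDl /T -!mulrDr -!tauD.
Qed.

Let TE0 : TE 0 = 0.
Proof. by rewrite /TE /= /T tau0 mulr0 scale0r. Qed.

Let tau_newton k m n eps :
  tau ((if k then e1 else e0) * ((\prod_(i < m) (a - (q ^+ i)%:A)) * (\prod_(i < n) (b - (q ^+ i)%:A)))
    * g ^+ nat_of_bool eps) \in R.
Proof.
set e := if k then e1 else e0.
pose pa m := \prod_(i < m) (a - (q ^+ i)%:A); pose pb n := \prod_(i < n) (b - (q ^+ i)%:A).
suff gen i j : tau (e * ((a ^+ i * pa m) * (b ^+ j * pb n)) * g ^+ eps) \in R.
  by have := gen 0%N 0%N; rewrite !expr0 !mul1r.
have q_in := os_zV_in S.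
have comm (x : H) l : x * \prod_(i < l) (x - (q ^+ i)%:A) = \prod_(i < l) (x - (q ^+ i)%:A) * x.
  elim: l => [|l IH]; first by rewrite big_ord0 mulr1 mul1r.
  rewrite big_ord_recr /= mulrA IH -!mulrA; congr (_ * _).
  by rewrite mulrBr mulrBl -scalerAr -scalerAl mulr1 mul1r.
have shift (x : H) r l : x ^+ r * \prod_(i < l.+1) (x - (q ^+ i)%:A)
    = x ^+ r.+1 * \prod_(i < l) (x - (q ^+ i)%:A) - q ^+ l *: (x ^+ r * \prod_(i < l) (x - (q ^+ i)%:A)).
  by rewrite big_ord_recr /= !mulrBr -comm -!scalerAr mulr1 mulrA -exprSr.
elim: m i j => [|m IHm] i j.
  rewrite /pa big_ord0 mulr1; elim: n i j => [|n IHn] i j.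
    rewrite /pb big_ord0 mulr1 -/(nik_monom e0 e1 a b g k i j eps) tau_monom.
    exact: rpred_nat.
  rewrite /pb shift -/(pb n).
  by rewrite !(mulrBr, mulrBl) tauB -!scalerAr -scalerAl tauZ rpredB ?rpredM ?rpredX ?IHn.
rewrite /pa shift -/(pa m).
by rewrite !(mulrBr, mulrBl) tauB -!(scalerAl, scalerAr) tauZ rpredB ?rpredM ?rpredX ?IHm.
Qed.

Let TE_newton x : M x -> L0 (TE x).
Proof.
elim=> [u v _ hu _ hv|s u hs _ hu|k m n eps].
- by rewrite TE_D; exact: (RsubalgD L0R).
- by have [k [l e]] := L0P hs; rewrite e TE_scal -e; exact: (RsubalgM L0R).
have [mp|mp] := leqP p m.
  rewrite (newton_big c (@qrootC _ H' c) (os_zV_prim S) (nik_ap NB) mp) mul0r mulr0 mul0r.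
  by rewrite TE0; exact: (Rsubalg0 L0R).
have [np|np] := leqP p n.
  rewrite (newton_big c (@qrootC _ H' c) (os_zV_prim S) (nik_bp NB) np) mulr0 mulr0 mul0r.
  by rewrite TE0; exact: (Rsubalg0 L0R).
rewrite !newtonE; try exact: qrootC.
set ti := c^-1 *: t.
have tiC y : ti * y = y * ti by rewrite /ti -scalerAl qrootC scalerAr.
have ioP y l : \prod_(i < l) (io y - (q ^+ i)%:A) = io (\prod_(i < l) (y - (q ^+ i)%:A)).
  elim: l => [|l IH]; first by rewrite !big_ord0 grade_emb1.
  rewrite !big_ord_recr /= (grade_embM _ c0) IH; congr (_ * _).
  have ioN u : io (- u) = - io u by rewrite -!scaleN1r grade_embZ.
  by rewrite grade_embD ioN grade_embZ grade_emb1.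
have tiX l y : ti ^+ l * y = y * ti ^+ l.
  by elim: l => [|l IH]; rewrite ?mul1r ?mulr1 // exprS -mulrA IH mulrA tiC -mulrA.
rewrite !ioP; set h := (if k then e1 else e0) * ((\prod_(i < m) (a - (q ^+ i)%:A)) * (\prod_(i < n) (b - (q ^+ i)%:A))) * g ^+ eps.
have -> : (if k then io e1 else io e0) * (ti ^+ m * io (\prod_(i < m) (a - (q ^+ i)%:A)) *
    (ti ^+ n * io (\prod_(i < n) (b - (q ^+ i)%:A)))) * io g ^+ eps = ti ^+ (m + n) * io h.
  rewrite /h !(grade_embM _ c0) (grade_embX _ c0) (fun_if io).
  set P := io (\prod_(i < m) _); set Q := io (\prod_(i < n) _); set E := if k then io e1 else io e0.
  have -> : ti ^+ m * P * (ti ^+ n * Q) = ti ^+ (m + n) * (P * Q).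
    by rewrite -mulrA [P * (ti ^+ n * _)]mulrA -tiX exprD !mulrA.
  by rewrite [E * (ti ^+ _ * _)]mulrA -tiX -!mulrA.
have -> : TE (ti ^+ (m + n) * io h) = ti ^+ (m + n) * TE (io h).
  have [k' [l ->]] : exists k' l, ti ^+ (m + n) = mk k'%:A l%:A.
    elim: (m + n)%N => [|j [k' [l e]]]; first by exists 1, 0; rewrite scale1r scale0r.
    exists (c^-1 * (c * l)), (c^-1 * k').
    by rewrite exprS e /ti -scalerAl qrootM mkqZ !scalerA mulrA.
  exact: TE_scal.
have -> : TE (io h) = (c ^+ p.-1)%:A * (tau h)%:A.
  rewrite /TE /grade_emb /= /T tauB nik_trace_odd subr0 tauZ nik_trace_odd !mulr0 scale0r.
  by rewrite -scalerAl mul1r scalerA -mkq1 mkqZ scaler0.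
rewrite mulrA; apply: (RsubalgM L0R); last by apply: (Rsubalg_scalar L0R); exact: tau_newton.
have tt : t ^+ 2 = c%:A by rewrite expr2; exact: qroot_sqr.
have tti : t * ti = 1 by rewrite /ti -scalerAr qroot_sqr scalerA mulVf // scale1r.
have -> : (c ^+ p.-1)%:A = t ^+ (2 * p.-1) :> B.
  rewrite exprM tt; elim: (p.-1) => [|j IH]; first by rewrite scale1r.
  by rewrite !exprS -IH -scalerAl mul1r scalerA.
have tX l j : t ^+ (l + j) * ti ^+ j = t ^+ l.
  elim: j => [|j IH]; first by rewrite addn0 mulr1.
  by rewrite addnS exprSr exprS -mulrA [t * _]mulrA tti mul1r.
have mn : (m + n <= 2 * p.-1)%N by have := p_gt0; lia.
by rewrite tiX; have := tX (2 * p.-1 - (m + n))%N (m + n)%N; rewrite subnK // => ->; apply: (RsubalgX L0R).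
Qed.

(** The spanning elements have traces with denominator at most t^(2 p - 2) = c^(p - 1), by
the normalization of the newton products. *)
Lemma nik_order_trace x : X x -> c ^+ p.-1 * tau x \in R.
Proof.
move=> hx; have Xx : Xd x.
  apply: (hx Xd XdR).
  - by apply: Xd_even => [|m]; [exact: nik_Ge0 N|exact: (newton_span_e0 L0R L0C NB)].
  - by apply: Xd_even => [|m]; [exact: nik_Ge1 N|exact: (newton_span_e1 L0R L0C NB)].
  - by apply: Xd_even => [|m]; [exact: nik_Gg N|apply: (newton_span_g L0C _ NB); exact: qrootC].
  - apply: Xd_near; [exact: nik_Ga N|exact: nik_ap NB|].
    by move=> m; apply: (newton_span_a L0R L0C _ L0t NB qX1c); exact: qrootC.
  apply: Xd_near; [exact: nik_Gb N|exact: nik_bp NB|].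
  move=> m; apply: (newton_span_b L0R L0C c0 _ (qroot_sqr H' c) L0t z_prim NB _ qX1c); first exact: qrootC.
  exact: (os_zV_in S).
have := TE_newton (Xx 1 (newton_span1 L0 c t NB)).
rewrite mulr1 /TE /=.
have -> : T 0 = 0 by rewrite /T tau0 mulr0.
rewrite scale0r => /(lat_base c delta Y0R)[r hr].
move/eqP; rewrite -subr_eq0 -scalerBl scaler_eq0 oner_eq0 orbF subr_eq0 => /eqP e.
by have -> : c ^+ p.-1 * tau x = r by exact: e.
Qed.

End TraceIntegral.

(** * Dual bases *)

Section DualBasis.
Variables (K : fieldType) (R : subringClosed K) (p : nat) (z c delta mu : K).
Hypothesis S : order_scalars R p z c delta mu.
Variables (H : hopfAlgebra K) (G : grading H) (e0 e1 a b g : H).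
Hypothesis N : nik_hopf p z G e0 e1 a b g.
Local Notation H' := (nik_form S N).
Local Notation TT := (tensor H' H').
Local Notation X := (nik_order (S:=S) (N:=N)).
Local Notation Y2 := (nik_order2 (S:=S) (N:=N)).
Local Notation io := (grade_emb G c : H -> quad H' c).
Local Notation te := (tens_emb (os_c S) (nik_comult_odd N) (nik_counit_odd N)
  (nik_antipode_odd N) : tensor H H -> quad TT c).
Local Notation nr Y := (near1 (lat delta Y) (qroot _ c)).
Local Notation q := z^-1.
Local Notation mon := (nik_monom e0 e1 a b g).
Local Notation tw := (tens_twist G c : tensor H H -> TT).
Variable tau : H -> K.
Hypothesis tau_lin : scalar tau.
Hypothesis tau_monom : forall k i j eps,
  tau (mon k i j eps) = [&& (p %| i)%N, (p %| j)%N & ~~ eps]%:R.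

Let XR := nik_order_Rsubalg S N.
Let YR := nik_order2_Rsubalg S N.
Let c0 := os_c S.
Let z_prim := os_prim S.
Let z0 := prim_neq0 z_prim.
Let p_gt0 := prim_order_gt0 z_prim.
Let LR : Rsubalg R (lat delta Y2 : quad TT c -> Prop) := os_lat S YR.

Let tauD x y : tau (x + y) = tau x + tau y.
Proof. by have := tau_lin 1 x y; rewrite scale1r mul1r. Qed.
Let tau0 : tau 0 = 0.
Proof. by have := tauD 0 0; rewrite addr0 => /eqP; rewrite -subr_eq0 opprD addrA subrr sub0r oppr_eq0 => /eqP. Qed.
Let tauZ k x : tau (k *: x) = k * tau x.
Proof. by have := tau_lin k x 0; rewrite addr0 tau0 addr0. Qed.
Let tau_odd x : homog G true x -> tau x = 0.
Proof. by move=> hx; rewrite -hx (nik_trace_odd S N tau_lin tau_monom). Qed.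

(* Contraction of the second factor against x. *)
Let C (x : H) (s : tensor H H) : H := tlift (fun u v : H => tau (v * x) *: u) s.
Let C' (x : H') (s : TT) : H' := tlift (fun u v : H' => tau (v * x) *: u) s.

Let Cb x : bilin (fun u v : H => tau (v * x) *: u).
Proof.
apply: bilinP => [k u u' v|k u v v'].
  by rewrite scalerDr !scalerA mulrC.
by rewrite mulrDl -scalerAl tau_lin scalerDl scalerA.
Qed.
Let C'b (x : H') : bilin (fun u v : H' => tau (v * x) *: u).
Proof.
apply: bilinP => [k u u' v|k u v v'].
  by rewrite scalerDr !scalerA mulrC.
by rewrite mulrDl -scalerAl tau_lin scalerDl scalerA.
Qed.
Let CE x u v : C x (u ⊗ v) = tau (v * x) *: u. Proof. exact: (tliftE (Cb x)). Qed.
Let C'E x u v : C' x (u ⊗ v) = tau (v * x) *: u. Proof. exact: (tliftE (C'b x)). Qed.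
Let CD x s t : C x (s + t) = C x s + C x t. Proof. exact: (tlift_add (Cb x)). Qed.
Let C'D x s t : C' x (s + t) = C' x s + C' x t. Proof. exact: (tlift_add (C'b x)). Qed.
Let C'Z x k s : C' x (k *: s) = k *: C' x s. Proof. exact: (tlift_scale (C'b x)). Qed.
Let GD x y : G (x + y) = G x + G y. Proof. exact: raddfD. Qed.
Let GZ k x : G (k *: x) = k *: G x. Proof. exact: linearZZ. Qed.

Let tauG j v x : homog G j v -> tau (v * G x) = if j then tau (v * x) else 0.
Proof.
case: j => hv; last by apply: tau_odd; apply: (homogM hv (homog_odd G x)).
rewrite -{2}[x](subrK (G x)) mulrDr tauD [X in X + _]tau_odd ?add0r //.
exact: (homogM hv (homog_even G x)).
Qed.

Let tau_twist j (v x : H) : homog G j v ->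
  tau ((v : H') * (x : H') : H') = (if j then c else 1) * tau (v * x).
Proof.
move=> hv; have -> : (v : H') * (x : H') = v * x + (c - 1) *: (G v * G x) :> H by [].
rewrite tauD tauZ; move: (hv); rewrite {1}/homog => ->.
case: j hv => hv; last by rewrite mul0r tau0 mulr0 addr0 mul1r.
by rewrite (tauG x hv) mulrBl mul1r addrC subrK.
Qed.

(* The failure of the twisted contraction to agree with the original one concerns tensors
   with even first and odd second leg. *)
Let C'_twist x s : C' x (tw s) = C x s + (c - 1) *: (C (G x) s - G (C (G x) s)).
Proof.
elim/(tensor_homog_ind (G := G)): s => [s t IH IH'|i j u v hu hv].
  rewrite tens_twistD C'D IH IH' !CD GD opprD addrACA -scalerDr.
  by congr (_ + _ *: _); rewrite addrACA.
rewrite (tens_twistE c hu hv) C'Z C'E (tau_twist x hv) !CE (tauG x hv) GZ hu.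
rewrite /twist_coef; case: i j {hu hv} => -[] /=.
- by rewrite subrr scaler0 addr0 scalerA mulrA mulVf // mul1r.
- by rewrite scale0r subrr scaler0 addr0 scale1r mul1r.
- by rewrite scaler0 subr0 scale1r -scalerA -[X in X + _]scale1r -scalerDl addrC subrK.
by rewrite !scale0r subrr scaler0 addr0 scale1r mul1r.
Qed.

Let C_odd x s : C x (tens_odd G s) = C (G x) s + G (C x s) - 2%:R *: G (C (G x) s).
Proof.
elim/(tensor_homog_ind (G := G)): s => [s t IH IH'|i j u v hu hv].
  by rewrite tens_oddD (CD x (tens_odd G s)) IH IH' !CD !GD scalerDr opprD addrACA [in RHS](addrACA (C (G x) s)).
have := homog_tens hu hv; rewrite /homog /= => ->.
rewrite !CE (tauG x hv) !GZ hu; case: i j {hu hv} => -[] /=.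
- by rewrite /C (linear_f0 (tlift_linear (Cb x))) scaler_nat mulr2n subrr.
- by rewrite CE scale0r add0r scaler0 subr0.
- by rewrite CE scaler0 addr0 scaler0 subr0.
by rewrite /C (linear_f0 (tlift_linear (Cb x))) scale0r add0r !scaler0 subr0.
Qed.

Let C_sum x (I : Type) (r : seq I) (P : pred I) (F : I -> tensor H H) :
  C x (\sum_(i <- r | P i) F i) = \sum_(i <- r | P i) C x (F i).
Proof.
elim/big_rec2: _ => [|i s t _ <-]; last exact: CD.
exact: (linear_f0 (tlift_linear (Cb x))).
Qed.

Let e (k : bool) := if k then e1 else e0.
(* The dual of e_k a^i b^j is e_k b^-j a^-i, here written with positive exponents. *)
Let dual k i j : H :=
  (if k then q ^+ (i * j) else 1) *: (e k * (a ^+ (p.-1 * i) * b ^+ (p.-1 * j))).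
Let OB : tensor H H := \sum_(k : bool) \sum_(i < p) \sum_(j < p) mon k i j false ⊗ dual k i j.
Let O : tensor H H := OB + (1 ⊗ g) * OB * (g ⊗ 1).

Let dvd_sub i i' : (i < p)%N -> (i' < p)%N -> (p %| p.-1 * i + i')%N = (i == i').
Proof.
move=> hi hi'; apply/idP/eqP=> [h|->]; last by rewrite -mulSnr prednK // dvdn_mulr.
have E : (p.-1 * i + i' + i = p * i + i')%N by rewrite -{2}(prednK p_gt0) mulSn; lia.
have : (i' = i %[mod p])%N.
  by rewrite -[LHS](modnMDl i) [(i * p)%N]mulnC -E -modnDml (eqP h) add0n.
by rewrite !modn_small.
Qed.

Let tau_dual k i j k' i' j' eps : (i < p)%N -> (j < p)%N -> (i' < p)%N -> (j' < p)%N ->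
  tau (dual k i j * mon k' i' j' eps) = [&& k == k', i == i', j == j' & ~~ eps]%:R.
Proof.
move=> hi hj hi' hj'; rewrite /dual -scalerAl tauZ.
have e_mon : e k * (a ^+ (p.-1 * i) * b ^+ (p.-1 * j)) * mon k' i' j' eps
    = a ^+ (p.-1 * i) * (b ^+ (p.-1 * j) * (e k * mon k' i' j' eps)).
  by rewrite -!mulrA /e; case: (k); rewrite !mulrA (commX_l (nik_e1a N), commX_l (nik_e0a N));
    rewrite -!mulrA; congr (_ * _); rewrite !mulrA (commX_l (nik_e1b N), commX_l (nik_e0b N)).
rewrite e_mon.
have -> : e k * mon k' i' j' eps = if k == k' then mon k i' j' eps else 0.
  by rewrite /e; case: (k); rewrite ?(nik_monom_e1 N) ?(nik_monom_e0 N); case: (k').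
case: eqP => [_|_]; last by rewrite !mulr0 tau0 mulr0.
have aX n i2 j2 : a ^+ n * mon k i2 j2 eps = mon k (n + i2) j2 eps.
  elim: n => [|n IH]; first by rewrite mul1r.
  by rewrite exprS -mulrA IH (nik_monom_a N).
have bX n i2 j2 : b ^+ n * mon k i2 j2 eps = (if k then q ^+ (i2 * n) else 1) *: mon k i2 (n + j2) eps.
  elim: n => [|n IH]; first by rewrite mul1r muln0 expr0; case: (k); rewrite scale1r.
  rewrite exprS -mulrA IH -scalerAr (nik_monom_b N z0).
  by case: (k); rewrite ?scalerA // -exprD mulnS addnC.
rewrite bX -scalerAr aX tauZ tau_monom !dvd_sub //= mulrA.
case: eqP => [<-|_]; last by rewrite mulr0.
case: eqP => [_|_]; last by rewrite mulr0.
case: (k); last by rewrite !mul1r.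
rewrite -exprD -mulnDr -mulSn prednK // mulnCA exprM exprVn (prim_expr_order z_prim).
by rewrite invr1 expr1n mul1r.
Qed.

Let C_OB k' i' j' eps : (i' < p)%N -> (j' < p)%N ->
  C (mon k' i' j' eps) OB = if eps then 0 else mon k' i' j' false.
Proof.
move=> hi' hj'; rewrite /OB C_sum (bigD1 k') //= C_sum (bigD1 (Ordinal hi')) //=.
rewrite C_sum (bigD1 (Ordinal hj')) //= CE tau_dual // !eqxx /=.
rewrite big1 ?addr0 => [|j nj]; last first.
  by rewrite CE tau_dual // !eqxx /= (_ : (_ == j') = false) ?scale0r //; apply/negbTE.
rewrite big1 ?addr0 => [|i ni]; last first.
  rewrite C_sum big1 // => j _.
  by rewrite CE tau_dual // !eqxx /= (_ : (_ == i') = false) ?scale0r //; apply/negbTE.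
rewrite big1 ?addr0 => [|k nk]; last first.
  rewrite C_sum big1 // => i _; rewrite C_sum big1 // => j _.
  by rewrite CE tau_dual // (negbTE nk) scale0r.
by case: eps; rewrite ?scale0r ?scale1r.
Qed.

Let mon_g k i j eps : mon k i j eps * g = mon k i j (~~ eps).
Proof.
rewrite /nik_monom -mulrA; congr (_ * _).
by case: eps; rewrite /= ?expr0 ?expr1 ?mul1r // (nik_gg N).
Qed.

Let tau_g x : tau (g * x) = tau (x * g).
Proof.
elim/(nik_span_ind N z0 (nik_gen N)): x => [x y IH IH'|k x IH|k i j eps].
- by rewrite mulrDr mulrDl !tauD IH IH'.
- by rewrite -scalerAr -scalerAl !tauZ IH.
by rewrite mon_g (nik_monom_g N); case: k; rewrite !tau_monom // andbCA.
Qed.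

Let C_g x s : C x ((1 ⊗ g) * s * (g ⊗ 1)) = C (x * g) (s * (g ⊗ 1)).
Proof.
elim/tensor_ind: s => [u v|s t IH IH'].
  by rewrite !tensM mul1r !CE !mulr1 -mulrA tau_g !mulrA.
by rewrite mulrDr !mulrDl !CD IH IH'.
Qed.

Let C_gr x s : C x (s * (g ⊗ 1)) = C x s * g.
Proof.
elim/tensor_ind: s => [u v|s t IH IH'].
  by rewrite !tensM !CE mulr1 scalerAl.
by rewrite mulrDl !CD IH IH' mulrDl.
Qed.

Let C_x s x y : C (x + y) s = C x s + C y s.
Proof.
elim/tensor_ind: s => [u v|s t IH IH'].
  by rewrite !CE mulrDr tauD scalerDl.
by rewrite !CD IH IH' addrACA.
Qed.

Let C_xZ s k x : C (k *: x) s = k *: C x s.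
Proof.
elim/tensor_ind: s => [u v|s t IH IH'].
  by rewrite !CE -scalerAr tauZ scalerA.
by rewrite !CD IH IH' scalerDr.
Qed.

(* O is the Casimir element of the trace form of H. *)
Let C_O x : C x O = x.
Proof.
elim/(nik_span_ind N z0 (nik_gen N)): x => [x y IH IH'|k x IH|k i j eps].
- by rewrite C_x IH IH'.
- by rewrite C_xZ IH.
rewrite (nik_monom_modp N); set i' := (i %% p)%N; set j' := (j %% p)%N.
have hi : (i' < p)%N by rewrite ltn_mod.
have hj : (j' < p)%N by rewrite ltn_mod.
rewrite /O CD C_g C_gr mon_g !C_OB //; case: eps; rewrite /= ?mul0r ?addr0 ?add0r //.
Qed.

Let E00 : tensor H H := e0 ⊗ e0.
Let E11 : tensor H H := e1 ⊗ e1.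
Let xa : tensor H H := a ⊗ a ^+ p.-1.
Let xb : tensor H H := b ⊗ b ^+ p.-1.

(* The two block components of the Casimir element are a product of geometric sums and p
   times a canonical element. *)
Let OB_E : OB = p%:R *: (E11 * rmat p z xa xb)
  + E00 * ((\sum_(i < p) xa ^+ i) * (\sum_(j < p) xb ^+ j)).
Proof.
have pure i j : xa ^+ i * xb ^+ j
    = (a ^+ i * b ^+ j) ⊗ (a ^+ (p.-1 * i) * b ^+ (p.-1 * j)).
  by rewrite !tensMX tensM -!exprM.
rewrite /OB big_bool; congr (_ + _).
  rewrite /rmat -scalerAr scalerA mulfV ?(os_p S) // scale1r mulr_sumr; apply: eq_bigr => i _.
  rewrite mulr_sumr; apply: eq_bigr => j _.
  by rewrite -scalerAr pure tensM /dual /nik_monom expr0 mulr1 tensZr.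
rewrite mulr_suml mulr_sumr; apply: eq_bigr => i _.
rewrite !mulr_sumr; apply: eq_bigr => j _.
by rewrite pure tensM /dual /nik_monom expr0 mulr1 scale1r.
Qed.

Let ioX h n : nr X (io h) -> nr X (io (h ^+ n)).
Proof. by rewrite (grade_embX _ c0) => hx; exact: (os_near1X S XR n hx). Qed.

Let OB_in : lat delta Y2 ((c ^+ p.-1)^-1 *: te OB).
Proof.
have na : nr X (io a) := nik_order_a S N.
have nb : nr X (io b) := nik_order_b S N.
have nxa : nr Y2 (te xa) by apply: nik_near_tens => //; exact: ioX.
have nxb : nr Y2 (te xb) by apply: nik_near_tens => //; exact: ioX.
rewrite OB_E tens_embD scalerDr; apply: (RsubalgD LR).
  rewrite tens_embZ scalerA mulrC; apply: (RsubalgZ LR); first exact: (os_p_c S).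
  apply: nik_rmat_tens => //.
  - by apply: nik_even_tens; rewrite ?(nik_Ge1 N) //; exact: nik_order_e1.
  - by rewrite tensM (nik_e11 N).
  - by rewrite !tensM (nik_e1a N) (commX_l (nik_e1a N)).
  - by rewrite !tensM (nik_e1b N) (commX_l (nik_e1b N)).
  by rewrite tensMX -exprM mulnC exprM (nik_bp N) expr1n tens1 mulr1.
rewrite tens_embM scalerAr; apply: (RsubalgM LR).
  by apply: nik_even_tens; rewrite ?(nik_Ge0 N) //; exact: nik_order_e0.
have teX (s : tensor H H) n : te (\sum_(i < n) s ^+ i) = \sum_(i < n) te s ^+ i.
  by rewrite tens_emb_sum; apply: eq_bigr => i _; exact: tens_embX.
by rewrite tens_embM !teX; exact: (os_geom S YR).
Qed.

(** The Casimir element of the trace form c^(p-1) tau: on the first block the factor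
c^(1-p) is absorbed by the geometric sums, on the second block by p, the canonical element
being integral. Its transport to the twist has the same contraction property because the
part of odd total degree contracts to zero. *)
Lemma nik_order_dual : exists r : seq (H' * H'),
  (forall u, List.In u r -> X u.1 /\ X u.2) /\
  forall x : H', x = \sum_(u <- r) (c ^+ p.-1 * tau (u.2 * x)) *: u.1.
Proof.
have O_in : lat delta Y2 ((c ^+ p.-1)^-1 *: te O).
  rewrite /O tens_embD scalerDr; apply: (RsubalgD LR); first exact: OB_in.
  rewrite !tens_embM scalerAl scalerAr; apply: (RsubalgM LR).
    apply: (RsubalgM LR); last exact: OB_in.
    by apply: nik_even_tens; [exact: homog1|exact: nik_Gg N|exact: (Rsubalg1 XR)|exact: nik_order_g].
  by apply: nik_even_tens; [exact: nik_Gg N|exact: homog1|exact: nik_order_g|exact: (Rsubalg1 XR)].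
case: O_in => _ /=.
set D := (X in Y2 X) => -[r [hr Dr]]; exists r; split=> // x.
have C'r : C' x D = \sum_(u <- r) tau (u.2 * x) *: u.1.
  rewrite Dr; elim: (r) => [|u r' IH]; last by rewrite !big_cons C'D C'E IH.
  by rewrite !big_nil; exact: (linear_f0 (tlift_linear (C'b x))).
transitivity (c ^+ p.-1 *: C' x D); last first.
  by rewrite C'r scaler_sumr; apply: eq_bigr => u _; rewrite scalerA.
have Co y : C y (tens_odd G O) = 0.
  rewrite C_odd !C_O scaler_nat mulr2n.
  have -> : G (G y) = G y by exact: odd_partK.
  by rewrite subrr.
have C'o : C' x (tw (tens_odd G O)) = 0.
  rewrite C'_twist !Co; have -> : G 0 = 0 by exact: linear0.
  by rewrite subrr scaler0 addr0.
have C'e : C' x (tw (O - tens_odd G O)) = x.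
  have := C'D x (tw (O - tens_odd G O)) (tw (tens_odd G O)).
  rewrite C'o addr0 -tens_twistD subrK => <-.
  rewrite C'_twist !C_O; have -> : G (G x) = G x by exact: odd_partK.
  by rewrite subrr scaler0 addr0.
have -> : D = (c ^+ p.-1)^-1 *: tw (O - tens_odd G O)
  + (- (c * delta)) *: ((c ^+ p.-1)^-1 *: (c^-1 *: tw (tens_odd G O))) by rewrite scaleNr.
rewrite C'D !C'Z C'e C'o !scaler0 addr0 scalerA mulfV ?scale1r //.
exact: expf_neq0.
Qed.

End DualBasis.

(** * Hopf orders from dual bases *)

Section DualBasisModule.
Variables (R : comNzRingType) (M : lmodType R) (m : nat) (b : 'I_m -> M) (phi : 'I_m -> M -> R).
Hypothesis phi_lin : forall i, scalar (phi i).
Hypothesis phi_dual : forall x, x = \sum_i phi i x *: b i.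

Lemma dual_finitely_generated : finitely_generated M.
Proof. by exists m, b => x; exists (phi^~ x); exact: phi_dual. Qed.

(** Coordinates lift along a surjection as soon as the images of the generators do. *)
Lemma dual_projective : projective M.
Proof.
move=> N N' g f surj.
have [y yE] := choice (fun i => surj (f (b i))).
pose h x := \sum_i phi i x *: y i.
have hL : linear h.
  move=> k u v; rewrite /h scaler_sumr -big_split; apply: eq_bigr => i _.
  by rewrite phi_lin scalerDl scalerA.
pose hh : {linear M -> N} := HB.pack h (GRing.isLinear.Build R M N *:%R h hL).
exists hh => x; rewrite [in RHS](phi_dual x) !linear_sum; apply: eq_bigr => i _.
by rewrite !linearZ /= yE.
Qed.

End DualBasisModule.

Section DualBasisOrder.
Variables (K : fieldType) (H : hopfAlgebra K) (R : subringClosed K).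
Variable X : submodClosed (over_subring R H).
Variables (m : nat) (b : 'I_m -> submodule X) (phi : 'I_m -> H -> K).
Hypothesis phi_lin : forall i, scalar (phi i).
Hypothesis phi_in : forall i (x : H), x \in X -> phi i x \in R.
Hypothesis phi_dual : forall y : H, y = \sum_i phi i y *: (\val (b i) : H).

Let phiR i (x : submodule X) : subring R := Sub (phi i (\val x)) (phi_in i (valP x)).

Let phiR_lin i : scalar (phiR i).
Proof. by move=> k u v; apply: val_inj; exact: phi_lin. Qed.

Let phiR_dual x : x = \sum_i phiR i x *: b i.
Proof.
apply: val_inj; rewrite [LHS]phi_dual raddf_sum /=.
by apply: eq_bigr.
Qed.

Lemma dual_order_projective : finitely_generated (submodule X) /\ projective (submodule X).
Proof.
split; first exact: dual_finitely_generated phiR_dual.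
exact: dual_projective phiR_lin phiR_dual.
Qed.

Let fb : bilin (fun (x : submodule X) (k : over_subring R K^o) =>
           (k : K) *: (\val x : H) : over_subring R H).
Proof.
apply: bilinP => [r x x' k|r x k k'].
  transitivity ((k : K) *: ((\val r : K) *: (\val x : H) + (\val x' : H))) => //.
  by rewrite scalerDr scalerA mulrC -scalerA.
transitivity (((\val r : K) * (k : K) + (k' : K)) *: (\val x : H)) => //.
by rewrite scalerDl -scalerA.
Qed.

(** The inverse sends y to the sum of the b_i ⊗ phi_i(y), for the K-linear extensions of the
coordinates. *)
Lemma dual_order_bijective : bijective (@order_to_hopf K H R X).
Proof.
pose inv (y : H) : tensor (submodule X) (over_subring R K^o) :=
  \sum_i b i ⊗ (phi i y : over_subring R K^o).
have fE (x : submodule X) (k : over_subring R K^o) : order_to_hopf (x ⊗ k) = (k : K) *: (\val x : H). 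
  by have E := tliftE fb x k; exact: E.
have fD (s t : tensor (submodule X) (over_subring R K^o)) :
    order_to_hopf (s + t) = order_to_hopf s + order_to_hopf t.
  by have E := tlift_add fb s t; exact: E.
have phiD i x y : phi i (x + y) = phi i x + phi i y.
  by have := phi_lin i 1 x y; rewrite scale1r mul1r.
have phi0 i : phi i 0 = 0.
  by have := phiD i 0 0; rewrite addr0 => /eqP; rewrite -subr_eq0 opprD addrA subrr sub0r oppr_eq0 => /eqP.
have phiZ i k x : phi i (k *: x) = k * phi i x.
  by have := phi_lin i k x 0; rewrite !addr0 phi0 addr0.
exists inv => [t|y]; last first.
  rewrite [RHS]phi_dual /inv.
  elim/big_rec2: _ => [|i u v _ <-]; last by rewrite fD fE.
  exact: (linear_f0 (tlift_linear fb)).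
elim/tensor_ind: t => [x k|s t IH IH']; last first.
  rewrite fD -{2}IH -{2}IH' /inv -big_split; apply: eq_bigr => i _ /=.
  by rewrite phiD tensDr.
rewrite fE /inv [in RHS](phiR_dual x) tens_suml; apply: eq_bigr => i _.
rewrite tensZl -tensZr; congr (_ ⊗ _).
by rewrite phiZ mulrC.
Qed.

End DualBasisOrder.

Section SubalgebraPred.
Variables (K : fieldType) (R : subringClosed K) (H : hopfAlgebra K) (Y : H -> Prop).

(* The proof is an argument so that the closure instance can be found. *)
Definition rsub_pred (YR : Rsubalg R Y) : {pred over_subring R H} := fun x => `[< Y x >].

Variable YR : Rsubalg R Y.

Fact rsub_submod_closed : GRing.submod_closed (rsub_pred YR).
Proof.
split=> [|r u v /asboolP hu /asboolP hv]; apply/asboolP; first exact: (Rsubalg0 YR).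
by apply: (RsubalgD YR) => //; apply: (RsubalgZ YR) => //; exact: valP.
Qed.

HB.instance Definition _ :=
  GRing.isSubmodClosed.Build (subring R) (over_subring R H) (rsub_pred YR) rsub_submod_closed.

End SubalgebraPred.

Section NikHopfOrder.
Variables (K : fieldType) (R : subringClosed K) (p : nat) (z c delta mu : K).
Hypothesis S : order_scalars R p z c delta mu.
Variables (H : hopfAlgebra K) (G : grading H) (e0 e1 a b g : H).
Hypothesis N : nik_hopf p z G e0 e1 a b g.
Local Notation H' := (nik_form S N).
Local Notation X := (nik_order (S:=S) (N:=N)).
Variable tau : H -> K.
Hypothesis tau_lin : scalar tau.
Hypothesis tau_monom : forall k i j eps,
  tau (nik_monom e0 e1 a b g k i j eps) = [&& (p %| i)%N, (p %| j)%N & ~~ eps]%:R.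

Theorem nik_hopf_order :
  exists X' : submodClosed (over_subring R H'), hopf_order X'.
Proof.
pose XR := nik_order_Rsubalg S N.
pose X' : submodClosed (over_subring R H') := rsub_pred XR.
exists X'.
have XP x : (x \in X') <-> X x by split=> [/asboolP|hx]; [|apply/asboolP].
have [r [hr dual]] := nik_order_dual S N tau_lin tau_monom.
pose d : H' * H' := (0, 0).
have hd i : X (nth d r i).1 /\ X (nth d r i).2.
  elim: r hr i {dual} => [|u r IH] hr [|i] /=; try by split; exact: (Rsubalg0 XR).
    by apply: hr; left.
  by apply: IH => v hv; apply: hr; right.
have bP i : (nth d r i).1 \in X' by apply/XP; case: (hd i).
pose bb (i : 'I_(size r)) : submodule X' := Sub (nth d r i).1 (bP i).
pose phi (i : 'I_(size r)) (x : H') : K := c ^+ p.-1 * tau ((nth d r i).2 * x).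
have phi_lin i : scalar (phi i).
  move=> k u v; rewrite /phi mulrDr -scalerAr tau_lin mulrDr; congr (_ + _).
  by rewrite mulrCA.
have phi_in i (x : H') : x \in X' -> phi i x \in R.
  move=> /XP hx; apply: (nik_order_trace tau_lin tau_monom).
  by apply: (RsubalgM XR) => //; case: (hd i).
have phi_dual (y : H') : y = \sum_i phi i y *: (\val (bb i) : H').
  by rewrite [LHS]dual (big_nth d) big_mkord.
split; first exact: (dual_order_projective phi_lin phi_in phi_dual).
split; first exact: (dual_order_bijective phi_lin phi_in phi_dual).
- by apply/XP; exact: (Rsubalg1 XR).
- by move=> x y /XP hx /XP hy; apply/XP; exact: (RsubalgM XR).
split=> [x /XP hx|x /XP hx|x /XP hx].
- have fb : bilin (fun x y : submodule X' =>
      (\val x : H') ⊗ (\val y : H') : over_subring R (tensor H' H')).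
    apply: bilinP => k u u' v; rewrite linearP /=.
      by rewrite [in LHS]tensDl; congr (_ + _); exact: tensZl.
    by rewrite [in LHS]tensDr; congr (_ + _); exact: tensZr.
  have := nik_order_comult hx; move: (comult H' x).
  apply: nik_order2_ind => [_ _ [s ->] [t ->]|u v hu hv].
    by exists (s + t); apply: esym; exact: (tlift_add fb).
  have hu' : u \in X' by apply/XP.
  have hv' : v \in X' by apply/XP.
  exists ((Sub u hu' : submodule X') ⊗ (Sub v hv' : submodule X')).
  by apply: esym; exact: (tliftE fb).
- exact: nik_order_counit.
by apply/XP; exact: nik_order_antipode.
Qed.

End NikHopfOrder.

(** * Integral closedness of cyclotomic integers at 2 *)

Section TwoAdic.
Variables (K : fieldType) (n : nat) (zn : K).
Hypothesis n_gt0 : (0 < n)%N.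
Hypothesis zn_prim : n.-primitive_root zn.
Hypothesis two_neq0 : 2%:R != 0 :> K.
Local Notation R := (int_adjoin zn).

Let zn_in : zn \in R.
Proof. by apply/asboolP; exists 'X; rewrite map_polyX hornerX. Qed.

Let R_ind (P : K -> Prop) : P 1 -> (forall x, P x -> P (- x)) ->
  (forall x y, P x -> P y -> P (x + y)) -> (forall x y, P x -> P y -> P (x * y)) -> P zn ->
  forall x, x \in R -> P x.
Proof.
move=> P1 PN PD PM Pzn x /asboolP[f ->]; elim/poly_ind: f => [|f k IH].
  by rewrite rmorph0 horner0 -(subrr 1); apply: (PD) => //; exact: PN.
rewrite rmorphD rmorphM /= map_polyX map_polyC hornerD hornerM hornerX hornerC.
apply: (PD); first exact: PM.
have P0 : P 0 by rewrite -(subrr 1); apply: (PD) => //; exact: PN.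
have Pn j : P j%:R by elim: j => [|j IHj] //; rewrite mulrSr; exact: PD.
by case: k => j; rewrite /= ?NegzE ?rmorphN; [exact: Pn|apply: PN; exact: Pn].
Qed.

Definition dvd_in (u x : K) : Prop := exists2 r, r \in R & x = u * r.

Let dvdD u x y : dvd_in u x -> dvd_in u y -> dvd_in u (x + y).
Proof. by move=> [r hr ->] [s hs ->]; exists (r + s); rewrite ?rpredD ?mulrDr. Qed.
Let dvdN u x : dvd_in u x -> dvd_in u (- x).
Proof. by move=> [r hr ->]; exists (- r); rewrite ?rpredN ?mulrN. Qed.
Let dvdM u x y : y \in R -> dvd_in u x -> dvd_in u (x * y).
Proof. by move=> hy [r hr ->]; exists (r * y); rewrite ?rpredM ?mulrA. Qed.
Let two_in : 2%:R \in R. Proof. exact: rpred_nat. Qed.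

Let frob2 s x y : x \in R -> y \in R ->
  exists2 r, r \in R & (x + y) ^+ (2 ^ s) = x ^+ (2 ^ s) + y ^+ (2 ^ s) + 2%:R * r.
Proof.
move=> hx hy; elim: s => [|s [r hr IH]]; first by exists 0; rewrite ?rpred0 // !expr1 mulr0 addr0.
rewrite expnSr !exprM IH; set A := x ^+ (2 ^ s); set B := y ^+ (2 ^ s).
exists (A * B + 2%:R * r * (A + B + r)); last by ring.
have hA : A \in R by exact: rpredX.
have hB : B \in R by exact: rpredX.
have hAB : A + B \in R by exact: rpredD.
by apply: rpredD; [exact: rpredM|apply: rpredM; [exact: rpredM|exact: rpredD]].
Qed.

(** A uniformizer at 2: 1 - zeta for zeta a root of unity of order the 2-part of n, or 2
itself when n is odd. Modulo it the ring of cyclotomic integers is reduced, being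
generated by a root of unity of odd order. *)
Let uniformizer : exists u e s,
  [/\ u \in R, dvd_in 2%:R (u ^+ e), u != 0, (0 < s)%N
    & forall x, x \in R -> dvd_in u (x ^+ (2 ^ s) - x)].
Proof.
have [m' m'2 nE] := pfactor_coprime (isT : prime 2) n_gt0.
set k := logn 2 n in nE; pose s := totient m'.
have m'_gt0 : (0 < m')%N by move: n_gt0; rewrite nE muln_gt0 => /andP[].
have s_gt0 : (0 < s)%N by rewrite totient_gt0.
have [l lE] : exists l, (2 ^ s = (l * m').+1)%N.
  have h := Euler_exp_totient m'2.
  have : (m' %| 2 ^ s - 1)%N by rewrite -eqn_mod_dvd ?expn_gt0 //; apply/eqP.
  by move/dvdnP=> [l hl]; exists l; rewrite -hl; have := expn_gt0 2 s; lia.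
pose y := zn ^+ m'.
have y_in : y \in R by exact: rpredX.
have yk : y ^+ (2 ^ k) = 1 by rewrite /y -exprM -nE (prim_expr_order zn_prim).
have [u [e [u_in u2 u_e y1 u0]]] : exists u e,
    [/\ u \in R, dvd_in u 2%:R, dvd_in 2%:R (u ^+ e), dvd_in u (y - 1) & u != 0].
  case: (posnP k) => [k0|k_gt0].
    exists 2%:R, 1%N; split=> //; try by exists 1; rewrite ?rpred1 ?mulr1.
    by exists 0; rewrite ?rpred0 // mulr0; move: yk; rewrite k0 expr1 => ->; rewrite subrr.
  have ym1 : y ^+ (2 ^ k.-1) = -1.
    have : (y ^+ (2 ^ k.-1)) ^+ 2 == 1 by rewrite -exprM -expnSr prednK // yk.
    rewrite sqrf_eq1 => /orP[|/eqP //]; rewrite /y -exprM -(prim_order_dvd zn_prim).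
    move/dvdn_leq; rewrite muln_gt0 m'_gt0 expn_gt0 /= => /(_ isT).
    by rewrite {1}nE leq_pmul2l // leq_exp2l // leqNgt prednK // leqnn.
  have u2 : dvd_in (1 - y) 2%:R.
    exists (\sum_(i < 2 ^ k.-1) y ^+ i); first by rewrite rpred_sum // => i _; rewrite rpredX.
    by rewrite -opprB mulNr -subrX1 ym1; ring.
  exists (1 - y), (2 ^ k)%N; split=> //.
  - by rewrite rpredB ?rpred1.
  - have [||r hr] := @frob2 k 1 (- y); rewrite ?rpred1 ?rpredN // expr1n.
    have -> : (- y) ^+ (2 ^ k) = 1 by rewrite -[k](prednK k_gt0) expnS exprM sqrrN -exprM -expnS prednK.
    by move=> ->; exists (1 + r); [rewrite rpredD ?rpred1|ring].
  - by exists (-1); rewrite ?rpredN ?rpred1 // mulrN1 opprB.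
  apply/eqP=> u0; move: u2 => [r _]; rewrite u0 mul0r => /eqP.
  by rewrite (negbTE two_neq0).
exists u, e, s; split=> //.
suff H x : x \in R -> x \in R /\ dvd_in u (x ^+ (2 ^ s) - x) by move=> x /H[].
have u2M v : v \in R -> dvd_in u (2%:R * v) by move=> hv; apply: dvdM.
move: x; apply: R_ind => [|x [hx IH]|x y' [hx IH] [hy IH']|x y' [hx IH] [hy IH']|].
- split; first exact: rpred1.
  by exists 0; rewrite ?rpred0 // expr1n subrr mulr0.
- split; first by rewrite rpredN.
  have -> : (- x) ^+ (2 ^ s) - - x = (x ^+ (2 ^ s) - x) + 2%:R * x.
    by rewrite -[s](prednK s_gt0) expnS exprM sqrrN -exprM; ring.
  by apply: dvdD => //; exact: u2M.
- split; first by rewrite rpredD.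
  have [r hr ->] := frob2 s hx hy.
  have -> : x ^+ (2 ^ s) + y' ^+ (2 ^ s) + 2%:R * r - (x + y')
    = (x ^+ (2 ^ s) - x) + (y' ^+ (2 ^ s) - y') + 2%:R * r by ring.
  by apply: dvdD; [exact: dvdD|exact: u2M].
- split; first by rewrite rpredM.
  have -> : (x * y') ^+ (2 ^ s) - x * y'
    = (x ^+ (2 ^ s) - x) * y' ^+ (2 ^ s) + (y' ^+ (2 ^ s) - y') * x by rewrite exprMn; ring.
  by apply: dvdD; apply: dvdM => //; rewrite rpredX.
split=> //.
have -> : zn ^+ (2 ^ s) - zn = (y - 1) * ((\sum_(i < l) y ^+ i) * zn).
  by rewrite mulrA -subrX1 lE exprSr mulnC exprM -/y mulrBl mul1r.
apply: dvdM => //.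
by rewrite rpredM // rpred_sum // => i _; rewrite rpredX.
Qed.

(** A root y of a monic polynomial whose lower coefficients are divisible by the
uniformizer is nilpotent modulo it, hence divisible by it. *)
Lemma int_adjoin_closed_at2 (x : K) :
  integralOver (intr : int -> K) x -> 2%:R * x \in R -> x \in R.
Proof.
move=> [f f_monic fx] x2.
have [u [e [s [u_in u_e u0 s_gt0 frob]]]] := uniformizer.
have frobX l y : y \in R -> dvd_in u (y ^+ (2 ^ (s * l)) - y).
  move=> hy; elim: l => [|l IH].
    by exists 0; rewrite ?rpred0 // muln0 expr1 subrr mulr0.
  rewrite mulnS expnD mulnC exprM.
  have := frob _ (rpredX (2 ^ (s * l)) hy) => /dvdD/(_ IH).
  by rewrite addrA subrK.
suff step j : u ^+ j.+1 * x \in R -> u ^+ j * x \in R.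
  have : u ^+ e * x \in R by have [r hr ->] := u_e; rewrite mulrAC rpredM.
  by elim: (e) => [|j IH]; [rewrite expr0 mul1r|move/step].
move=> hy; set y := u ^+ j.+1 * x in hy.
pose d := (size f).-1.
have dE : size f = d.+1 by rewrite /d prednK // size_poly_gt0 monic_neq0.
have yd : dvd_in u (y ^+ d).
  have : (map_poly intr f).[x] = 0 :> K by exact/eqP.
  rewrite horner_coef size_map_poly_id0 ?(monicP f_monic) ?oner_eq0 // dE big_ord_recr /=.
  have -> : (map_poly intr f)`_d = 1 :> K.
    by rewrite coef_map /= -[f`_d]/(lead_coef f) (monicP f_monic).
  rewrite mul1r => /eqP; rewrite addrC addr_eq0 => /eqP xd.
  rewrite /y exprMn xd mulrN; apply: dvdN; rewrite mulr_sumr.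
  have dvd0 : dvd_in u 0 by exists 0; rewrite ?rpred0 ?mulr0.
  apply: big_ind => // [|i _]; first exact: dvdD.
  rewrite coef_map /=.
  have -> : u ^+ j.+1 ^+ d * ((f`_i)%:~R * x ^+ i) = u ^+ j.+1 ^+ (d - i) * ((f`_i)%:~R * y ^+ i).
    rewrite /y exprMn -{1}(subnK (ltnW (ltn_ord i))) exprD; ring.
  apply: dvdM; first by rewrite rpredM ?rpredX // rpred_int.
  have di : (0 < d - i)%N by rewrite subn_gt0.
  rewrite -exprM -(prednK (_ : (0 < j.+1 * (d - i))%N)) ?muln_gt0 // exprS.
  by exists (u ^+ (j.+1 * (d - i)).-1) => //; rewrite rpredX.
have dvdy : dvd_in u y.
  have dl : (d <= 2 ^ (s * d))%N.
    by apply: (leq_trans (ltnW (ltn_expl d (isT : (1 < 2)%N)))); rewrite leq_exp2l // leq_pmull.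
  have h1 : dvd_in u (y ^+ (2 ^ (s * d))) by rewrite -(subnKC dl) exprD; apply: dvdM => //; rewrite rpredX.
  have := dvdD h1 (dvdN (frobX d y hy)); by rewrite opprB addrCA subrr addr0.
have [r hr] := dvdy; rewrite /y exprS -mulrA => /(mulfI u0) ->.
by [].
Qed.

End TwoAdic.

(** * Scalars in the cyclotomic ring *)

Lemma odd_sqr_mod4 m : odd m -> exists q, (m * m = 4 * q + 1)%N.
Proof.
move=> m_odd; exists (m./2 * m./2 + m./2)%N.
have mE : (m = 2 * m./2 + 1)%N by have := odd_double_half m; rewrite m_odd; lia.
by rewrite {1 2}mE; ring.
Qed.

Section CyclotomicScalars.
Variables (p n : nat) (K : fieldExtType rat) (L : fieldExtType K).
Variables (zn zp w d : K) (t : L).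
Hypothesis p_prime : prime p.
Hypothesis p_odd : odd p.
Hypothesis n_gt0 : (0 < n)%N.
Hypothesis p_dvd_n : (p %| n)%N.
Hypothesis zn_prim : n.-primitive_root zn.
Hypothesis zp_prim : p.-primitive_root zp.
Hypothesis w_in : w \in int_adjoin zn.
Hypothesis w_unit : exists2 w', w' \in int_adjoin zn & w * w' = 1.
Hypothesis t_sqr : t ^+ 2 = (w * (zp - 1))%:A.
Hypothesis d_in : d \in int_adjoin zn.
Hypothesis dt_int : integralOver (intr : int -> L) (2%:R^-1 * (d%:A + t)).
Local Notation R := (int_adjoin zn).
Local Notation c := (w * (zp - 1)).

Lemma natr_ext_neq0 m : (0 < m)%N -> m%:R != 0 :> K.
Proof.
move=> m0; have -> : m%:R = (m%:R : rat)%:A :> K by rewrite scaler_nat.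
by rewrite scaler_eq0 oner_eq0 orbF Num.Theory.pnatr_eq0 -lt0n.
Qed.

Let two : 2%:R != 0 :> K. Proof. exact: natr_ext_neq0. Qed.
Let p_gt0 : (0 < p)%N := prime_gt0 p_prime.
Let p_gt1 : (1 < p)%N := prime_gt1 p_prime.

Let zn_in : zn \in R.
Proof. by apply/asboolP; exists 'X; rewrite map_polyX hornerX. Qed.

Let zp_in : zp \in R.
Proof.
have zpn : zp ^+ n = 1.
  by have /dvdnP[l ->] := p_dvd_n; rewrite mulnC exprM (prim_expr_order zp_prim) expr1n.
by have [i ->] := prim_rootP zn_prim zpn; rewrite rpredX.
Qed.

Let zp1 : zp - 1 != 0.
Proof. by rewrite subr_eq0 -[zp]expr1 (prim_expr_neq1 zp_prim). Qed.

Let w0 : w != 0.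
Proof. by apply/eqP=> w0; have [w' _ /eqP] := w_unit; rewrite w0 mul0r eq_sym oner_eq0. Qed.

Let wV_in : w^-1 \in R.
Proof. by have [w' hw' ww'] := w_unit; rewrite -[w^-1]mulr1 -ww' mulKf. Qed.

Let c0 : c != 0. Proof. exact: mulf_neq0. Qed.
Let c_in : c \in R. Proof. by rewrite rpredM ?rpredB ?rpred1. Qed.

(* Cyclotomic units: zp is a power of zp^i, so the quotient is a geometric sum. *)
Let zp1_zpi i : (0 < i < p)%N -> (zp - 1) / (zp ^+ i - 1) \in R.
Proof.
move=> ip; have /andP[i0 ip'] := ip.
have cop : coprime i p.
  rewrite coprime_sym prime_coprime //; apply/negP=> /dvdn_leq.
  by rewrite i0 leqNgt ip' => /(_ isT).
have zi_prim : p.-primitive_root (zp ^+ i) by rewrite (prim_root_exp_coprime _ zp_prim).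
have [j zj] := prim_rootP zi_prim (prim_expr_order zp_prim).
have n0 : zp ^+ i - 1 != 0 by rewrite subr_eq0 (prim_expr_neq1 zp_prim).
rewrite {1}zj subrX1 mulrAC divff // mul1r rpred_sum // => l _.
by rewrite !rpredX.
Qed.

Let p_zp1 : p%:R / (zp - 1) \in R.
Proof.
have -> : p%:R = \sum_(i < p) (1 - zp ^+ i) :> K.
  rewrite sumrB sumr_const card_ord.
  have := sum_prim_expr zp_prim 1; rewrite expr1 => ->.
  by rewrite ifN ?subr0 // dvdn1 neq_ltn p_gt1 orbT.
rewrite mulr_suml rpred_sum // => i _.
rewrite -opprB subrX1 mulNr mulrAC divff // mul1r rpredN rpred_sum // => l _.
by rewrite rpredX.
Qed.

Let p_c : p%:R / c \in R.
Proof. by rewrite invfM [w^-1 * _]mulrC mulrA rpredM. Qed.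

Let integralR x : x \in R -> integralOver (intr : int -> K) x.
Proof.
move=> /asboolP[f ->]; apply: integral_horner.
  by apply/integral_poly => i; rewrite coef_map; exact: integral_id.
exists ('X^n - 1); first exact: monicXnsubC.
by rewrite rmorphB /= map_polyXn rmorph1 rootE !hornerE (prim_expr_order zn_prim) subrr.
Qed.

(* The norm of (d + t) / 2 is integral at 2, hence lies in the ring of cyclotomic integers. *)
Let norm_in : (d ^+ 2 - c) / 4%:R \in R.
Proof.
set x := _ / _.
have x_int : integralOver (intr : int -> K) x.
  have d_int : integralOver (intr : int -> L) d%:A.
    have [f fm fd] := integralR d_in; exists f => //.
    have -> : map_poly intr f = map_poly (in_alg L) (map_poly intr f) :> {poly L}.
      by rewrite -map_poly_comp; apply: eq_map_poly => k; exact: esym (rmorph_int (in_alg L) k).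
    exact: rmorph_root.
  have s'_int := integral_sub d_int dt_int.
  have := integral_mul dt_int s'_int.
  have L2 : 2%:R != 0 :> L.
    by rewrite -(rmorph_nat (in_alg L)) fmorph_eq0.
  have -> : 2%:R^-1 * (d%:A + t) * (d%:A - 2%:R^-1 * (d%:A + t)) = x%:A.
    have -> : x%:A = ((d%:A) ^+ 2 - t ^+ 2) / 4%:R :> L.
      have E : in_alg L x = (in_alg L d ^+ 2 - in_alg L c) / 4%:R.
        by rewrite /x fmorph_div rmorph_nat rmorphB rmorphXn.
      by rewrite t_sqr; exact: E.
    have L4 : 4%:R != 0 :> L by rewrite (natrM _ 2 2) mulf_neq0.
    by field; rewrite L2 L4.
  move=> [f fm fx]; exists f => //.
  have : root (map_poly (in_alg L) (map_poly intr f)) (in_alg L x).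
    move: fx; congr (is_true (root _ _)).
    by rewrite -map_poly_comp; apply: eq_map_poly => k; exact: esym (rmorph_int (in_alg L) k).
  by rewrite fmorph_root.
have closed2 := int_adjoin_closed_at2 n_gt0 zn_prim two.
have x2_int : integralOver (intr : int -> K) (2%:R * x).
  by apply: integral_mul => //; exact: integral_nat.
apply: (closed2) => //; apply: (closed2) => //.
have n4 : 4%:R != 0 :> K by exact: natr_ext_neq0.
by rewrite mulrA -natrM /x mulrCA divff // mulr1 rpredB ?rpredX.
Qed.

(** delta = (p / c) d is integral because p is divisible by zeta_p - 1. The number mu is
integral since p mu and 4 mu are: c mu differs from (d^2 - c) / 4 by an integer multiple of
d^2, as p^2 = 1 modulo 4, and p / c is integral. *)
Lemma cyclotomic_order_scalars : exists delta mu, order_scalars R p zp c delta mu.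
Proof.
pose delta := p%:R / c * d.
pose mu := (c * delta ^+ 2 - 1) / 4%:R.
have n4 : 4%:R != 0 :> K by exact: natr_ext_neq0.
exists delta, mu; split=> //.
- exact: natr_ext_neq0.
- by rewrite rpredM.
- have [q4 q4E] := odd_sqr_mod4 p_odd.
  have ppE : (p%:R * p%:R : K) = 4%:R * q4%:R + 1 by rewrite -natrM q4E natrD natrM.
  have cmu : c * mu \in R.
    have -> : c * mu = (d ^+ 2 - c) / 4%:R + q4%:R * d ^+ 2.
      have q4' : q4%:R = (p%:R * p%:R - 1) / 4%:R :> K by rewrite ppE addrK mulrAC divff // mul1r.
      rewrite q4' /mu /delta; field.
      by rewrite ?n4 ?zp1 ?w0.
    by rewrite rpredD // rpredM ?rpred_nat ?rpredX.
  have pmu : p%:R * mu \in R.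
    have -> : p%:R * mu = p%:R / c * (c * mu) by field; rewrite zp1 w0.
    by rewrite rpredM.
  have mu4 : 4%:R * mu \in R.
    have -> : 4%:R * mu = c * delta ^+ 2 - 1 by rewrite /mu mulrCA divff // mulr1.
    by rewrite rpredB ?rpred1 // rpredM // rpredX // rpredM.
  have -> : mu = p%:R * (p%:R * mu) - q4%:R * (4%:R * mu).
    by rewrite mulrA ppE; ring.
  by rewrite rpredB // rpredM ?rpred_nat.
- by rewrite /mu mulrCA divff // mulr1.
- by rewrite invfM mulrCA divff // mulr1.
by move=> i ip; rewrite -mulrA rpredM // zp1_zpi.
Qed.

End CyclotomicScalars.

Theorem theorem3 (p n : nat) (K : fieldExtType rat) (L : fieldExtType K)
    (zn zp w d : K) (t : L) (Hp : hopfAlgebra K)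
    (p_prime : prime p) (p_odd : odd p)
    (n_gt0 : (0 < n)%N) (p_dvd_n : (p %| n)%N)
    (zn_prim : n.-primitive_root zn) (K_gen : <<1; zn>>%VS = fullv :> {vspace K})
    (zp_prim : p.-primitive_root zp)
    (Hp_nikshych : is_nikshych p zp Hp)
    (w_in : w \in int_adjoin zn)
    (w_unit : exists2 w', w' \in int_adjoin zn & w * w' = 1)
    (t_sqr : t ^+ 2 = (w * (zp - 1))%:A)
    (L_gen : <<1; t>>%VS = fullv :> {vspace L})
    (d_in : d \in int_adjoin zn)
    (dt_int : integralOver (intr : int -> L) (2%:R^-1 * (d%:A + t))) :
  exists Hp' : hopfAlgebra K,
    is_form L Hp Hp' /\
    exists X : submodClosed (over_subring (int_adjoin zn) Hp'), hopf_order X.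
Proof.
have [delta [mu S]] := cyclotomic_order_scalars p_prime p_odd n_gt0 p_dvd_n zn_prim zp_prim
  w_in w_unit t_sqr d_in dt_int.
have [x [pres costr]] := Hp_nikshych.
have p_gt1 := prime_gt1 p_prime.
have [G N] := nik_hopf_of_presentation p_gt1 zp_prim (os_two S) pres costr.
exists (nik_form S N); split.
  exact: (twist_is_form (os_c S) (nik_comult_odd N) (nik_counit_odd N) (nik_antipode_odd N) t_sqr).
have [tau [tau_lin tau_mon]] : exists tau : Hp -> K, scalar tau /\
  forall k i j eps, tau (nik_monom (gen_e0 x) (gen_e1 x) (gen_ua x + gen_va x) (gen_ub x + gen_vb x)
    (gen_g x) k i j eps) = [&& (p %| i)%N, (p %| j)%N & ~~ eps]%:R.
  have p0 := os_p S; case: (p) zp_prim pres p0 => [/prim_order_gt0//|q zp_prim' pres' p0].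
  exact: (nik_trace zp_prim' p0 (os_two S) pres').
exact: nik_hopf_order tau_lin tau_mon.
Qed.
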